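(* Fix $T>0$. For each $0\le r<1$ let $f_T^r$ denote the solution at $t=T$ of the exterior-disk Loewner equation $$\partial_tf_t(z)=z\,\partial_zf_t(z)\,\frac{z+\xi(t)}{z-\xi(t)},\qquad f_0(z)=z,\qquad z\in\Delta,$$ with driving process $\xi=\xi_r=\xi_{r,1/(1-r)}$. Let $f_T$ denote the solution at $t=T$ of the same equation with a unimodular Cauchy process as driving process. Then, as $r\to1$, the law of $e^{-T}f_T^r$ converges weakly in $\Pi(\Sigma')$ to that of $e^{-T}f_T$.
   Context: $\Delta=\{z\in\mathbb{C}_\infty:|z|>1\}$. $\Sigma'$ is the class of univalent functions $f$ in $\Delta$ with expansion $f(z)=z+b_0+\sum_{n\ge1}b_nz^{-n}$ at infinity and with $0\notin f(\Delta)$, with the topology of uniform convergence on compact subsets (of $\{z\in\mathbb{C}:|z|>1\}$). $\Pi(\Sigma')$ is the space of Borel probability measures on $\Sigma'$ with the topology of weak convergence. For $0\le r<1$ and $\lambda>0$, the driving process $\xi_{r,\lambda}$ is defined as follows. $X^r$ is a random variable on $[-\pi,\pi]$ with density $\frac{1}{2\pi}\frac{1-r^2}{1-2r\cos\theta+r^2}$; $N$ is a Poisson process with intensity $\lambda$; $X_1,X_2,\dots$ are i.i.d. with the law of $X^r$, independent of $N$; $Y(0)=0$ and $Y(t)=\sum_{j=1}^{N(t)}X_j$ for $t>0$; and $\xi_{r,\lambda}(t)=\exp\{iY(t)\}$. Here $\lambda=1/(1-r)$. The unimodular Cauchy process is $t\mapsto\exp\{iC(t)\}$, where $C$ is the real-valued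 standard Cauchy (L\'evy) process started at $0$; its law at time $t$ has Fourier coefficients $\mathbb{E}[e^{inC(t)}]=e^{-t|n|}$, $n\in\mathbb{Z}$. The solution $f_t$ of the Loewner equation (holding for a.e. $t$) is the inverse of $g_t$, where $\partial_tg_t(z)=g_t(z)\frac{\xi(t)+g_t(z)}{\xi(t)-g_t(z)}$, $g_0(z)=z$, $z \in \Delta$; it maps $\Delta$ conformally onto the complement of a compact set and $e^{-t}f_t\in\Sigma'$. *)

(* Defs.v *)
From HB Require Import structures.
From mathcomp Require Import all_boot all_order all_algebra.
From mathcomp Require Import all_classical all_reals all_analysis.
From mathcomp Require Import complex.

Set Implicit Arguments.
Unset Strict Implicit.
Unset Printing Implicit Defensive.

Import Order.TTheory GRing.Theory Num.Theory.
Import numFieldNormedType.Exports.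

Local Open Scope classical_set_scope.
Local Open Scope ring_scope.
Local Open Scope complex_scope.

(** Complex numbers are [R[i]].  Its topology and its structure of normed space
    over itself are carried by the alias [R[i]^o], written [Ctop R]. *)
Notation Ctop R := (R[i]^o).

Section Sigma_prime.
Context {R : realType}.

(* The finite part of the exterior disk; the point at infinity is accounted for
   by the Laurent expansion below. *)
Definition Delta : set R[i] := [set z | 1 < `|z|].

(* f(z) = z + b_0 + b_1 / z + b_2 / z^2 + ... near infinity *)
Definition expansion_at_infinity (f : R[i] -> R[i]) :=
  exists (b : nat -> R[i]) (rho : R), forall z, rho%:C < `|z| ->
    (\sum_(0 <= n < N) b n * z ^- n : Ctop R) @[N --> \oo]
      --> (f z - z : Ctop R).

(* Only the values of f on Delta matter.  Univalence at infinity is automatic: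
   f maps infinity to infinity and is finite on Delta. *)
Definition class_Sigma' (f : R[i] -> R[i]) :=
  [/\ forall z, Delta z -> derivable (f : Ctop R -> Ctop R) z 1,
      {in Delta &, injective f},
      expansion_at_infinity f
    & forall z, Delta z -> f z != 0].

Definition compact_in_Delta (K : set (Ctop R)) := compact K /\ K `<=` Delta.

(* Uniform convergence on the compact subsets of Delta. *)
Definition fun_space := {family compact_in_Delta, Ctop R -> Ctop R}.

(* Functions are total, so an element of Sigma' is represented by its extension
   by 0 outside Delta; this makes the representation unique. *)
Definition Sigma'_set : set fun_space :=
  [set f | class_Sigma' f /\ forall z, ~ Delta z -> f z = 0].

Definition idDelta : fun_space := fun z : R[i] => if 1 < `|z| then z else 0.

Lemma idDelta_Sigma' : Sigma'_set idDelta.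
Proof.
split; last by move=> z /negP/negbTE; rewrite /idDelta => ->.
split.
- move=> z Dz.
  have Dn : \forall x \near (z : Ctop R), 1 < `|x|.
    have z1 : 0 < `|z| - 1 by rewrite subr_gt0.
    near=> x; have zx : `|z - x| < `|z| - 1.
      by near: x; exact: (@nbhsx_ballx _ (Ctop R) z _ z1).
    have : `|z| < `|z| - 1 + `|x|.
      by rewrite -{1}(subrK x z) (le_lt_trans (ler_normD _ _))// ltrD2r.
    by rewrite -addrA ltrDl addrC subr_gt0.
  apply: (@near_eq_derivable _ _ _ id); last exact: derivable_id.
  by near=> x; rewrite /idDelta ifT//; near: x.
- by move=> x y /set_mem Dx /set_mem Dy; rewrite /idDelta !ifT.
- exists (fun=> 0), 1 => z z1; rewrite /idDelta z1 subrr.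
  rewrite (_ : (fun _ => _) = fun=> 0); first exact: cvg_cst.
  by apply/funext => N; rewrite big1// => i _; rewrite mul0r.
- move=> z Dz; rewrite /idDelta ifT// -normr_gt0.
  by apply: lt_trans Dz; exact: ltr01.
Unshelve. all: by end_near. Qed.

(* [set_type] carries the subspace topology. *)
Definition Sigma' : Type := set_type Sigma'_set.

HB.instance Definition _ := Topological.on Sigma'.
HB.instance Definition _ :=
  isPointed.Build Sigma' (SigSub (mem_set idDelta_Sigma')).

Definition Sigma'_val (f : Sigma') : R[i] -> R[i] := set_val f.

End Sigma_prime.
Arguments Sigma' : clear implicits.

(* T equipped with its Borel sigma-algebra *)
Notation Borel T := (g_sigma_algebraType (@open T)).

Section weak_convergence.

Definition weakly_cvg {R : realType} {T : ptopologicalType} {I : Type}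
    (F : set_system I) (mu : I -> probability (Borel T) R)
    (nu : probability (Borel T) R) :=
  forall h : T -> R, continuous h -> bounded_fun h ->
    (\int[mu i]_x (h x)%:E)%E @[i --> F] --> (\int[nu]_x (h x)%:E)%E.

End weak_convergence.

Section processes.
Context {R : realType} {d : measure_display} {Omega : measurableType d}.
Variable P : probability Omega R.

Definition mutually_independent {d'} {T : measurableType d'}
    (X : nat -> Omega -> T) :=
  forall (s : seq nat) (A : nat -> set T), uniq s ->
    (forall i, measurable (A i)) ->
    P (\bigcap_(i in [set` s]) X i @^-1` A i) =
    (\prod_(i <- s) P (X i @^-1` A i))%E.

Definition generated_sigma_algebra {I : Type} {d'} {T : measurableType d'}
    (D : set I) (X : I -> Omega -> T) : set (set Omega) :=
  <<s \bigcup_(i in D) preimage_set_system setT (X i) measurable >>.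

Definition independent_sigma_algebras (G H : set (set Omega)) :=
  forall A B, G A -> H B -> P (A `&` B) = (P A * P B)%E.

Definition cadlag (x : R -> R) :=
  (forall t, 0 <= t -> x s @[s --> t^'+] --> x t) /\
  (forall t, 0 < t -> cvg (x s @[s --> t^'-])).

(* Processes are indexed by R, only times t >= 0 being relevant.  Stochastic
   continuity follows from stationarity and right-continuity. *)
Record levy_process (X : R -> Omega -> R) : Prop := {
  levy_measurable : forall t, 0 <= t -> measurable_fun setT (X t) ;
  levy_start : {ae P, forall w, X 0 w = 0} ;
  levy_indep_increments : forall t : nat -> R,
    0 <= t 0%N -> nondecreasing_seq t ->
    mutually_independent (fun k w => X (t k.+1) w - X (t k) w) ;
  levy_stationary : forall s u (A : set R), 0 <= s -> 0 <= u -> measurable A ->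
    P [set w | A (X (s + u) w - X s w)] = P [set w | A (X u w)] ;
  levy_cadlag : {ae P, forall w, cadlag (X ^~ w)} }.

Definition poisson_process (lambda : R) (N : R -> Omega -> nat) :=
  levy_process (fun t w => (N t w)%:R) /\
  forall t k, 0 < t ->
    P [set w | N t w = k] = (poisson_pmf (lambda * t) k)%:E.

(* X has density p on D, and takes values in D almost surely. *)
Definition has_density (D : set R) (p : R -> R) (X : Omega -> R) :=
  measurable_fun setT X /\
  forall A : set R, measurable A ->
    P (X @^-1` A) = (\int[lebesgue_measure]_(x in A `&` D) (p x)%:E)%E.

Definition poisson_kernel (r theta : R) : R :=
  (2 * pi)^-1 * ((1 - r ^+ 2) / (1 - 2 * r * cos theta + r ^+ 2)).

Definition unit_exp (y : R) : R[i] := cos y +i* sin y.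

(* xi is a version of xi_{r, lambda}; the jump X_{j+1} is written X j *)
Definition compound_poisson_driving (r lambda : R) (xi : R -> Omega -> R[i]) :=
  exists (N : R -> Omega -> nat) (X : nat -> Omega -> R),
  [/\ poisson_process lambda N,
      forall j, has_density `[- pi, pi] (poisson_kernel r) (X j),
      mutually_independent X
    & independent_sigma_algebras
        (generated_sigma_algebra [set t | 0 <= t] N)
        (generated_sigma_algebra setT X)] /\
  forall t w, 0 <= t -> xi t w = unit_exp (\sum_(j < N t w) X j w).

Definition cauchy_process (C : R -> Omega -> R) :=
  levy_process C /\
  forall t, 0 < t ->
    has_density setT (fun x => t / (pi * (t ^+ 2 + x ^+ 2))) (C t).

Definition unimodular_cauchy_driving (xi : R -> Omega -> R[i]) :=
  exists2 C, cauchy_process C &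
    forall t w, 0 <= t -> xi t w = unit_exp (C t w).

End processes.

Section loewner.
Context {R : realType}.

Definition abs_continuous (a b : R) (c : R -> R[i]) :=
  forall e : R, 0 < e -> exists2 delta : R, 0 < delta &
    forall (n : nat) (u v : nat -> R),
      (forall k, (k < n)%N -> [/\ a <= u k, u k <= v k & v k <= b]) ->
      (forall j k, (j < k < n)%N -> v j <= u k) ->
      \sum_(k < n) (v k - u k) < delta ->
      \sum_(k < n) `|c (v k) - c (u k)| < e%:C.

(* R[i] is not a normed space over R in the library, hence the explicit
   difference quotient. *)
Definition time_derivative (c : R -> R[i]) (t : R) (l : R[i]) :=
  ((h^-1)%:C * (c (t + h) - c t) : Ctop R) @[h --> (0 : R)^'] --> (l : Ctop R).

(* g_t(w) = z, where g solves the Loewner ODE driven by xi with g_0 = id: the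
   absolutely continuous trajectory c = g_.(w) stays in Delta up to time t. *)
Definition loewner_flow (xi : R -> R[i]) (t : R) (w z : R[i]) :=
  exists c : R -> R[i],
  [/\ c 0 = w, c t = z,
      forall s, 0 <= s <= t -> Delta (c s),
      abs_continuous 0 t c
    & {ae lebesgue_measure, forall s, 0 <= s <= t ->
        time_derivative c s (c s * ((xi s + c s) / (xi s - c s)))}].

(* (f_t), 0 <= t <= T, is the solution of the Loewner equation driven by xi. *)
Record loewner_solution (T : R) (xi : R -> R[i])
    (f : R -> R[i] -> R[i]) : Prop := {
  loewner_init : forall z, Delta z -> f 0 z = z ;
  loewner_class : forall t, 0 <= t <= T ->
    class_Sigma' (fun z => (expR (- t))%:C * f t z) ;
  loewner_ac : forall z, Delta z -> abs_continuous 0 T (fun t => f t z) ;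
  loewner_pde : {ae lebesgue_measure, forall t, 0 <= t <= T ->
    forall z, Delta z ->
      time_derivative (fun s => f s z) t
        (z * ('D_1 (f t : Ctop R -> Ctop R) z : R[i]) *
         ((z + xi t) / (z - xi t)))} ;
  loewner_inverse : forall t z w, 0 <= t <= T -> Delta z ->
    (f t z = w <-> loewner_flow xi t w z) }.

End loewner.

(* Main.v *)
(** Time reversal turns [f_T] into the endpoint of the flow of
    [u' = u (u + x) / (u - x)], [x = xi (T - s)], along which [|u|] increases, so that the
    field is Lipschitz in [u] and in [x].  Hence [e^{-T} f_T] satisfies Lipschitz bounds
    depending only on [T], and it is approximated by an Euler scheme with [N] steps, with
    an expected error controlled by the expected oscillation of [xi] on intervals of
    length [T / N].  This oscillation is the same for all [r], since
    [E xi(t) = exp (- t)] for all the driving processes considered here.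

    A bounded continuous [h] on Sigma' is approximated from below, among functions
    satisfying these Lipschitz bounds, by Lipschitz functions of finitely many values;
    applied to the Euler scheme these are Lipschitz functions of the increments of the
    driving angle, hence uniform limits of trigonometric polynomials.  Independence of
    the increments reduces the convergence of their expectations to
    [exp (- t (1 - r^m) / (1 - r)) --> exp (- t m)].  This gives a lower bound for the
    lower limit of [E h], and [- h] gives the upper bound. *)

Require Import Defs.
From HB Require Import structures.
From mathcomp Require Import all_boot all_order all_algebra.
From mathcomp Require Import all_classical all_reals all_analysis.
From mathcomp Require Import measurable_realfun complex.
From mathcomp Require Import ring lra.

Set Implicit Arguments.
Unset Strict Implicit.
Unset Printing Implicit Defensive.

Import Order.TTheory GRing.Theory Num.Theory.
Import numFieldNormedType.Exports.

Local Open Scope classical_set_scope.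
Local Open Scope ring_scope.
Local Open Scope complex_scope.

(** * Absolutely continuous functions with a.e. derivative bounds *)

(** No compactness in Sigma' is used. Tightness is replaced by one estimate: the first Fourier
    coefficient of the Poisson kernel is [r], so the intensity [1 / (1 - r)] gives increments of the
    angle over a time [s] the mean cosine [exp (- s)] for every [r], and the mean chord between two
    values of the driving process is bounded in terms of the time lag alone. This holds in mean
    only: jumps occur at rate [1 / (1 - r)], so pathwise error bounds of the scheme are not uniform
    in [r]. Hence schemes with [N] and with [N * m] steps are compared: [N] is fixed before [r]
    moves, while [m] tends to infinity along each path and disappears through a Fatou-type
    inequality. The oscillation then enters as a finite sum whose expectation is bounded term by
    term. Approximation from below suffices because the two sides use different halves of it: for
    the single Cauchy law the envelopes converge to [h] in mean, and for the laws indexed by [r]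
    only the inequality [envelope <= h] is invoked. So no uniformity in [r] of the convergence of
    the envelopes is required. *)

Lemma eq_ler (R : realType) (x y : R) : x = y -> x <= y.
Proof. by move=> ->. Qed.

(** Cousin's compactness argument as an induction on intervals: the supremum of the reachable points
    is itself reachable by the local hypothesis there, and the same hypothesis goes beyond it unless
    it is [b]. *)
Lemma cousin (R : realType) (Q : R -> R -> Prop) (a b : R) : a <= b ->
  (forall x y z, a <= x -> x <= y -> y <= z -> z <= b ->
     Q x y -> Q y z -> Q x z) ->
  (forall s, a <= s <= b -> exists2 e, 0 < e &
     forall u v, a <= u -> v <= b -> s - e < u -> u <= s -> s <= v ->
       v < s + e -> Q u v) ->
  Q a b.
Proof.
move=> ab Qtrans Qloc.
pose A := [set x | a <= x <= b /\ Q a x].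
have Aa : A a.
  split; first by rewrite lexx.
  have [|e e0 H] := Qloc a; first by rewrite lexx.
  by apply: H; rewrite ?lexx ?ltrBlDr ?ltrDl.
have Aub : ubound A b by move=> x [/andP[]].
have hA : has_sup A by split; [exists a | exists b].
have sa : a <= sup A by apply: ub_le_sup => //; exists b.
have sb : sup A <= b by apply: ge_sup => //; exists a.
have [|e e0 H] := Qloc (sup A); first by rewrite sa.
have [x [/andP[ax xb] Qax] xs] := sup_adherent e0 hA.
have xle : x <= sup A by apply: ub_le_sup; [exists b|split=> //; apply/andP].
have ext v : sup A <= v -> v <= b -> v < sup A + e -> Q a v.
  by move=> sv vb ve; apply: (Qtrans a x v) => //; [lra|apply: H].
have Qsup : Q a (sup A) by apply: ext; rewrite ?ltrDl.
have [sltb|] := ltP (sup A) b; last first.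
  by move=> bs; rewrite (_ : b = sup A)//; apply/eqP; rewrite eq_le bs.
have [v [vs vb ve]] : exists v, [/\ sup A < v, v <= b & v < sup A + e].
  exists (Num.min b (sup A + e / 2)); split.
  - by rewrite lt_min sltb ltrDl divr_gt0.
  - by rewrite ge_min lexx.
  - by rewrite gt_min ltrD2l; apply/orP; right; lra.
have : v <= sup A.
  apply: ub_le_sup; first by exists b.
  by split; [apply/andP; split=> //; lra | apply: ext => //; exact: ltW].
by rewrite leNgt vs.
Qed.

(* Henstock's argument: on a fine tagged partition the intervals tagged in the
   exceptional null set lie in an open set of small measure, and absolute
   continuity makes their contribution small. *)
Lemma ac_nonincreasing (R : realType) (psi : R -> R) (a b : R) : a <= b ->
  (forall e : R, 0 < e -> exists2 delta : R, 0 < delta &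
    forall (n : nat) (u v : nat -> R),
      (forall k, (k < n)%N -> [/\ a <= u k, u k <= v k & v k <= b]) ->
      (forall j k, (j < k < n)%N -> v j <= u k) ->
      \sum_(k < n) (v k - u k) < delta ->
      \sum_(k < n) (psi (v k) - psi (u k)) < e) ->
  {ae lebesgue_measure, forall s, a <= s <= b ->
    forall e : R, 0 < e -> exists2 delta : R, 0 < delta &
    forall u v, a <= u -> v <= b -> s - delta < u -> u <= s -> s <= v ->
      v < s + delta -> psi v - psi u <= e * (v - u)} ->
  psi b <= psi a.
Proof.
move=> ab ac [E0 [mE0 E00 HE0]].
have [E [mE E0' HE]] : exists E : set R, [/\ measurable E,
    (lebesgue_measure E <= 0)%E & E0 = E].
  by exists E0; split => //; rewrite le_eqVlt; apply/orP; left; exact/eqP.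
rewrite {}HE in HE0 => {E0 mE0 E00}; have {E0'}E0 : lebesgue_measure E = 0%E.
  by apply/eqP; rewrite eq_le E0' measure_ge0.
suff key e : 0 < e -> psi b - psi a <= e * (b - a) + e.
  rewrite -subr_le0 leNgt; apply/negP => psi0.
  have p1 : 0 < b - a + 1 by lra.
  move: psi0 key; set D := psi b - psi a => D0.
  have q0 : 0 < D / (b - a + 1) / 2 by rewrite !divr_gt0.
  move=> /(_ _ q0).
  have -> : D / (b - a + 1) / 2 * (b - a) + D / (b - a + 1) / 2 = D / 2.
    by field; rewrite lt0r_neq0.
  by rewrite leNgt gtr_pMr ?invf_lt1 ?ltr1n.
move=> e0.
have [d d0 Hd] := ac e e0.
have [|U [oU EU Ud]] := lebesgue_regularity_outer mE _ d0.
  by have -> // : (lebesgue_measure E < +oo)%E by rewrite E0 ltry.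
have {}Ud : (lebesgue_measure (U `\` E) < d%:E)%E by exact: Ud.
have mU : measurable U by exact: open_measurable.
have {}Ud : (lebesgue_measure U < d%:E)%E.
  have -> : U = E `|` (U `\` E) by first [rewrite setDUK|rewrite setDKU|rewrite setUD].
  have -> : (lebesgue_measure (E `|` (U `\` E)) =
      lebesgue_measure E + lebesgue_measure (U `\` E))%E.
    apply: measureU => //; first exact: measurableD.
    by rewrite setDE setICA setICr setI0.
  by rewrite E0 add0e.
(* Half-open intervals make [mu] additive under concatenation, so that the length budget in [Q] adds
   up. The list in [Q] collects the intervals tagged in the null set; the rest of the interval
   contributes at most slope [e]. *)
pose mu (x y : R) := lebesgue_measure (U `&` `]x, y]).
pose Q x y := exists l : seq (R * R),
  [/\ pairwise (fun p q => p.2 <= q.1) l,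
      all (fun p => [&& x <= p.1, p.1 <= p.2 & p.2 <= y]) l,
      ((\sum_(p <- l) (p.2 - p.1))%:E <= mu x y)%E &
      psi y - psi x <= e * (y - x) + \sum_(p <- l) (psi p.2 - psi p.1)].
have : Q a b.
  apply: cousin => //.
    move=> x y z ax xy yz zb [l [p1 a1 m1 i1]] [m [p2 a2 m2 i2]].
    exists (l ++ m); split.
    - rewrite pairwise_cat p1 p2 !andbT; apply/allrelP => p q pl qm.
      move/allP: a1 => /(_ _ pl)/and3P[_ _ h1].
      move/allP: a2 => /(_ _ qm)/and3P[h2 _ _].
      exact: le_trans h1 h2.
    - rewrite all_cat; apply/andP; split.
        apply: sub_all a1 => p /and3P[-> -> /=]; move/le_trans; exact.
      by apply: sub_all a2 => p /and3P[h -> -> /=]; rewrite (le_trans xy).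
    - rewrite big_cat/= EFinD.
      have -> : mu x z = (mu x y + mu y z)%E.
        rewrite /mu; have -> : U `&` `]x, z] = (U `&` `]x, y]) `|` (U `&` `]y, z]).
          rewrite -setIUr; congr (_ `&` _).
          apply/seteqP; split=> t /=; rewrite !in_itv/=.
            move=> /andP[xt tz].
            by case: (leP t y) => ty; [left|right]; rewrite ?xt ?ty ?tz.
          by case=> /andP[h1 h2]; apply/andP; split; lra.
        apply: measureU.
        + exact: measurableI.
        + exact: measurableI.
        + rewrite setIACA setIid [X in _ `&` X](_ : _ = set0) ?setI0//.
          by apply/seteqP; split=> t //=; rewrite !in_itv/=; lra.
      exact: leeD.
    - by rewrite big_cat/=; lra.
  move=> s sab.
  (* A tag in [E] puts its whole interval, contained in [U], into the list; any other tag leaves the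
     list empty and uses the slope bound. *)
  have [Es|nEs] := pselect (E s).
    have := open_itvoo_subset oU (EU _ Es).
    move=> [r /= r0 rU]; exists (r / 2); first exact: divr_gt0.
    move=> u v au vb su us sv vs.
    exists [:: (u, v)]; split => //=.
    - by rewrite !lexx (le_trans us sv).
    - rewrite big_seq1 /= /mu setIidr; last first.
        apply: subset_trans (rU (r / 2) _ _).
        + by move=> t; rewrite /= !in_itv/= => /andP[h1 h2]; apply/andP; lra.
        + by rewrite /= sub0r normrN gtr0_norm; lra.
        + by rewrite divr_gt0.
      rewrite lebesgue_measure_itv/= lte_fin; case: ltP => uv //.
      by rewrite lee_fin; lra.
    - by rewrite big_seq1/= lerDr mulr_ge0 ?subr_ge0 ?(le_trans us sv)// ltW.
  have [r r0 Hr] : exists2 delta : R, 0 < delta &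
    forall u v, a <= u -> v <= b -> s - delta < u -> u <= s -> s <= v ->
      v < s + delta -> psi v - psi u <= e * (v - u).
    apply: contrapT => /= h; apply/nEs/HE0 => /= /(_ sab e e0).
    exact: h.
  exists r => // u v au vb su us sv vs.
  exists [::]; split => //=; first by rewrite big_nil.
  by rewrite big_nil addr0; exact: Hr.
move=> [l [pl al ml il]].
apply: le_trans il _; rewrite lerD2l.
have ln k : (k < size l)%N -> nth (a, a) l k \in l by exact: mem_nth.
have := Hd (size l) (fun k => (nth (a, a) l k).1) (fun k => (nth (a, a) l k).2).
rewrite -(big_mkord xpredT (fun k => (nth (a, a) l k).2 - (nth (a, a) l k).1)).
rewrite -(big_mkord xpredT
  (fun k => psi (nth (a, a) l k).2 - psi (nth (a, a) l k).1)).
rewrite -(big_nth (a, a) xpredT (fun p => p.2 - p.1)).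
rewrite -(big_nth (a, a) xpredT (fun p => psi p.2 - psi p.1)).
move=> H; apply/ltW/H.
- by move=> k /ln lk; move/allP: al => /(_ _ lk)/and3P.
- by move=> j k /andP[jk kl]; move/pairwiseP : pl;
    apply => //; rewrite inE//; exact: ltn_trans jk kl.
- rewrite -lte_fin; apply: le_lt_trans Ud; apply: le_trans ml _.
  by apply: le_measure; rewrite ?inE//; exact: measurableI.
Qed.

(** The modulus as an element of [R], so that real inequalities and real analysis apply to it; the
    norm of [R[i]] takes its values in [R[i]]. *)
Notation cabs := Normc.normc.

(** * The Loewner vector field and its Euler scheme *)

Section modulus.
Context {R : realType}.
Implicit Types z w u v x y : R[i].

Lemma norm_cabs z : `|z| = (cabs z)%:C. Proof. by []. Qed.

Lemma DeltaE z : Delta z <-> 1 < cabs z.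
Proof. by rewrite /Delta /= norm_cabs ltcR. Qed.

Lemma cabs_ge0 z : 0 <= cabs z.
Proof. by case: z => a b /=; exact: sqrtr_ge0. Qed.

Lemma cabsB z w : cabs (z - w) = cabs (w - z).
Proof. by rewrite -normcN opprB. Qed.

Lemma cabs_tri z w v : cabs (z - v) <= cabs (z - w) + cabs (w - v).
Proof. by rewrite -[z - v](subrKA w); exact: le_normcD. Qed.

Lemma cabs_leD z w : cabs z <= cabs (z - w) + cabs w.
Proof. by rewrite -{1}(subrK w z); exact: le_normcD. Qed.

Lemma cabs_real (r : R) : cabs r%:C = `|r|.
Proof. by rewrite /= expr0n/= addr0 sqrtr_sqr. Qed.

Lemma cabsX2 z : cabs z ^+ 2 = complex.Re z ^+ 2 + complex.Im z ^+ 2.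
Proof. by case: z => a b /=; rewrite sqr_sqrtr// addr_ge0// sqr_ge0. Qed.

Lemma cabs_sum n (F : 'I_n -> R[i]) :
  cabs (\sum_i F i) <= \sum_i cabs (F i).
Proof.
elim/big_ind2 : _ => //; first by rewrite Normc.normc0.
by move=> a b c d ab cd; apply: le_trans (le_normcD _ _) _; exact: lerD.
Qed.

Lemma cabs_unit_exp (r : R) : cabs (unit_exp r) = 1.
Proof. by rewrite /= cos2Dsin2 sqrtr1. Qed.

End modulus.

Section vector_field.
Context {R : realType}.
Implicit Types u v x y : R[i].

(** The Loewner field with the opposite sign: trajectories of [loewner_flow] have derivative
    [- lfield], so a scheme that starts at time [T] and runs back to time 0 adds [lfield]. *)
Definition lfield u x := u * ((u + x) / (u - x)).

Lemma gap_gt0 (rho : R) u x : 1 < rho -> cabs x = 1 -> rho <= cabs u ->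
  rho - 1 <= cabs (u - x).
Proof. by move=> r1 x1 ru; have := cabs_leD u x; rewrite x1; lra. Qed.

Lemma gap_neq0 (rho : R) u x : 1 < rho -> cabs x = 1 -> rho <= cabs u ->
  u - x != 0.
Proof.
move=> r1 x1 ru; have := gap_gt0 r1 x1 ru.
by apply: contraTneq => ->; rewrite Normc.normc0; lra.
Qed.

(** Both constants come from factoring a difference of fields: [1 - 2 x^2 / ((u - x) (v - x))] in
    the point and [2 + 2 ((x + y) u - x y) / ((u - x) (u - y))] in the driving value, with all
    denominators at distance at least [rho - 1] from 0. *)
Definition lipz (rho : R) := 1 + 2 / (rho - 1) ^+ 2.
Definition lipx (rho : R) := 2 + 2 * ((2 * rho + 1) / (rho - 1) ^+ 2).

Lemma cabs2 : cabs (2 : R[i]) = 2.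
Proof. by rewrite -[2 : R[i]](rmorph_nat (real_complex R)) cabs_real ger0_norm. Qed.

Lemma lfield_lipz (rho : R) u v x : 1 < rho -> cabs x = 1 ->
  rho <= cabs u -> rho <= cabs v ->
  cabs (lfield u x - lfield v x) <= lipz rho * cabs (u - v).
Proof.
move=> r1 x1 ru rv.
have ux := gap_neq0 r1 x1 ru; have vx := gap_neq0 r1 x1 rv.
have -> : lfield u x - lfield v x =
    (u - v) * (1 - 2 * x ^+ 2 / ((u - x) * (v - x))).
  by rewrite /lfield; field; rewrite ux vx.
rewrite Normc.normcM mulrC ler_wpM2r ?cabs_ge0//.
apply: le_trans (le_normcD _ _) _; rewrite normcN Normc.normc1 lerD2l.
rewrite !Normc.normcM Normc.normcV !Normc.normcM x1 cabs2 !mulr1.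
rewrite ler_pM2l// lef_pV2 ?posrE ?exprn_gt0 ?subr_gt0//; last first.
  by rewrite mulr_gt0//; (apply: lt_le_trans (gap_gt0 r1 x1 _) => //); lra.
by rewrite expr2; apply: ler_pM; rewrite ?subr_ge0 ?gap_gt0// ltW.
Qed.

Lemma lfield_lipx (rho : R) u x y : 1 < rho -> cabs x = 1 -> cabs y = 1 ->
  rho <= cabs u -> cabs (lfield u x - lfield u y) <= lipx rho * cabs (x - y).
Proof.
move=> r1 x1 y1 ru.
have ux := gap_neq0 r1 x1 ru; have uy := gap_neq0 r1 y1 ru.
have -> : lfield u x - lfield u y =
    (x - y) * (2 + 2 * (((x + y) * u - x * y) / ((u - x) * (u - y)))).
  by rewrite /lfield; field; rewrite ux uy.
rewrite Normc.normcM mulrC ler_wpM2r ?cabs_ge0//.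
apply: le_trans (le_normcD _ _) _; rewrite cabs2 lerD2l.
rewrite Normc.normcM cabs2 ler_pM2l//.
rewrite Normc.normcM Normc.normcV Normc.normcM.
have n1 : cabs ((x + y) * u - x * y) <= 2 * cabs u + 1.
  apply: le_trans (le_normcD _ _) _; rewrite normcN !Normc.normcM x1 y1 mulr1.
  rewrite lerD2r ler_wpM2r ?cabs_ge0//.
  by apply: le_trans (le_normcD _ _) _; rewrite x1 y1.
have d0 z : cabs z = 1 -> 0 < cabs u - 1 <= cabs (u - z).
  by move=> z1; have := cabs_leD u z; rewrite z1 => ?; apply/andP; split; lra.
have /andP[d1 d2] := d0 _ x1; have /andP[_ d3] := d0 _ y1.
apply: (@le_trans _ _ ((2 * cabs u + 1) / (cabs u - 1) ^+ 2)).
  apply: ler_pM; rewrite ?cabs_ge0 ?invr_ge0 ?mulr_ge0 ?cabs_ge0//.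
  rewrite lef_pV2 ?posrE ?exprn_gt0 ?mulr_gt0//; try lra.
  by rewrite expr2; apply: ler_pM => //; exact: ltW.
rewrite ler_pdivlMr ?exprn_gt0 ?subr_gt0// mulrAC ler_pdivrMr ?exprn_gt0//.
(* The cross-multiplied difference factors through [cabs u - rho]: this is the monotonicity of
   [(2 s + 1) / (s - 1)^2] for [s > 1]. *)
have h : 0 <= (cabs u - rho) *
  (2 * (cabs u - 1) * (rho - 1) + 3 * ((cabs u - 1) + (rho - 1))).
  rewrite mulr_ge0 ?subr_ge0// addr_ge0// !mulr_ge0//; lra.
rewrite -subr_ge0; apply: le_trans h _; rewrite le_eqVlt; apply/orP; left.
by apply/eqP; ring.
Qed.

Lemma lfield_bound (rho : R) u x : 1 < rho -> cabs x = 1 ->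
  rho <= cabs u -> cabs (lfield u x) <= (rho + 1) / (rho - 1) * cabs u.
Proof.
move=> r1 x1 ru; rewrite /lfield mulrC Normc.normcM ler_wpM2r ?cabs_ge0//.
rewrite Normc.normcM Normc.normcV.
have := cabs_leD u x; rewrite x1 => h1; have := le_normcD u x; rewrite x1 => h2.
apply: (@le_trans _ _ ((cabs u + 1) / (cabs u - 1))).
  apply: ler_pM; rewrite ?cabs_ge0 ?invr_ge0 ?cabs_ge0//.
  by rewrite lef_pV2 ?posrE; lra.
rewrite ler_pdivlMr ?subr_gt0// mulrAC ler_pdivrMr; first lra.
lra.
Qed.

Lemma cabs_shift u v (h : R) : cabs (u + h%:C * v) ^+ 2 =
  cabs u ^+ 2 + 2 * h * (complex.Re u * complex.Re v + complex.Im u * complex.Im v) + h ^+ 2 * cabs v ^+ 2.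
Proof. by rewrite !cabsX2; case: u => a b; case: v => c d /=; ring. Qed.

(** The expression is the real inner product of [u - x] and [u + x], equal to [|u|^2 - |x|^2].
    Equivalently [(u + x) / (u - x)] has nonnegative real part, which is why the reversed flow moves
    away from the circle. *)
Lemma outward u x : cabs x = 1 -> 1 < cabs u ->
  0 <= complex.Re (u - x) * complex.Re (u + x) + complex.Im (u - x) * complex.Im (u + x).
Proof.
move=> x1 u1.
have -> : complex.Re (u - x) * complex.Re (u + x) + complex.Im (u - x) * complex.Im (u + x) =
    cabs u ^+ 2 - cabs x ^+ 2.
  by rewrite !cabsX2; case: u {u1} => a b; case: x {x1} => c d /=; ring.
by rewrite x1 expr1n subr_ge0 exprn_ege1// ltW.
Qed.

Lemma lfield_step u x (h : R) : u - x != 0 ->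
  u + h%:C * lfield u x = u / (u - x) * (u - x + h%:C * (u + x)).
Proof. by move=> ux; rewrite /lfield; field. Qed.

Lemma euler_grows u x (h : R) : 0 <= h -> cabs x = 1 -> 1 < cabs u ->
  cabs u <= cabs (u + h%:C * lfield u x).
Proof.
move=> h0 x1 u1; have ux := gap_neq0 u1 x1 (lexx _).
rewrite lfield_step// Normc.normcM.
have {1}-> : u = u / (u - x) * (u - x) by rewrite divfK.
rewrite Normc.normcM ler_wpM2l ?cabs_ge0// -ler_sqr ?nnegrE ?cabs_ge0//.
rewrite cabs_shift -addrA lerDl addr_ge0//; last by rewrite mulr_ge0 ?sqr_ge0.
by rewrite mulr_ge0 ?outward// mulr_ge0.
Qed.

(** The first-order term has a favourable sign, so a step against the field enlarges the modulus by
    a factor [1 + O(h^2)] at most; such an error is harmless for the monotonicity of a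
    differentiable trajectory. *)
Lemma euler_backward u x (h : R) : 0 <= h -> cabs x = 1 -> 1 < cabs u ->
  cabs (u - h%:C * lfield u x) <=
  cabs u * (1 + h ^+ 2 * (cabs (u + x) / cabs (u - x)) ^+ 2).
Proof.
move=> h0 x1 u1; have ux := gap_neq0 u1 x1 (lexx _).
have -> : u - h%:C * lfield u x = u + (- h)%:C * lfield u x.
  by rewrite rmorphN mulNr.
rewrite lfield_step// Normc.normcM.
have -> : cabs u = cabs (u / (u - x)) * cabs (u - x).
  by rewrite -Normc.normcM divfK.
rewrite -mulrA ler_wpM2l ?cabs_ge0//.
set A := cabs (u - x); set B := cabs (u + x).
have A0 : 0 < A by rewrite lt_neqAle cabs_ge0 andbT eq_sym; apply: contra_neq ux => /Normc.eq0_normc.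
have q0 : 0 <= h ^+ 2 * (B / A) ^+ 2 by rewrite mulr_ge0 ?sqr_ge0.
rewrite -ler_sqr ?nnegrE ?cabs_ge0 ?mulr_ge0 ?cabs_ge0 ?addr_ge0 ?(ltW A0)//.
rewrite cabs_shift.
apply: (@le_trans _ _ (A ^+ 2 + h ^+ 2 * B ^+ 2)).
  rewrite -/A -/B sqrrN lerD2r gerDl.
  by have := mulr_ge0 h0 (outward x1 u1); lra.
move: q0; set q := h ^+ 2 * (B / A) ^+ 2 => q0.
have -> : h ^+ 2 * B ^+ 2 = A ^+ 2 * q by rewrite /q; field; rewrite lt0r_neq0.
have -> : (A * (1 + q)) ^+ 2 = A ^+ 2 + A ^+ 2 * q + A ^+ 2 * (q + q ^+ 2) by ring.
by rewrite lerDl mulr_ge0 ?sqr_ge0// addr_ge0 ?sqr_ge0.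
Qed.

End vector_field.

Lemma ae_imp d (T : semiRingOfSetsType d) (R : realFieldType)
    (mu : set T -> \bar R) (P Q : T -> Prop) :
  (forall x, P x -> Q x) -> {ae mu, forall x, P x} -> {ae mu, forall x, Q x}.
Proof.
by move=> PQ [E [mE E0 HE]]; exists E; split=> // x nQ; apply: HE => Px; apply/nQ/PQ.
Qed.

(** * Estimates along absolutely continuous trajectories *)

Section trajectories.
Context {R : realType}.
Implicit Types c : R -> R[i].

Lemma time_derivative_local c s l : time_derivative c s l ->
  forall e : R, 0 < e -> exists2 d : R, 0 < d &
    forall h, `|h| < d -> cabs (c (s + h) - c s - h%:C * l) <= e * `|h|.
Proof.
move=> /(@cvgrPdist_lt _ (Ctop R)) H e e0.
have e0' : (0 : R[i]) < e%:C by rewrite ltcR.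
have [d d0 Hd] := H _ e0'; exists d => // h hd.
have [->|h0] := eqVneq h 0.
  by rewrite addr0 subrr mul0r subrr Normc.normc0 normr0 mulr0.
have := Hd h; rewrite /= sub0r normrN => /(_ hd h0).
rewrite -[`|_|]/((cabs _)%:C) ltcR => /ltW.
rewrite -(ler_pM2r (_ : 0 < `|h|)) ?normr_gt0//; apply: le_trans.
rewrite -(cabs_real h) -Normc.normcM cabsB le_eqVlt; apply/orP; left; apply/eqP.
congr cabs; rewrite mulrBl mulrAC -rmorphM mulVf// mul1r; ring.
Qed.

Lemma abs_continuousP c (a b : R) : abs_continuous a b c ->
  forall e : R, 0 < e -> exists2 d : R, 0 < d &
    forall (n : nat) (u v : nat -> R),
      (forall k, (k < n)%N -> [/\ a <= u k, u k <= v k & v k <= b]) ->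
      (forall j k, (j < k < n)%N -> v j <= u k) ->
      \sum_(k < n) (v k - u k) < d ->
      \sum_(k < n) cabs (c (v k) - c (u k)) < e.
Proof.
move=> ac e e0; have [d d0 H] := ac e e0; exists d => // n u v h1 h2 h3.
have := H n u v h1 h2 h3.
rewrite (eq_bigr (fun k : 'I_n => (cabs (c (v k) - c (u k)))%:C))//.
by rewrite -rmorph_sum/= ltcR.
Qed.

(** Only signed increments of [psi] are bounded, from above, which is the form that
    [ac_nonincreasing] takes as hypothesis. *)
Lemma ac_transfer c (a b K : R) (psi : R -> R) : abs_continuous a b c ->
  0 <= K ->
  (forall u v, a <= u -> u <= v -> v <= b ->
    psi v - psi u <= cabs (c v - c u) + K * (v - u)) ->
  forall e : R, 0 < e -> exists2 d : R, 0 < d &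
    forall (n : nat) (u v : nat -> R),
      (forall k, (k < n)%N -> [/\ a <= u k, u k <= v k & v k <= b]) ->
      (forall j k, (j < k < n)%N -> v j <= u k) ->
      \sum_(k < n) (v k - u k) < d ->
      \sum_(k < n) (psi (v k) - psi (u k)) < e.
Proof.
move=> ac K0 H e e0.
have e2 : 0 < e / 2 by rewrite divr_gt0.
have [d d0 Hd] := abs_continuousP ac e2.
have K1 : 0 < K + 1 by lra.
exists (Num.min d (e / 2 / (K + 1))); first by rewrite lt_min d0 divr_gt0.
move=> n u v h1 h2; rewrite lt_min => /andP[/(Hd n u v h1 h2) s1].
rewrite ltr_pdivlMr// => s2.
have s0 : 0 <= \sum_(k < n) (v k - u k).
  by apply: sumr_ge0 => k _; have [] := h1 k (ltn_ord k); rewrite subr_ge0.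
apply: (@le_lt_trans _ _ (\sum_(k < n) (cabs (c (v k) - c (u k)) +
    K * (v k - u k)))).
  by apply: ler_sum => k _; have [] := h1 k (ltn_ord k); exact: H.
by rewrite big_split/= -mulr_sumr; lra.
Qed.

Lemma ac_sub c (a b a' b' : R) : a <= a' -> b' <= b ->
  abs_continuous a b c -> abs_continuous a' b' c.
Proof.
move=> aa bb ac e e0; have [d d0 H] := ac e e0; exists d => // n u v h1.
apply: H => k /h1[h3 h4 h5]; split=> //.
  exact: le_trans aa h3.
exact: le_trans h5 bb.
Qed.

(** The derivative is compared with a fixed vector [w]: the choice [w = 0] gives a Lipschitz bound
    in time, and [w] equal to a frozen value of the field gives the local error of an Euler step. *)
Lemma mean_value_ac c (a b B : R) (w : R[i]) (l : R -> R[i]) :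
  a <= b -> 0 <= B -> abs_continuous a b c ->
  {ae lebesgue_measure, forall s, a <= s <= b -> time_derivative c s (l s)} ->
  (forall s, a <= s <= b -> cabs (l s - w) <= B) ->
  cabs (c b - c a - (b - a)%:C * w) <= B * (b - a).
Proof.
move=> ab B0 ac dc lB.
pose psi x := cabs (c x - c a - (x - a)%:C * w) - B * x.
have : psi b <= psi a.
  apply: ac_nonincreasing => //.
    apply: (ac_transfer (K := cabs w) ac (cabs_ge0 _)) => u v au uv vb.
    have : cabs (c v - c a - (v - a)%:C * w) <=
        cabs (c v - c u - (v - u)%:C * w) + cabs (c u - c a - (u - a)%:C * w).
      apply: le_trans (le_normcD _ _); rewrite le_eqVlt; apply/orP; left.
      by apply/eqP; congr cabs; rewrite !rmorphB/=; ring.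
    have := le_normcD (c v - c u) (- ((v - u)%:C * w)).
    rewrite normcN Normc.normcM cabs_real ger0_norm ?subr_ge0// /psi => h1 h2.
    have := mulr_ge0 B0 (_ : 0 <= v - u); rewrite subr_ge0 => /(_ uv).
    by move: h1 h2; lra.
  apply: ae_imp dc => s H sab e e0.
  have [d d0 Hd] := time_derivative_local (H sab) e0.
  exists d => // u v au vb su us sv vs.
  have hv : cabs (c v - c s - (v - s)%:C * l s) <= e * (v - s).
    have := Hd (v - s); rewrite subrKC ger0_norm ?subr_ge0//; apply; lra.
  have hu : cabs (c u - c s - (u - s)%:C * l s) <= e * (s - u).
    have := Hd (u - s); rewrite subrKC ler0_norm ?subr_le0// opprB; apply; lra.
  have hl : cabs ((v - u)%:C * (l s - w)) <= B * (v - u).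
    rewrite Normc.normcM cabs_real ger0_norm ?subr_ge0 ?(le_trans us)// mulrC.
    by rewrite ler_wpM2r ?lB// subr_ge0 (le_trans us).
  have : cabs (c v - c a - (v - a)%:C * w) <=
      cabs (c v - c s - (v - s)%:C * l s) +
      cabs (- (c u - c s - (u - s)%:C * l s)) +
      cabs ((v - u)%:C * (l s - w)) + cabs (c u - c a - (u - a)%:C * w).
    have T (p q r t : R[i]) :
        cabs (p + q + r + t) <= cabs p + cabs q + cabs r + cabs t.
      do 3 (apply: le_trans (le_normcD _ _) _; rewrite ?lerD2r).
      exact: lexx.
    apply: le_trans (T _ _ _ _); rewrite le_eqVlt; apply/orP; left.
    by apply/eqP; congr cabs; rewrite !rmorphB/=; ring.
  by rewrite normcN /psi; lra.
rewrite /psi !subrr mul0r subrr Normc.normc0; lra.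
Qed.

(** At a point [s] of differentiability the trajectory agrees to first order with an Euler step on
    each side: the past is farther out by [euler_grows], and the future is farther in up to second
    order by [euler_backward]. *)
Lemma decreasing_ac c (a b : R) (xi : R -> R[i]) : a <= b ->
  abs_continuous a b c ->
  (forall s, a <= s <= b -> 1 < cabs (c s) /\ cabs (xi s) = 1) ->
  {ae lebesgue_measure, forall s, a <= s <= b ->
    time_derivative c s (- lfield (c s) (xi s))} ->
  cabs (c b) <= cabs (c a).
Proof.
move=> ab ac big dc; apply: (ac_nonincreasing (psi := fun x => cabs (c x))) => //.
  apply: (ac_transfer (psi := fun x => cabs (c x)) (K := 0) ac (lexx _)) => u v au uv vb.
  by rewrite mul0r addr0 lerBlDr cabs_leD.
apply: ae_imp dc => s H sab e e0; have [s1 x1] := big s sab.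
have e2 : 0 < e / 2 by rewrite divr_gt0.
have [d d0 Hd] := time_derivative_local (H sab) e2.
set q := (cabs (c s + xi s) / cabs (c s - xi s)) ^+ 2.
have q0 : 0 <= q by exact: sqr_ge0.
have K0 : 0 < cabs (c s) * q + 1 by rewrite ltr_wpDl// mulr_ge0// cabs_ge0.
(* The second bound keeps the second-order term of [euler_backward] below [e / 2 * (v - s)]; the
   first one leaves the other [e / 2] for the differentiation error. *)
exists (Num.min d (e / 2 / (cabs (c s) * q + 1))).
  by rewrite lt_min d0 divr_gt0.
move=> u v au vb su us sv vs.
have ud : s - u < Num.min d (e / 2 / (cabs (c s) * q + 1)) by lra.
have vd : v - s < Num.min d (e / 2 / (cabs (c s) * q + 1)) by lra.
move: ud vd; rewrite !lt_min => /andP[ud _] /andP[vd].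
rewrite ltr_pdivlMr// => vq.
have hv : cabs (c v) <= cabs (c s - (v - s)%:C * lfield (c s) (xi s))
    + e / 2 * (v - s).
  have := Hd (v - s); rewrite subrKC ger0_norm ?subr_ge0// => /(_ vd).
  have := cabs_leD (c v) (c s - (v - s)%:C * lfield (c s) (xi s)).
  by rewrite mulrN opprB opprK addrA [c v + _ - _]addrAC; lra.
have hu : cabs (c s + (s - u)%:C * lfield (c s) (xi s)) <= cabs (c u)
    + e / 2 * (s - u).
  have := Hd (u - s); rewrite subrKC ler0_norm ?subr_le0// opprB => /(_ ud).
  have := cabs_leD (c s + (s - u)%:C * lfield (c s) (xi s)) (c u).
  rewrite cabsB (_ : (u - s)%:C = - (s - u)%:C); last by rewrite -rmorphN opprB.
  by rewrite mulrNN opprD addrA; lra.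
have gu : cabs (c s) <= cabs (c s + (s - u)%:C * lfield (c s) (xi s)).
  by apply: euler_grows => //; rewrite subr_ge0.
have gv := euler_backward (_ : 0 <= v - s) x1 s1.
rewrite subr_ge0 -/q in gv; have {gv} := gv sv.
have : (v - s) * ((v - s) * (cabs (c s) * q)) <= (v - s) * (e / 2).
  rewrite ler_wpM2l ?subr_ge0//.
  have : 0 <= v - s by rewrite subr_ge0.
  by move: vq; rewrite mulrDr mulr1; lra.
have : 0 <= e / 2 * (s - u) by rewrite mulr_ge0 ?subr_ge0 ?(ltW e2).
rewrite [cabs (c s) * (1 + _)]mulrDr mulr1 => h1 h2 h3.
have : cabs (c s) * ((v - s) ^+ 2 * q) = (v - s) * ((v - s) * (cabs (c s) * q)) by ring.
by lra.
Qed.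

End trajectories.

(** * Stability and refinement of the Euler scheme *)

Section euler.
Context {R : realType}.
Implicit Types (h : R) (x : nat -> R[i]) (z w : R[i]).

Fixpoint euler h x z n : R[i] :=
  if n is k.+1 then euler h x z k + h%:C * lfield (euler h x z k) (x k) else z.

Lemma expDx_le (a : R) n : 0 <= a -> (1 + a) ^+ n <= expR (a *+ n).
Proof.
move=> a0; rewrite -mulr_natr mulrC expRM_natl lerXn2r ?nnegrE ?expR_ge0 ?expR_ge1Dx//.
exact: addr_ge0.
Qed.

Lemma gronwall (a : R) (e b : nat -> R) n : 0 <= a ->
  (forall k, (k < n)%N -> 0 <= b k) ->
  (forall k, (k < n)%N -> e k.+1 <= (1 + a) * e k + b k) ->
  e n <= (1 + a) ^+ n * (e 0%N + \sum_(k < n) b k).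
Proof.
move=> a0; elim: n => [|n IH] b0 H; first by rewrite big_ord0 expr0 mul1r addr0.
apply: le_trans (H n (ltnSn n)) _.
have a1 : 1 <= 1 + a by rewrite lerDl.
have a10 : 0 <= 1 + a by rewrite addr_ge0.
have {}IH := IH (fun k kn => b0 k (ltnW kn)) (fun k kn => H k (ltnW kn)).
rewrite big_ord_recr/= addrA mulrDr exprS -mulrA; apply: lerD.
  by rewrite ler_wpM2l.
by rewrite ler_peMl ?b0// -exprS exprn_ege1.
Qed.

Lemma euler_nondecr h x z n : 0 <= h -> (forall k, (k < n)%N -> cabs (x k) = 1) ->
  1 < cabs z -> cabs z <= cabs (euler h x z n).
Proof.
move=> h0; elim: n => [//|n IH] x1 z1 /=.
have {}IH := IH (fun k kn => x1 k (ltnW kn)) z1.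
apply: le_trans (IH) _; apply: euler_grows => //; first exact: x1.
exact: lt_le_trans z1 IH.
Qed.

Lemma euler_ge h x (rho : R) z n : 0 <= h ->
  (forall k, (k < n)%N -> cabs (x k) = 1) -> 1 < rho -> rho <= cabs z ->
  rho <= cabs (euler h x z n).
Proof.
move=> h0 x1 r1 rz; apply: (le_trans rz); apply: euler_nondecr => //.
exact: lt_le_trans rz.
Qed.

Lemma euler_lip h x (rho : R) z w n : 0 <= h ->
  (forall k, (k < n)%N -> cabs (x k) = 1) ->
  1 < rho -> rho <= cabs z -> rho <= cabs w ->
  cabs (euler h x z n - euler h x w n) <=
  expR (h * lipz rho *+ n) * cabs (z - w).
Proof.
move=> h0 x1 r1 rz rw.
have L0 : 0 <= lipz rho by rewrite addr_ge0// divr_ge0// sqr_ge0.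
have := @gronwall (h * lipz rho)
  (fun k => cabs (euler h x z k - euler h x w k)) (fun=> 0) n.
rewrite big1// addr0 => /(_ (mulr_ge0 h0 L0)) H.
apply: le_trans (H _ _) _ => //.
  move=> k kn /=; rewrite addr0.
  have -> : forall p q a b : R[i], p + h%:C * a - (q + h%:C * b) =
    (p - q) + h%:C * (a - b) by move=> *; ring.
  apply: le_trans (le_normcD _ _) _; rewrite mulrDl mul1r lerD2l.
  rewrite Normc.normcM cabs_real ger0_norm// -mulrA ler_wpM2l//.
  have xk j : (j < k)%N -> cabs (x j) = 1 by move=> jk; rewrite x1// (ltn_trans jk).
  apply: lfield_lipz => //; first exact: x1.
    exact: euler_ge.
  exact: euler_ge.
by rewrite ler_wpM2r ?cabs_ge0// expDx_le// mulr_ge0.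
Qed.

(** The supremum of [|u + x| / |u - x|] over [|u| >= rho] and [|x| = 1], hence an exponential growth
    rate for the scheme. *)
Definition expo (rho : R) := (rho + 1) / (rho - 1).

Lemma euler_bound h x (rho : R) z n : 0 <= h ->
  (forall k, (k < n)%N -> cabs (x k) = 1) -> 1 < rho -> rho <= cabs z ->
  cabs (euler h x z n) <= expR (h * expo rho *+ n) * cabs z.
Proof.
move=> h0 x1 r1 rz.
have q0 : 0 <= expo rho by rewrite divr_ge0//; lra.
have := @gronwall (h * expo rho) (fun k => cabs (euler h x z k)) (fun=> 0) n.
rewrite big1// addr0 => /(_ (mulr_ge0 h0 q0)) H.
apply: le_trans (H _ _) _ => //.
  move=> k kn /=; rewrite addr0.
  apply: le_trans (le_normcD _ _) _; rewrite mulrDl mul1r lerD2l.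
  rewrite Normc.normcM cabs_real ger0_norm// -mulrA ler_wpM2l//.
  have xk j : (j < k)%N -> cabs (x j) = 1 by move=> jk; rewrite x1// (ltn_trans jk).
  apply: lfield_bound => //; first exact: x1.
  exact: euler_ge.
by rewrite ler_wpM2r ?cabs_ge0// expDx_le// mulr_ge0.
Qed.

(** Within a block of [m] fine steps the fine scheme moves by at most its speed bound times
    [h *+ m]. The Lipschitz constant in the point turns this into the mesh term, the one in the
    driving value yields the oscillation inside the blocks, and Gronwall over the [n] blocks gives
    the factor [expR (T * lipz rho)]. Comparing two schemes, and not a scheme with the flow, makes
    the oscillation a finite sum. *)
Lemma euler_refine h x (rho T : R) z n m : (0 < m)%N -> 0 <= h ->
  (forall k, (k < n * m)%N -> cabs (x k) = 1) -> 1 < rho -> rho <= cabs z ->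
  h *+ (n * m) = T ->
  cabs (euler h x z (n * m) - euler (h *+ m) (fun k => x (k * m)%N) z n) <=
  expR (T * lipz rho) *
    (T * lipz rho * (expo rho * (expR (T * expo rho) * cabs z)) * (h *+ m) +
     lipx rho * (h * \sum_(k < n) \sum_(i < m) cabs (x (k * m + i)%N - x (k * m)%N))).
Proof.
move=> m0 h0 x1 r1 rz hT.
set L := lipz rho; set K := lipx rho; set M := expo rho * _.
have q0 : 0 <= expo rho by rewrite divr_ge0//; lra.
have L0 : 0 <= L by rewrite addr_ge0// divr_ge0// sqr_ge0.
have K0 : 0 <= K.
  by rewrite addr_ge0// mulr_ge0// divr_ge0// ?sqr_ge0//; lra.
have M0 : 0 <= M.
  by apply: mulr_ge0 => //; apply: mulr_ge0; [exact: expR_ge0|exact: cabs_ge0].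
have T0 : 0 <= T by rewrite -hT mulrn_wge0.
set v := euler h x z; set u := euler _ _ z.
have vS j : v j.+1 = v j + h%:C * lfield (v j) (x j) by [].
have uS k : u k.+1 = u k + (h *+ m)%:C * lfield (u k) (x (k * m)%N) by [].
have v0 : v 0%N = u 0%N by [].

have hm0 : 0 <= h *+ m by rewrite mulrn_wge0.
have vge j : (j <= n * m)%N -> rho <= cabs (v j).
  move=> jn; apply: euler_ge => // k kj.
  by apply: x1; exact: leq_trans kj jn.
have vM j : (j < n * m)%N -> cabs (lfield (v j) (x j)) <= M.
  move=> jn; apply: le_trans (lfield_bound r1 (x1 _ jn) (vge _ (ltnW jn))) _.
  rewrite /M ler_wpM2l//.
  apply: le_trans (euler_bound h0 _ r1 rz) _ => [k kj|].
    by apply: x1; exact: leq_trans kj (ltnW jn).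
  rewrite ler_wpM2r ?cabs_ge0// ler_expR -mulrnAl ler_wpM2r// -hT.
  by rewrite ler_wpMn2l// ltnW.
have kmn k : (k < n)%N -> (k * m < n * m)%N by move=> kn; rewrite ltn_pmul2r.
have kimn k i : (k < n)%N -> (i < m)%N -> (k * m + i < n * m)%N.
  move=> kn im; apply: (@leq_trans (k.+1 * m)); first by rewrite mulSn addnC ltn_add2r.
  by rewrite leq_mul2r kn orbT.
have uge k : (k <= n)%N -> rho <= cabs (u k).
  move=> kn; apply: euler_ge => // j jk.
  by apply: x1; apply: kmn; exact: leq_trans jk kn.
(* The local error of block [k], with the discrepancy already present at the start of the block set
   apart for Gronwall. *)
pose b k := \sum_(i < m) h * (L * M * (h *+ m) + K * cabs (x (k * m + i)%N - x (k * m)%N)).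
have b0 k : 0 <= b k.
  apply: sumr_ge0 => i _; apply: mulr_ge0 => //; apply: addr_ge0.
    by apply: mulr_ge0 => //; exact: mulr_ge0.
  by apply: mulr_ge0 => //; exact: cabs_ge0.
have vstep k i : (k < n)%N -> (i <= m)%N ->
    v (k * m + i)%N = v (k * m)%N + h%:C * \sum_(j < i) lfield (v (k * m + j)%N) (x (k * m + j)%N).
  move=> kn; elim: i => [|i IH] im; first by rewrite addn0 big_ord0 mulr0 addr0.
  by rewrite addnS vS big_ord_recr/= mulrDr addrA -IH// ltnW.
have vnear k i : (k < n)%N -> (i <= m)%N ->
    cabs (v (k * m + i)%N - v (k * m)%N) <= M * (h *+ m).
  move=> kn im; rewrite vstep// addrAC subrr add0r Normc.normcM cabs_real ger0_norm//.
  apply: (@le_trans _ _ (h * (M *+ i))); last first.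
    by rewrite !mulrnAr [M * h]mulrC ler_wpMn2l// mulr_ge0.
  rewrite ler_wpM2l//; apply: le_trans (cabs_sum _) _.
  rewrite -[X in M *+ X]card_ord -sumr_const; apply: ler_sum => j _.
  by apply: vM; apply: kimn => //; exact: leq_trans (ltn_ord j) im.
have := @gronwall (h *+ m * L) (fun k => cabs (v (k * m)%N - u k)) b n.
move=> /(_ (mulr_ge0 hm0 L0) (fun k _ => b0 k)).
rewrite mul0n v0 subrr Normc.normc0 add0r => H.
apply: le_trans (H _) _.
  move=> k kn.
  have -> : (k.+1 * m = k * m + m)%N by rewrite mulSn addnC.
  rewrite vstep// uS.
  have -> : v (k * m)%N + h%:C * (\sum_(j < m) lfield (v (k * m + j)%N) (x (k * m + j)%N)) -
      (u k + (h *+ m)%:C * lfield (u k) (x (k * m)%N)) =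
      (v (k * m)%N - u k) + h%:C * \sum_(j < m)
        (lfield (v (k * m + j)%N) (x (k * m + j)%N) - lfield (u k) (x (k * m)%N)).
    rewrite sumrB sumr_const card_ord rmorphMn/= mulrBr mulrnAl mulrnAr; ring.
  apply: le_trans (le_normcD _ _) _; rewrite mulrDl mul1r -addrA lerD2l.
  rewrite Normc.normcM cabs_real ger0_norm//.
  apply: (@le_trans _ _ (h * \sum_(j < m) (L * (cabs (v (k * m)%N - u k) + M * (h *+ m)) +
      K * cabs (x (k * m + j)%N - x (k * m)%N)))).
    rewrite ler_wpM2l//; apply: le_trans (cabs_sum _) _; apply: ler_sum => j _.
    have kj := kimn _ _ kn (ltn_ord j).
    apply: le_trans (cabs_tri _ (lfield (u k) (x (k * m + j)%N)) _) _.
    apply: lerD.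
      apply: le_trans (lfield_lipz r1 (x1 _ kj) (vge _ (ltnW kj)) (uge _ (ltnW kn))) _.
      rewrite ler_wpM2l//; apply: le_trans (cabs_tri _ (v (k * m)%N) _) _.
      by rewrite addrC lerD2l vnear// ltnW.
    by apply: lfield_lipx => //; rewrite ?x1 ?kmn// uge// ltnW.
  rewrite /b -mulr_sumr !big_split/= !sumr_const card_ord.
  apply: eq_ler; ring.
have E1 : expR (h *+ m * L *+ n) = expR (T * L).
  by rewrite -mulrnAl -mulrnA mulnC hT.
apply: (@le_trans _ _ (expR (T * L) * \sum_(k < n) b k)).
  by rewrite ler_wpM2r ?sumr_ge0// -E1 expDx_le// mulr_ge0.
rewrite ler_wpM2l ?expR_ge0// /b.
under eq_bigr do rewrite -mulr_sumr big_split/= sumr_const card_ord -mulr_sumr.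
rewrite -mulr_sumr big_split/= sumr_const card_ord -mulr_sumr -mulrnA mulrDr.
apply: eq_ler.
rewrite -hT [(m * n)%N]mulnC; ring.
Qed.

End euler.

Ltac nneg := repeat (first [ assumption | by apply: ltW | exact: ler0n
  | exact: ler01 | exact: expR_ge0 | exact: cabs_ge0 | exact: sqr_ge0
  | apply: mulr_ge0 | apply: addr_ge0 | apply: divr_ge0 | apply: sumr_ge0 => ? _
  | apply: mulrn_wge0 | apply: exprn_ge0 ]).

Section constants.
Context {R : realType}.
Implicit Types rho : R.

Lemma expo_ge0 rho : 1 < rho -> 0 <= expo rho.
Proof. by move=> r1; rewrite /expo divr_ge0//; lra. Qed.

Lemma lipz_ge0 rho : 0 <= lipz rho.
Proof. by rewrite addr_ge0// divr_ge0// sqr_ge0. Qed.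

Lemma lipx_ge0 rho : 1 < rho -> 0 <= lipx rho.
Proof. by move=> r1; rewrite addr_ge0// mulr_ge0// divr_ge0 ?sqr_ge0//; lra. Qed.

End constants.

(** * Convergence of the scheme along a fixed path *)

Section pathwise.
Context {R : realType}.
Implicit Types (xi : R -> R[i]) (z w : R[i]).

(** A finite form of the cadlag property: finitely many times account for all oscillations larger
    than [e]. A time [p] separates [u] from [v] when [u < p <= v], since a right-continuous path has
    already jumped at [p]. *)
Definition small_osc (T : R) xi := forall e : R, 0 < e -> exists l : seq R,
  forall u v, 0 <= u -> u <= v -> v <= T ->
    (forall p, p \in l -> ~ (u < p <= v)) -> cabs (xi u - xi v) <= e.

Lemma small_oscP (T : R) xi : 0 <= T ->
  (forall s, 0 <= s <= T -> forall e : R, 0 < e -> exists2 d : R, 0 < d &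
     (forall u, s <= u -> u < s + d -> cabs (xi s - xi u) <= e) /\
     (forall u v, 0 <= u -> s - d < u -> u <= v -> v < s -> cabs (xi u - xi v) <= e)) ->
  small_osc T xi.
Proof.
move=> T0 loc e e0.
have e2 : 0 < e / 2 by rewrite divr_gt0.
pose Q x y := exists l : seq R, forall u v, x <= u -> u <= v -> v <= y ->
  (forall p, p \in l -> ~ (u < p <= v)) -> cabs (xi u - xi v) <= e.
apply: (cousin (Q := Q)) => //.
  (* The junction [y] joins the list, so no pair of times straddling it has to be controlled. *)
  move=> x y z _ xy yz _ [l1 H1] [l2 H2]; exists (y :: l1 ++ l2).
  move=> u v xu uv vz Hl.
  have [vy|yv] := ltP v y.
    apply: H1 => //; first exact: ltW.
    by move=> p pl; apply: Hl; rewrite inE mem_cat pl orbT.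
  have [uy|yu] := ltP u y.
    by have := Hl y (mem_head _ _); rewrite uy yv.
  apply: H2 => // p pl; apply: Hl; rewrite inE mem_cat pl !orbT//.
move=> s sT; have [d d0 [Hr Hl]] := loc s sT _ e2.
exists d => // a b a0 bT sa as_ sb bs; exists [:: s] => u v au uv vb Hp.
have [vs|sv] := ltP v s.
  apply: le_trans (Hl u v _ _ uv vs) _; last lra.
    exact: le_trans a0 au.
  exact: lt_le_trans sa au.
have [us|su] := ltP u s; first by have := Hp s (mem_head _ _); rewrite us sv.
apply: le_trans (cabs_tri _ (xi s) _) _.
have := Hr u su (le_lt_trans (le_trans uv vb) bs).
have := Hr v sv (le_lt_trans vb bs).
by rewrite (cabsB (xi u)); lra.
Qed.

Lemma sum_disjoint_le1 N (b : nat -> bool) :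
  (forall j k, (j < N)%N -> (k < N)%N -> b j -> b k -> j = k) ->
  \sum_(k < N) (b k)%:R <= 1 :> R.
Proof.
move=> H; have [[k [kN bk]]|nk] := pselect (exists k : nat, (k < N)%N /\ b k).
  rewrite (bigD1 (Ordinal kN))//= bk big1 ?addr0// => j jk.
  case bj : (b j) => //; case/negP: jk; apply/eqP/val_inj => /=.
  exact: H.
rewrite big1// => k _; case bk : (b k) => //; case: nk; exists k; split=> //.
Qed.

(** No rate: [N0] depends on the number of listed times in [small_osc], hence on the path. Steps
    that contain a listed time have an error of order [h] and there are boundedly many of them; the
    other steps contribute in proportion to [eta]. *)
Lemma euler_cvg (T : R) xi z w : 0 < T -> Delta z ->
  (forall s, 0 <= s -> cabs (xi s) = 1) -> small_osc T xi ->
  loewner_flow xi T w z ->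
  forall e : R, 0 < e -> exists N0 : nat, forall N, (N0 <= N)%N -> (0 < N)%N ->
    cabs (w - euler (T / N%:R) (fun k => xi (T - k%:R * (T / N%:R))) z N) <= e.
Proof.
move=> T0 /DeltaE z1 x1 osc [c [c0 cT cD cac dc]] e e0.
have cD1 s : 0 <= s <= T -> 1 < cabs (c s) by move=> /cD/DeltaE.
have {}dc : {ae lebesgue_measure, forall s, 0 <= s <= T ->
    time_derivative c s (- lfield (c s) (xi s))}.
  apply: ae_imp dc => s H /H; congr time_derivative.
  by rewrite /lfield -mulrN -mulrN -invrN opprB addrC.
have sub a b : 0 <= a -> b <= T -> {ae lebesgue_measure, forall s, a <= s <= b ->
    time_derivative c s (- lfield (c s) (xi s))}.
  move=> a0 bT; apply: ae_imp dc => s H /andP[as_ sb]; apply: H.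
  by rewrite (le_trans a0 as_) (le_trans sb bT).
have dec a b : 0 <= a -> a <= b -> b <= T -> cabs (c b) <= cabs (c a).
  move=> a0 ab bT; apply: (decreasing_ac (xi := xi) ab).
  - exact: ac_sub cac.
  - by move=> s /andP[as_ sb]; split; [apply: cD1|apply: x1]; lra.
  - exact: sub.
pose rho := cabs z.
have cz s : 0 <= s <= T -> rho <= cabs (c s).
  by move=> /andP[s0 sT]; rewrite /rho -cT dec.
have q0 := expo_ge0 z1; rewrite -/rho in q0.
have L0 := lipz_ge0 rho; have K0 := lipx_ge0 z1; rewrite -/rho in L0 K0.
set L := lipz rho in L0; set K := lipx rho in K0.
pose M := expo rho * cabs w.
have M0 : 0 <= M by rewrite mulr_ge0// cabs_ge0.
have lM s : 0 <= s <= T -> cabs (lfield (c s) (xi s)) <= M.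
  move=> sT; have /andP[s0 sT'] := sT.
  apply: le_trans (lfield_bound z1 (x1 _ s0) (cz _ sT)) _.
  by rewrite ler_wpM2l// -c0 dec.
have lip a b : 0 <= a -> a <= b -> b <= T -> cabs (c b - c a) <= M * (b - a).
  move=> a0 ab bT.
  have := @mean_value_ac _ c a b M 0 (fun s => - lfield (c s) (xi s)) ab M0 _ _ _.
  rewrite mulr0 subr0; apply; first exact: ac_sub cac.
    exact: sub.
  by move=> s sab; rewrite subr0 normcN lM//; lra.
pose D := expR (T * L).
have D0 : 0 < D by exact: expR_gt0.
(* Chosen so that the oscillation on steps without a listed time costs at most
   [D * (K * T) * eta <= e / 2] in the end. *)
pose eta := e / 2 / (D * (K * T + 1)).
have KT : 0 < K * T + 1 by rewrite ltr_wpDl// mulr_ge0// ltW.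
have eta0 : 0 < eta by rewrite !divr_gt0// mulr_gt0.
have [l Hl] := osc _ eta0.
(* Gathers what is divided by [N]: the displacement of the trajectory within a step, and at most
   [size l] steps where the driving value may jump across the circle. *)
pose B := D * (T * (L * M * T) + K * T * (2 * (size l)%:R)).
have B0 : 0 <= B.
  by rewrite /B; nneg.
exists (Num.truncn (2 * B / e)).+1 => N NN N0.
have N0' : 0 < N%:R :> R by rewrite ltr0n.
pose h := T / N%:R; have h0 : 0 < h by rewrite divr_gt0.
have hN : h * N%:R = T by rewrite /h divfK// lt0r_neq0.
rewrite -/h; set u := euler _ _ z; pose t k : R := T - k%:R * h.
have tS k : t k.+1 = t k - h by rewrite /t -natr1; ring.
have t0 k : (k <= N)%N -> 0 <= t k <= T.
  move=> kN; rewrite /t lerBlDr lerDl mulr_ge0 ?(ltW h0)// andbT subr_ge0.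
  by rewrite -hN mulrC ler_wpM2l ?(ltW h0)// ler_nat.
have uS k : u k.+1 = u k + h%:C * lfield (u k) (xi (t k)) by [].
pose hit (k : nat) (p : R) : bool := t k.+1 < p <= t k.
pose bad k := has (hit k) l.
(* On a step hit by a listed time the only bound is 2, the diameter of the circle. *)
pose om (k : nat) : R := eta + 2 * \sum_(p <- l) (hit k p)%:R.
have om0 k : 0 <= om k by rewrite /om; nneg.
have osck k s : (k < N)%N -> t k.+1 <= s <= t k -> cabs (xi s - xi (t k)) <= om k.
  move=> kN /andP[ts st].
  have /andP[tk1 _] := t0 _ kN; have /andP[_ tk2] := t0 _ (ltnW kN).
  have s0 : 0 <= s by exact: le_trans ts.
  have [bk|nbk] := boolP (bad k).
    apply: le_trans (le_normcD _ _) _; rewrite normcN !x1//; last exact: le_trans st.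
    rewrite /om (_ : 1 + 1 = 0 + 2 * 1 :> R); last by rewrite add0r mulr1.
    apply: lerD; first exact: ltW.
    rewrite ler_pM2l//; have /hasP[p pl Hp] := bk.
    rewrite (perm_big _ (perm_to_rem pl))/= big_cons Hp lerDl.
    exact: sumr_ge0.
  apply: le_trans (Hl _ _ s0 st tk2 _) _.
    move=> p pl /andP[sp pt]; move/hasPn : nbk => /(_ _ pl).
    by rewrite /hit pt andbT -leNgt => pt'; have := lt_le_trans sp (le_trans pt' ts); rewrite ltxx.
  by rewrite lerDl mulr_ge0// sumr_ge0.
(* The cells of the time grid are half-open and disjoint, so each listed time is counted once at
   most. *)
have omsum : \sum_(k < N) om k <= N%:R * eta + 2 * (size l)%:R.
  rewrite big_split/= sumr_const card_ord mulr_natl lerD2l -mulr_sumr ler_pM2l//.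
  rewrite exchange_big/= -[X in _ <= X%:R]sum1_size natr_sum.
  apply: ler_sum => p _; apply: (sum_disjoint_le1 (b := fun k => hit k p)).
  have tmono j k : (j < k)%N -> t k <= t j.+1.
    by move=> jk; rewrite /t lerB// ler_wpM2r ?(ltW h0)// ler_nat.
  move=> j k jN kN /andP[p1 p2] /andP[p3 p4].
  case: (ltngtP j k) => // /tmono jk.
    by have := lt_le_trans p1 (le_trans p4 jk); rewrite ltxx.
  by have := lt_le_trans p3 (le_trans p2 jk); rewrite ltxx.
have := @gronwall _ (h * L) (fun k => cabs (c (t k) - u k))
  (fun k => h * (L * (M * h) + K * om k)) N (mulr_ge0 (ltW h0) L0) _ _.
have -> : t 0%N = T by rewrite /t mul0r subr0.
have -> : t N = 0 by rewrite /t mulrC hN subrr.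
rewrite cT c0 subrr Normc.normc0 add0r => H; apply: le_trans (H _ _) _.
- by move=> k _; nneg.
- move=> k kN; rewrite uS.
  have /andP[tk1 _] := t0 _ kN; have /andP[_ tk2] := t0 _ (ltnW kN).
  have tt : t k.+1 <= t k by rewrite tS; lra.
  have tk3 : 0 <= t k by exact: le_trans tt.
  have tkk : t k - t k.+1 = h by rewrite tS; ring.
  have ukz : rho <= cabs (u k).
    apply: euler_ge => //; first exact: ltW.
    move=> j jk; apply: x1.
    by have /andP[] := t0 j (ltnW (ltn_trans jk kN)).
  have step : cabs (c (t k.+1) - (c (t k) + h%:C * lfield (c (t k)) (xi (t k))))
      <= (L * (M * h) + K * om k) * h.
    have := @mean_value_ac _ c (t k.+1) (t k) (L * (M * h) + K * om k)
      (- lfield (c (t k)) (xi (t k))) (fun s => - lfield (c s) (xi s)) tt _ _ _ _.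
    rewrite tkk cabsB => H1; apply: le_trans (H1 _ _ _ _).
    + apply: eq_ler; congr cabs; ring.
    + by nneg.
    + exact: ac_sub cac.
    + exact: sub.
    + move=> s /andP[s1 s2].
      have s3 : 0 <= s by exact: le_trans s1.
      have s4 : s <= T by exact: le_trans tk2.
      rewrite -opprD normcN.
      apply: le_trans (cabs_tri _ (lfield (c (t k)) (xi s)) _) _.
      apply: lerD.
        apply: le_trans (lfield_lipz z1 (x1 _ s3) (cz _ _) (cz _ _)) _; rewrite ?s3 ?tk3//.
        rewrite ler_wpM2l// cabsB; apply: le_trans (lip _ _ s3 s2 tk2) _.
        by rewrite ler_wpM2l//; move: tkk; lra.
      apply: le_trans (lfield_lipx z1 (x1 _ s3) (x1 _ tk3) (cz _ _)) _; rewrite ?tk3//.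
      by rewrite ler_wpM2l// osck// s1.
  apply: le_trans (cabs_tri _ (c (t k) + h%:C * lfield (c (t k)) (xi (t k))) _) _.
  rewrite addrC [leRHS](_ : _ = (1 + h * L) * cabs (c (t k) - u k) +
     (L * (M * h) + K * om k) * h); last by rewrite [in RHS]mulrC; congr (_ + _); exact: mulrC.
  apply: lerD => //.
  have -> : forall p q a b : R[i], p + h%:C * a - (q + h%:C * b) =
    (p - q) + h%:C * (a - b) by move=> *; ring.
  apply: le_trans (le_normcD _ _) _; rewrite mulrDl mul1r lerD2l.
  rewrite Normc.normcM cabs_real ger0_norm ?(ltW h0)// -mulrA ler_wpM2l ?(ltW h0)//.
  apply: lfield_lipz => //; first exact: x1.
  by apply: cz; rewrite tk3.
- rewrite -mulr_sumr big_split/= sumr_const card_ord -mulr_sumr.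
  have DL : (1 + h * L) ^+ N <= D.
    apply: le_trans (expDx_le _ _) _; first by rewrite mulr_ge0// ltW.
    by rewrite /D -mulrnAl -mulr_natr hN.
  apply: (@le_trans _ _ (D * (h * (L * (M * h) *+ N + K * (N%:R * eta + 2 * (size l)%:R))))).
    apply: ler_pM => //.
    + by nneg.
    + by nneg.
    + by rewrite ler_pM2l// lerD2l ler_wpM2l.
  have -> : D * (h * (L * (M * h) *+ N + K * (N%:R * eta + 2 * (size l)%:R))) =
      B / N%:R + D * (K * T) * eta.
    by rewrite /B /h; field; rewrite lt0r_neq0.
  have b1 : B / N%:R <= e / 2.
    rewrite ler_pdivrMr// mulrAC ler_pdivlMr// -ler_pdivrMl// mulrC [_ * 2]mulrC.
    by apply: ltW; apply: lt_le_trans (truncnS_gt _) _; rewrite ler_nat.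
  have b2 : D * (K * T) * eta <= e / 2.
    rewrite /eta mulrA ler_pdivrMr ?mulr_gt0// mulrC ler_pM2l ?divr_gt0//.
    by rewrite ler_pM2l//; lra.
  by lra.
Qed.

End pathwise.

(** * Lower envelopes of continuous functions on Sigma' *)

Section dense_sequence.
Context {R : realType}.

Lemma cabs_le_ReIm (z : R[i]) : cabs z <= `|complex.Re z| + `|complex.Im z|.
Proof.
rewrite -ler_sqr ?nnegrE ?cabs_ge0 ?addr_ge0// cabsX2 sqrrD !real_normK ?num_real//.
by rewrite addrAC lerDl mulrn_wge0// mulr_ge0.
Qed.

(** An enumeration of the complex rationals of [Delta]; codes without a value and points of the
    closed disk are sent to 2, so that evaluation at every index stays inside [Delta]. *)
Definition zseq (i : nat) : R[i] :=
  let z := if unpickle i is Some (a, b) then (ratr a +i* ratr b)%C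
           else 0 : R[i] in
  if 1 < cabs z then z else 2.

Lemma zseq_Delta i : 1 < cabs (zseq i).
Proof. by rewrite /zseq; case: ifP => // _; rewrite cabs2 ltr1n. Qed.

Lemma zseq_dense (z : R[i]) (e : R) : 1 < cabs z -> 0 < e ->
  exists i, cabs (z - zseq i) < e.
Proof.
move=> z1 e0; pose d := Num.min e (cabs z - 1) / 2.
have m0 : 0 < Num.min e (cabs z - 1) by rewrite lt_min e0 subr_gt0.
have d0 : 0 < d by rewrite divr_gt0.
case: z z1 @d m0 d0 => x y z1 d m0 d0.
have [a] := @rat_in_itvoo R (x - d) (x + d) ltac:(lra).
have [b] := @rat_in_itvoo R (y - d) (y + d) ltac:(lra).
rewrite !in_itv/= => /andP[b1 b2] /andP[a1 a2].
have close : cabs ((x +i* y)%C - (ratr a +i* ratr b)%C) < Num.min e (cabs (x +i* y)%C - 1).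
  apply: le_lt_trans (cabs_le_ReIm _) _ => /=.
  rewrite (_ : Num.min _ _ = d + d); last by rewrite /d; lra.
  by apply: ltrD; rewrite ltr_norml; apply/andP; lra.
exists (pickle (a, b)); rewrite /zseq pickleK.
move: close; rewrite lt_min => /andP[c1 c2]; case: ifP => // /negbT.
by have := cabs_leD (x +i* y)%C (ratr a +i* ratr b)%C; rewrite -leNgt; lra.
Qed.

Lemma near_cabs (x : R[i]) (e : R) : 0 < e ->
  \forall y \near (x : Ctop R), cabs (x - y) < e.
Proof.
move=> e0; have e0' : (0 : R[i]) < e%:C by rewrite ltcR.
have := @nbhsx_ballx _ (Ctop R) x _ e0'.
by apply: filterS => y; rewrite /ball/= -ltcR.
Qed.

(** The net must avoid the same disk as [K], because the Lipschitz constants available later depend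
    on the distance to the circle. *)
Lemma compact_net (K : set (Ctop R)) : compact_in_Delta K ->
  exists2 rho : R, 1 < rho & (forall z, K z -> rho <= cabs z) /\
  forall e : R, 0 < e -> exists k : nat, forall z, K z ->
    exists i, [/\ (i < k)%N, cabs (z - zseq i) < e & rho <= cabs (zseq i)].
Proof.
move=> [/compact_near_coveringP cK KD].
have [rho r1 Hr] : exists2 rho : R, 1 < rho & forall z, K z -> rho <= cabs z.
  have := cK nat \oo (fun n z => 1 + n.+1%:R^-1 <= cabs (z : R[i])) _.
  move=> /(_ _)[].
    move=> x /KD/DeltaE x1.
    have e0 : 0 < (cabs x - 1) / 2 by rewrite divr_gt0 ?subr_gt0.
    have := near_infty_natSinv_lt (PosNum e0).
    have := near_cabs x e0.
    move=> H1 H2; exists ([set y | cabs (x - y) < (cabs x - 1) / 2],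
      [set n | n.+1%:R^-1 < (cabs x - 1) / 2]) => //=.
    have H (p q : R[i]) (t : R) : cabs (p - q) < (cabs p - 1) / 2 ->
        t < (cabs p - 1) / 2 -> 1 + t <= cabs q.
      by have := cabs_leD p q; lra.
    by move=> [y n] /= [h1 h2]; exact: H h1 h2.
  move=> n _ Hn; exists (1 + n.+1%:R^-1); first by rewrite ltrDl invr_gt0.
  by move=> z Kz; exact: (Hn n (leqnn n) z Kz).
(* Half of the distance to the circle is given up, which leaves room for net points that are closer
   to the circle than [K] is. *)
exists ((1 + rho) / 2); first lra.
split=> [z /Hr|e e0]; first lra.
pose d := Num.min e ((rho - 1) / 2) / 2.
have m0 : 0 < Num.min e ((rho - 1) / 2) by rewrite lt_min e0 divr_gt0 ?subr_gt0.
have d0 : 0 < d by rewrite divr_gt0.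
have := cK nat \oo (fun k z => exists i, [/\ (i < k)%N,
   cabs ((z : R[i]) - zseq i) < e & (1 + rho) / 2 <= cabs (zseq i)]) _.
move=> /(_ _)[].
  move=> x Kx; have x1 : 1 < cabs x by apply/DeltaE/KD.
  have [i xi] := zseq_dense x1 d0.
  exists ([set y | cabs (x - y) < d], [set k | (i < k)%N]).
    by split; [exact: near_cabs | exists i.+1].
  have de : d + d <= e by rewrite /d -splitr ge_min lexx.
  have dr : d <= (rho - 1) / 2.
    by rewrite /d ler_pdivrMr// ge_min; apply/orP; right; lra.
  have zr : (1 + rho) / 2 <= cabs (zseq i).
    have H (p q : R[i]) : cabs (p - q) < d -> rho <= cabs p -> (1 + rho) / 2 <= cabs q.
      by have := cabs_leD p q; lra.
    exact: H xi (Hr _ Kx).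
  have H (p q r : R[i]) : cabs (p - q) < d -> cabs (p - r) < d -> cabs (q - r) < e.
    by have := cabs_tri q p r; rewrite (cabsB q p); lra.
  by move=> [y k] /= [xy ik]; exists i; split=> //; exact: H xy xi.
by move=> k _ Hk; exists k => z Kz; exact: (Hk k (leqnn k) z Kz).
Qed.

End dense_sequence.

(** * Continuous functions on a Lipschitz class of Sigma' *)

Section lipschitz_class.
Context {R : realType}.
Implicit Types (f g : Sigma' R) (K : R -> R).

Lemma entourage_cabs (e : R) : 0 < e ->
  entourage [set p : Ctop R * Ctop R | cabs ((p.1 : R[i]) - p.2) < e].
Proof.
move=> e0; rewrite -entourage_ballE; exists e%:C; first by rewrite /= ltcR.
by move=> [x y]; rewrite /ball/= -ltcR.
Qed.

Lemma entourage_cabs_inv (E : set (Ctop R * Ctop R)) : entourage E ->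
  exists2 e : R, 0 < e & forall p, cabs ((p.1 : R[i]) - p.2) < e -> E p.
Proof.
rewrite -entourage_ballE => -[e /= e0 He].
have ee : e = (complex.Re e)%:C by rewrite RRe_real// gtr0_real.
exists (complex.Re e); first by rewrite -ltcR -ee.
by move=> [x y] h; apply: He; rewrite /ball/= ee ltcR.
Qed.

Definition lip_class K : set (Sigma' R) := [set f | forall rho, 1 < rho ->
  forall z w, rho <= cabs z -> rho <= cabs w ->
  cabs (Sigma'_val f z - Sigma'_val f w) <= K rho * cabs (z - w)].

Lemma near_eval f z (e : R) : 1 < cabs z -> 0 < e ->
  \forall g \near f, cabs (Sigma'_val f z - Sigma'_val g z) < e.
Proof.
move=> z1 e0.
have cf : (@set_val _ (@Sigma'_set R) g) @[g --> f] --> (set_val f : fun_space).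
  exact: initial_continuous.
move/fam_cvgP : cf => /(_ _ [set z]) cf.
have cz : compact_in_Delta [set (z : Ctop R)].
  by split; [exact: compact_set1 | move=> _ ->; exact/DeltaE].
have {}cf := cf _ cz.
have : nbhs (set_val f : {uniform` [set (z : Ctop R)] -> Ctop R})
    [set h : Ctop R -> Ctop R | cabs ((set_val f : R[i] -> R[i]) z - h z) < e].
  apply/uniform_nbhs; exists [set p : Ctop R * Ctop R | cabs ((p.1 : R[i]) - p.2) < e].
  by split; [exact: entourage_cabs | move=> h /= /(_ z); exact].
move=> H.
have FF : Filter (nbhs f) by exact: nbhs_filter.
exact: (cf (fmap_filter _ FF)) H.
Qed.

(** Equicontinuity turns closeness at finitely many points of a dense sequence into locally uniform
    closeness. The filter [F0], generated by such conditions within the class, therefore converges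
    to [f], and the claim is the continuity of [h] along it. *)
Lemma continuous_lip_class K (h : Sigma' R -> R) f (e : R) :
  continuous h -> lip_class K f -> 0 < e ->
  exists k, exists2 d : R, 0 < d & forall g, lip_class K g ->
    (forall i, (i < k)%N ->
       cabs (Sigma'_val f (zseq i) - Sigma'_val g (zseq i)) < d) ->
    `|h f - h g| < e.
Proof.
move=> ch Kf e0.
pose close k (d : R) g := forall i, (i < k)%N ->
  cabs (Sigma'_val f (zseq i) - Sigma'_val g (zseq i)) < d.
pose F0 : set_system (Sigma' R) := [set A | exists k, exists2 d : R, 0 < d &
  forall g, lip_class K g -> close k d g -> A g].
have FF : Filter F0.
  split; first by exists 0%N, 1.
    move=> P Q [k [d d0 HP]] [l [d' d0' HQ]].
    exists (maxn k l), (Num.min d d'); first by rewrite lt_min d0.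
    move=> g Kg cg; split.
      apply: HP => // i ik; have := cg i; rewrite leq_max ik => /(_ isT).
      by rewrite lt_min => /andP[].
    apply: HQ => // i ik; have := cg i; rewrite leq_max ik orbT => /(_ isT).
    by rewrite lt_min => /andP[].
  by move=> P Q PQ [k [d d0 HP]]; exists k, d => // g Kg cg; exact/PQ/HP.
have cvgF : set_val g @[g --> F0] --> (set_val f : fun_space (R := R)).
  apply/fam_cvgP => A cA P /uniform_nbhs [E [entE EP]].
  have [r r0 rE] := entourage_cabs_inv entE.
  have [rho r1 [Ar net]] := compact_net cA.
  (* Three errors of size [r / 3]: moving to the net point for [f], moving for [g], and the distance
     at the net point. Since [K] is arbitrary, the absolute value and the added 1 make the divisor
     positive. *)
  pose eta := r / 3 / (`|K rho| + 1).
  have K1 : 0 < `|K rho| + 1 by rewrite ltr_wpDl.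
  have eta0 : 0 < eta by rewrite !divr_gt0.
  have [k Hk] := net _ eta0.
  exists k, (r / 3); first by rewrite divr_gt0.
  move=> g Kg cg; apply: EP => y Ay; apply: rE => /=.
  have [i [ik yi ri]] := Hk y Ay.
  have H1 (g' : Sigma' R) : lip_class K g' ->
      cabs (Sigma'_val g' y - Sigma'_val g' (zseq i)) < r / 3.
    move=> Kg'; apply: le_lt_trans (Kg' rho r1 y (zseq i) (Ar _ Ay) ri) _.
    apply: (@le_lt_trans _ _ (`|K rho| * eta)).
      apply: (@le_trans _ _ (`|K rho| * cabs (y - zseq i))).
        by rewrite ler_wpM2r ?cabs_ge0// ler_norm.
      by rewrite ler_wpM2l// ltW.
    by rewrite /eta mulrA ltr_pdivrMr// mulrC ltr_pM2l ?divr_gt0// ltrDl.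
  have h1 := H1 _ Kf; have h2 := H1 _ Kg; have h3 := cg i ik.
  have := cabs_tri (Sigma'_val f y) (Sigma'_val f (zseq i)) (Sigma'_val g y).
  have := cabs_tri (Sigma'_val f (zseq i)) (Sigma'_val g (zseq i)) (Sigma'_val g y).
  rewrite (cabsB (Sigma'_val g (zseq i))) => h4 h5.
  apply: (@lt_le_trans _ _ (r / 3 + r / 3 + r / 3)); last by lra.
  apply: le_lt_trans h5 _; apply: le_lt_trans (lerD (lexx _) h4) _.
  by rewrite addrA; do 2 apply: ltrD => //.
have : F0 --> f.
  move=> U [_ /= [[W oW <-] /= Wf WU]].
  apply: (filterS WU); apply: cvgF; exact: open_nbhs_nbhs.
move=> cF; have /cvgrPdist_lt /(_ _ e0) /cF [k [d d0 H]] := ch f.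
by exists k, d => // g Kg cg; exact: H.
Qed.

Section lower_envelope.
Variables (K : R -> R) (h : Sigma' R -> R) (M : R) (g0 : Sigma' R).
Hypotheses (Kg0 : lip_class K g0) (hM : forall g, `|h g| <= M).

Definition evals g : nat -> R[i] := fun i => Sigma'_val g (zseq i).

Definition l1dist k (x y : nat -> R[i]) : R := \sum_(i < k) cabs (x i - y i).

(* The inf-convolution below is a Lipschitz function of finitely many values of its
   argument, and increases to [h] on [lip_class K] as [k] grows. *)
Definition penalized k (y : nat -> R[i]) g : R := h g + k%:R * l1dist k y (evals g).

Definition lower_env k (y : nat -> R[i]) : R :=
  inf [set penalized k y g | g in lip_class K].

Lemma l1dist_ge0 k x y : 0 <= l1dist k x y.
Proof. by apply: sumr_ge0 => i _; exact: cabs_ge0. Qed.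

Lemma l1dist_tri k x y z : l1dist k x z <= l1dist k x y + l1dist k y z.
Proof. by rewrite -big_split/=; apply: ler_sum => i _; exact: cabs_tri. Qed.

Lemma penalized_ge k y g : - M <= penalized k y g.
Proof.
have := hM g; rewrite ler_norml => /andP[h1 _].
by apply: le_trans h1 _; rewrite lerDl mulr_ge0// l1dist_ge0.
Qed.

Let hinf k y : has_inf [set penalized k y g | g in lip_class K].
Proof.
by split; [exists (penalized k y g0), g0|exists (- M) => _ [g _ <-]; exact: penalized_ge].
Qed.

Lemma lower_env_ge k y : - M <= lower_env k y.
Proof.
by apply: lb_le_inf; [exact: (hinf k y).1|move=> _ [g _ <-]; exact: penalized_ge].
Qed.

Lemma lower_env_le k y g : lip_class K g -> lower_env k y <= penalized k y g.
Proof. by move=> Kg; apply: ge_inf; [exact: (hinf k y).2|exists g]. Qed.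

Lemma lower_env_evals k g : lip_class K g -> lower_env k (evals g) <= h g.
Proof.
move=> Kg; apply: le_trans (lower_env_le k (evals g) Kg) _.
by rewrite /penalized /l1dist big1 ?mulr0 ?addr0// => i _; rewrite subrr Normc.normc0.
Qed.

Lemma lower_env_lip k x y : lower_env k x - lower_env k y <= k%:R * l1dist k x y.
Proof.
rewrite lerBlDr addrC -lerBlDr.
apply: lb_le_inf; first exact: (hinf k y).1.
move=> _ [g Kg <-]; rewrite lerBlDr.
apply: le_trans (lower_env_le k x Kg) _.
rewrite /penalized -addrA lerD2l -mulrDr ler_wpM2l// addrC.
exact: l1dist_tri.
Qed.

(** A competitor [g] is either close to [f] at the first points, so that [h g] is close to [h f], or
    far at one of them, and then the penalty outweighs any gain in [h]. *)
Lemma lower_env_cvg f (e : R) : continuous h -> lip_class K f -> 0 < e ->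
  exists k0 : nat, forall k, (k0 <= k)%N -> h f - e <= lower_env k (evals f).
Proof.
move=> ch Kf e0; have [k [d d0 H]] := continuous_lip_class ch Kf e0.
(* Beyond this index [n * d >= 2 * M], the largest possible gap between two values of [h]. *)
exists (maxn k (Num.truncn (2 * M / d)).+1) => n; rewrite geq_max => /andP[kn nd].
apply: lb_le_inf; first exact: (hinf n (evals f)).1.
move=> _ [g Kg <-].
have [cl|ncl] := pselect (forall i, (i < k)%N ->
    cabs (Sigma'_val f (zseq i) - Sigma'_val g (zseq i)) < d).
  have := H g Kg cl; rewrite ltr_norml => /andP[_ hfg].
  apply: (@le_trans _ _ (h g)); first lra.
  by rewrite lerDl mulr_ge0// l1dist_ge0.
have [i [ik di]] : exists i, (i < k)%N /\
    d <= cabs (Sigma'_val f (zseq i) - Sigma'_val g (zseq i)).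
  apply: contrapT => nex; apply: ncl => i ik; rewrite ltNge; apply/negP => di.
  by apply: nex; exists i.
have dl : d <= l1dist n (evals f) (evals g).
  apply: le_trans di _; rewrite /l1dist (bigD1 (Ordinal (leq_trans ik kn)))//=.
  by rewrite lerDl sumr_ge0// => j _; exact: cabs_ge0.
have Mn : 2 * M <= n%:R * l1dist n (evals f) (evals g).
  apply: (@le_trans _ _ (n%:R * d)); last by rewrite ler_wpM2l.
  rewrite -ler_pdivrMr//; apply: ltW; apply: lt_le_trans (truncnS_gt _) _.
  by rewrite ler_nat.
rewrite /penalized; have := hM f; have := hM g; rewrite !ler_norml.
by move=> /andP[g1 g2] /andP[f1 f2]; lra.
Qed.

(** It holds on all of Sigma', by the Lipschitz bound and the continuity of point evaluations; this
    makes the envelope of a random element measurable. *)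
Lemma continuous_lower_env k : continuous (fun g => lower_env k (evals g)).
Proof.
move=> f; apply/(@cvgrPdist_lt _ _ _ (nbhs f) (nbhs_filter f)) => e e0.
pose d := e / (k%:R * k%:R + 1).
have k1 : 0 < k%:R * k%:R + 1 :> R by rewrite ltr_wpDl// mulr_ge0.
have d0 : 0 < d by rewrite divr_gt0.
have : \forall g \near f, forall i, (i < k)%N ->
    cabs (evals f i - evals g i) < d.
  have FF := nbhs_filter f.
  elim: k {d k1 d0} (d) (d0) => [|m IH] d d0; first by apply: (filterS _ filterT).
  apply: filterS2 (IH d d0) (near_eval f (zseq_Delta m) d0) => g h1 h2 i.
  by rewrite ltnS leq_eqVlt => /orP[/eqP->//|/h1].
apply: filterS => g Hg.
have H : k%:R * l1dist k (evals f) (evals g) < e.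
  apply: (@le_lt_trans _ _ (k%:R * (k%:R * d))).
    rewrite ler_wpM2l// mulr_natl -[X in d *+ X]card_ord -sumr_const.
    by apply: ler_sum => i _; apply/ltW/Hg.
  by rewrite mulrA /d mulrA ltr_pdivrMr// mulrC ltr_pM2l// ltrDl.
rewrite ltr_norml; apply/andP; split.
  rewrite ltrNl opprB; apply: le_lt_trans (lower_env_lip _ _ _) _.
  by rewrite /l1dist; under eq_bigr do rewrite cabsB.
exact: le_lt_trans (lower_env_lip _ _ _) H.
Qed.

End lower_envelope.

End lipschitz_class.

Lemma continuous_Borel (R : realType) (T : ptopologicalType) (h : T -> R) :
  continuous h -> measurable_fun setT (h : Borel T -> R).
Proof.
move=> /continuousP ch; apply: (measurability _ (RGenOpens.measurableE R)).
move=> _ [_ [a [b ->] <-]]; rewrite setTI; apply: sub_sigma_algebra.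
by apply: ch; exact: interval_open.
Qed.

(** * Expectations of bounded functions *)

Section bounded_measurable.
Context {R : realType} {d : measure_display} {T : measurableType d}.
Implicit Types (f g : T -> R) (A : set T).

Definition bm f := measurable_fun setT f /\ exists M : R, forall x, `|f x| <= M.

Lemma bm_bound f : bm f -> exists2 M : R, 0 < M & forall x, `|f x| <= M.
Proof.
move=> [_ [M HM]]; exists (`|M| + 1); first by rewrite ltr_wpDl.
by move=> x; apply: le_trans (HM x) _; apply: le_trans (ler_norm M) _; rewrite lerDl.
Qed.

Lemma bm_cst (c : R) : bm (fun=> c).
Proof. by split; [exact: measurable_cst|exists `|c|]. Qed.

Lemma bmD f g : bm f -> bm g -> bm (fun x => f x + g x).
Proof.
move=> [mf [M HM]] [mg [N HN]]; split; first exact: measurable_funD.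
by exists (M + N) => x; apply: le_trans (ler_normD _ _) _; exact: lerD.
Qed.

Lemma bmM f g : bm f -> bm g -> bm (fun x => f x * g x).
Proof.
move=> bf bg; have [M M0 HM] := bm_bound bf; have [N N0 HN] := bm_bound bg.
split; first by apply: measurable_funM; [exact: bf.1|exact: bg.1].
by exists (M * N) => x; rewrite normrM ler_pM.
Qed.

Lemma bmZ (c : R) f : bm f -> bm (fun x => c * f x).
Proof. by apply: bmM; exact: bm_cst. Qed.

Lemma bmB f g : bm f -> bm g -> bm (fun x => f x - g x).
Proof.
move=> bf /(bmZ (-1)) bg; have := bmD bf bg.
by under eq_fun do rewrite mulN1r.
Qed.

Lemma bm_sum (I : Type) (s : seq I) (P : pred I) (F : I -> T -> R) :
  (forall i, bm (F i)) -> bm (fun x => \sum_(i <- s | P i) F i x).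
Proof.
move=> bF; elim: s => [|i s IH].
  by under eq_fun do rewrite big_nil; exact: bm_cst.
under eq_fun do rewrite big_cons; case: (P i) => //; exact: bmD.
Qed.

Lemma bm_prod (I : Type) (s : seq I) (P : pred I) (F : I -> T -> R) :
  (forall i, bm (F i)) -> bm (fun x => \prod_(i <- s | P i) F i x).
Proof.
move=> bF; elim: s => [|i s IH].
  by under eq_fun do rewrite big_nil; exact: bm_cst.
under eq_fun do rewrite big_cons; case: (P i) => //; exact: bmM.
Qed.

Lemma bm_indic A : measurable A -> bm (\1_A : T -> R).
Proof.
move=> mA; split; first exact: measurable_indic.
by exists 1 => x; rewrite indicE; case: (x \in A); rewrite ?normr1 ?normr0.
Qed.

Lemma bm_norm f : bm f -> bm (fun x => `|f x|).
Proof.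
move=> [mf [M HM]]; split; first exact: measurableT_comp.
by exists M => x; rewrite normr_id.
Qed.

End bounded_measurable.

Lemma bm_comp (R : realType) d (T : measurableType d) d' (T' : measurableType d')
    (f : T' -> R) (X : T -> T') :
  bm f -> measurable_fun setT X -> bm (fun x => f (X x)).
Proof.
move=> [mf [M HM]] mX; split; first exact: measurableT_comp.
by exists M => x; exact: HM.
Qed.

(** Identities linear in a bounded measurable function are reduced to indicators by uniform
    approximation with simple functions, in place of a monotone class argument. *)
Lemma bm_functional0 (R : realType) d (T : measurableType d)
    (L : (T -> R) -> R) (B : R) :
  (forall f g, bm f -> bm g -> L (fun x => f x + g x) = L f + L g) ->
  (forall c f, bm f -> L (fun x => c * f x) = c * L f) ->
  (forall f M, bm f -> (forall x, `|f x| <= M) -> `|L f| <= B * M) ->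
  (forall A, measurable A -> L (\1_A) = 0) ->
  forall f, bm f -> L f = 0.
Proof.
move=> LD LZ LB L1 f bf; have [M M0 HM] := bm_bound bf.
have B0 : 0 <= B.
  have := LB (fun=> 1) 1 (bm_cst 1) (fun _ => _); rewrite mulr1 => H.
  by apply: le_trans (H _); rewrite ?normr1.
suff key n : `|L f| <= B * n.+1%:R^-1.
  apply/eqP; rewrite -normr_le0 leNgt; apply/negP => L0.
  have := key (Num.truncn (B / `|L f|)).
  rewrite ler_pdivlMr ?ltr0n// leNgt => /negP; apply.
  by rewrite mulrC -ltr_pdivrMr// truncnS_gt.
(* [f + M] takes values in [[0, 2 M]], cut here at the multiples of [1 / (n + 1)]. *)
pose J := (Num.truncn (2 * M * n.+1%:R)).+1.
pose A j := [set x | j%:R <= (f x + M) * n.+1%:R < j.+1%:R].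
have mg : measurable_fun setT (fun x => (f x + M) * n.+1%:R).
  apply: measurable_funM; last exact: measurable_cst.
  by apply: measurable_funD; [exact: bf.1|exact: measurable_cst].
have mA j : measurable (A j).
  rewrite (_ : A j = (fun x => (f x + M) * n.+1%:R) @^-1` `[j%:R, j.+1%:R[).
    by rewrite -[_ @^-1` _]setTI; apply: mg => //; exact: measurable_itv.
  by apply/seteqP; split=> x /=; rewrite in_itv.
pose fn x := \sum_(j < J) (j%:R / n.+1%:R - M) * \1_(A j) x.
have bfn : bm fn by apply: bm_sum => j; apply: bmZ; exact: bm_indic.
have Lsum (s : seq 'I_J) :
    L (fun x => \sum_(j <- s) (j%:R / n.+1%:R - M) * \1_(A j) x) = 0.
  elim: s => [|j s IH].
    rewrite [X in L X](_ : _ = fun x => 0 * (fun=> 1 : R) x).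
      by rewrite LZ ?mul0r//; exact: bm_cst.
    by apply/funext => x; rewrite big_nil mul0r.
  rewrite [X in L X](_ : _ = fun x => (j%:R / n.+1%:R - M) * \1_(A j) x +
     \sum_(j <- s) (j%:R / n.+1%:R - M) * \1_(A j) x); last first.
    by apply/funext => x; rewrite big_cons.
  rewrite LD ?IH ?LZ ?L1 ?mulr0 ?addr0//.
  - exact: bm_indic.
  - by apply: bmZ; exact: bm_indic.
  - by apply: bm_sum => i; apply: bmZ; exact: bm_indic.
have fnE x : `|f x - fn x| <= n.+1%:R^-1.
  pose v := (f x + M) * n.+1%:R.
  have n0 : 0 < n.+1%:R :> R by rewrite ltr0n.
  have fM : 0 <= f x + M <= 2 * M.
    by have := HM x; rewrite ler_norml => /andP[? ?]; apply/andP; lra.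
  have v0 : 0 <= v by rewrite mulr_ge0//; case/andP: fM.
  have /andP[v1 v2] := truncn_itv v0.
  have jJ : (Num.truncn v < J)%N.
    by rewrite ltnS le_truncn// ler_wpM2r//; case/andP: fM.
  rewrite /fn (bigD1 (Ordinal jJ))//= big1 ?addr0.
    rewrite indicE mem_set ?mulr1//=; last by apply/andP.
    have -> : f x - ((Num.truncn v)%:R / n.+1%:R - M) =
        (v - (Num.truncn v)%:R) / n.+1%:R.
      have vE (q a t m : R) : q != 0 -> a - (t / q - m) = ((a + m) * q - t) / q.
        by move=> q0; field.
      by apply: vE; rewrite lt0r_neq0.
    rewrite normrM [`|_^-1|]ger0_norm ?invr_ge0// ger_pMl ?invr_gt0//.
    rewrite ger0_norm ?subr_ge0// lerBlDr -natr1 in v2 *.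
    by rewrite addrC ltW.
  move=> j jv; rewrite indicE memNset ?mulr0//= => /andP[j1 j2].
  move/negP: jv; apply; apply/eqP/val_inj => /=; apply/eqP.
  by rewrite eq_sym truncn_eq// j1.
have Lfn : L fn = 0 by exact: Lsum.
have -> : L f = L (fun x => f x - fn x).
  have := LD (fun x => f x - fn x) fn (bmB bf bfn) bfn; rewrite Lfn addr0 => <-.
  by congr L; apply/funext => x; rewrite subrK.
by apply: LB => //; exact: bmB.
Qed.

Section expectation.
Context {R : realType} {d : measure_display} {T : measurableType d}.
Variable P : probability T R.
Implicit Types f g : T -> R.

Definition Ex f : R := \int[P]_x f x.

Lemma bm_integrable f : bm f -> P.-integrable setT (EFin \o f).
Proof.
move=> [mf [M HM]]; apply: measurable_bounded_integrable => //.
  exact: le_lt_trans (probability_le1 P measurableT) (ltry 1).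
by exists M; split; [exact: num_real|move=> y My x _; apply: le_trans (HM x) (ltW My)].
Qed.

Lemma EFin_Ex f : bm f -> (\int[P]_x (f x)%:E)%E = (Ex f)%:E.
Proof. by move=> bf; rewrite /Ex /Rintegral fineK// integrable_fin_num// bm_integrable. Qed.

Lemma ExD f g : bm f -> bm g -> Ex (fun x => f x + g x) = Ex f + Ex g.
Proof. by move=> bf bg; rewrite /Ex RintegralD//; exact: bm_integrable. Qed.

Lemma ExB f g : bm f -> bm g -> Ex (fun x => f x - g x) = Ex f - Ex g.
Proof. by move=> bf bg; rewrite /Ex RintegralB//; exact: bm_integrable. Qed.

Lemma ExZ c f : bm f -> Ex (fun x => c * f x) = c * Ex f.
Proof. by move=> bf; rewrite /Ex RintegralZl//; exact: bm_integrable. Qed.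

Lemma Ex_cst c : Ex (fun=> c) = c.
Proof.
rewrite /Ex Rintegral_cst// -[RHS]mulr1; congr (_ * _).
exact: (congr1 fine (probability_setT P)).
Qed.

Lemma Ex_le f g : bm f -> bm g -> (forall x, f x <= g x) -> Ex f <= Ex g.
Proof. by move=> bf bg fg; apply: le_Rintegral => //; exact: bm_integrable. Qed.

Lemma Ex_sum (I : Type) (s : seq I) (Q : pred I) (F : I -> T -> R) :
  (forall i, bm (F i)) ->
  Ex (fun x => \sum_(i <- s | Q i) F i x) = \sum_(i <- s | Q i) Ex (F i).
Proof.
move=> bF; elim: s => [|i s IH].
  by rewrite big_nil -[RHS](Ex_cst 0); congr Ex; apply/funext => x; rewrite big_nil.
rewrite big_cons -IH; case: ifPn => Qi.
  rewrite -ExD//; last exact: bm_sum.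
  by congr Ex; apply/funext => x; rewrite big_cons Qi.
by congr Ex; apply/funext => x; rewrite big_cons (negbTE Qi).
Qed.

Lemma Ex_norm_le f M : bm f -> (forall x, `|f x| <= M) -> `|Ex f| <= M.
Proof.
move=> bf H; apply: le_trans (le_normr_Rintegral _ _) _ => //; first exact: bm_integrable.
rewrite -[leRHS]Ex_cst; apply: Ex_le => //; [exact: bm_norm|exact: bm_cst].
Qed.

Lemma Ex_indic A : measurable A -> Ex (\1_A) = fine (P A).
Proof. by move=> mA; rewrite /Ex /Rintegral integral_indic// setIT. Qed.

Lemma Ex_ae f g : bm f -> bm g -> {ae P, forall x, f x = g x} -> Ex f = Ex g.
Proof.
move=> bf bg fg; rewrite /Ex /Rintegral; congr fine; apply: ae_eq_integral => //.
- by apply/measurable_EFinP; exact: bf.1.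
- by apply/measurable_EFinP; exact: bg.1.
- by apply: ae_imp fg => x /= ->.
Qed.

Lemma Ex_cvg (f_ : nat -> T -> R) f M : (forall n, bm (f_ n)) -> bm f ->
  (forall n x, `|f_ n x| <= M) ->
  {ae P, forall x, f_ ^~ x @ \oo --> f x} ->
  Ex (f_ n) @[n --> \oo] --> Ex f.
Proof.
move=> bf_ bf HM cf.
have [] := @dominated_convergence _ _ _ P setT measurableT
  (fun n x => (f_ n x)%:E) (fun x => (f x)%:E) (fun=> M%:E) _ _ _ _ _.
- by move=> n; apply/measurable_EFinP; exact: (bf_ n).1.
- by apply/measurable_EFinP; exact: bf.1.
- by apply: ae_imp cf => x cx _; apply/fine_cvgP; split => //; exact: nearW.
- exact: (bm_integrable (bm_cst M)).
- by apply/aeW => x n _; rewrite lee_fin HM.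
move=> _ _ H.
have := @fine_cvg _ _ _ _ (fun n => \int[P]_x (f_ n x)%:E)%E (Ex f).
by rewrite -EFin_Ex//; apply.
Qed.

End expectation.

(** The weights carry the other factors of a product, so that indicators can be replaced by general
    functions one factor at a time. *)
Lemma Ex_transfer (R : realType) d1 (T1 : measurableType d1) (P1 : probability T1 R)
    d2 (T2 : measurableType d2) (P2 : probability T2 R)
    d' (S : measurableType d') (X1 : T1 -> S) (X2 : T2 -> S)
    (W1 : T1 -> R) (W2 : T2 -> R) :
  measurable_fun setT X1 -> measurable_fun setT X2 -> bm W1 -> bm W2 ->
  (forall A : set S, measurable A ->
    Ex P1 (fun x => W1 x * \1_A (X1 x)) = Ex P2 (fun x => W2 x * \1_A (X2 x))) ->
  forall f, bm f ->
    Ex P1 (fun x => W1 x * f (X1 x)) = Ex P2 (fun x => W2 x * f (X2 x)).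
Proof.
move=> mX1 mX2 bW1 bW2 H f bf; apply/eqP; rewrite -subr_eq0; apply/eqP.
have [M1 M10 HM1] := bm_bound bW1; have [M2 M20 HM2] := bm_bound bW2.
have b1 g : bm g -> bm (fun x => W1 x * g (X1 x)).
  by move=> bg; apply: bmM => //; exact: (bm_comp bg).
have b2 g : bm g -> bm (fun x => W2 x * g (X2 x)).
  by move=> bg; apply: bmM => //; exact: (bm_comp bg).
pose L g := Ex P1 (fun x => W1 x * g (X1 x)) - Ex P2 (fun x => W2 x * g (X2 x)).
apply: (@bm_functional0 _ _ _ L (M1 + M2)) => //.
- move=> g h bg bh; rewrite /L.
  under [in X in X - _]eq_fun do rewrite mulrDr.
  under [in X in _ - X]eq_fun do rewrite mulrDr.
  by rewrite (ExD P1 (b1 _ bg) (b1 _ bh)) (ExD P2 (b2 _ bg) (b2 _ bh)); ring.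
- move=> c g bg; rewrite /L.
  under [in X in X - _]eq_fun do rewrite mulrCA.
  under [in X in _ - X]eq_fun do rewrite mulrCA.
  by rewrite (ExZ P1 _ (b1 _ bg)) (ExZ P2 _ (b2 _ bg)) mulrBr.
- move=> g M bg gM; rewrite /L; apply: le_trans (ler_normB _ _) _.
  rewrite mulrDl; apply: lerD; apply: Ex_norm_le.
  + exact: b1.
  + by move=> x; rewrite normrM ler_pM.
  + exact: b2.
  + by move=> x; rewrite normrM ler_pM.
- by move=> A mA; rewrite /L H// subrr.
Qed.

Lemma bm_cos (R : realType) (c t : R) : bm (fun x : R => cos (t + c * x)).
Proof.
split.
  apply: (measurableT_comp (f := @cos R)).
    by apply: continuous_measurable_fun; exact: continuous_cos.
  by apply: measurable_funD => //; apply: measurable_funM.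
by exists 1 => x; rewrite ler_norml cos_geN1 cos_le1.
Qed.

Lemma bm_sin (R : realType) (c t : R) : bm (fun x : R => sin (t + c * x)).
Proof.
have := bm_cos c (t - pi / 2).
by under eq_fun do rewrite addrAC cosBpihalf.
Qed.

Lemma bm_cosM (R : realType) (c : R) : bm (fun x : R => cos (c * x)).
Proof. by have := bm_cos c 0; under eq_fun do rewrite add0r. Qed.

Lemma bm_sinM (R : realType) (c : R) : bm (fun x : R => sin (c * x)).
Proof. by have := bm_sin c 0; under eq_fun do rewrite add0r. Qed.

Lemma bm_cosine (R : realType) : bm (@cos R).
Proof. by have := bm_cosM (1 : R); under eq_fun do rewrite mul1r. Qed.

(** * Products and cosines of independent variables *)

Section independence.
Context {R : realType} {d : measure_display} {T : measurableType d}.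
Variable P : probability T R.
Implicit Types (X : nat -> T -> R) (A : nat -> set R).

(** [Z] is an extra factor, in the applications 1 or the indicator of an event of the Poisson
    process. In [key] the factors of index below [k] are arbitrary and the others are indicators;
    each induction step frees one more by [Ex_transfer]. *)
Lemma Ex_prod X (Z : T -> R) (z : R) n :
  (forall i, measurable_fun setT (X i)) -> bm Z ->
  (forall A, (forall i, measurable (A i)) ->
    Ex P (fun x => Z x * \prod_(i < n) \1_(A i) (X i x)) =
    z * \prod_(i < n) Ex P (fun x => \1_(A i) (X i x))) ->
  forall phi : nat -> R -> R, (forall i, bm (phi i)) ->
    Ex P (fun x => Z x * \prod_(i < n) phi i (X i x)) =
    z * \prod_(i < n) Ex P (fun x => phi i (X i x)).
Proof.
move=> mX bZ H.
have bc (phi : R -> R) i : bm phi -> bm (fun x => phi (X i x)) by move=> b; exact: (bm_comp b).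
suff key k : forall phi : nat -> R -> R, (forall i, bm (phi i)) ->
    (forall i, (k <= i < n)%N -> exists2 B, measurable B & phi i = \1_B) ->
    Ex P (fun x => Z x * \prod_(i < n) phi i (X i x)) =
    z * \prod_(i < n) Ex P (fun x => phi i (X i x)).
  by move=> phi bphi; apply: (key n) => // i /andP[ni /(leq_ltn_trans ni)]; rewrite ltnn.
elim: k => [|k IH] phi bphi Hphi.
  have /choice[B HB] : forall i, exists B : set R, measurable B /\
      ((i < n)%N -> phi i = \1_B).
    move=> i; have [ni|ni] := ltnP i n.
      by have [B mB ->] := Hphi i ni; exists B.
    by exists set0; split=> //; rewrite ltnNge ni.
  have -> : (fun x => Z x * \prod_(i < n) phi i (X i x)) =
      (fun x => Z x * \prod_(i < n) \1_(B i) (X i x)).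
    by apply/funext => x; congr (_ * _); apply: eq_bigr => i _; rewrite (HB i).2.
  rewrite H; last by move=> i; exact: (HB i).1.
  by congr (_ * _); apply: eq_bigr => i _; rewrite -(HB i).2.
have [nk|kn] := leqP n k.
  apply: IH => // i /andP[ki /(leq_ltn_trans ki)]; by rewrite ltnNge nk.
pose W x := Z x * \prod_(i < n | i != Ordinal kn) phi i (X i x).
pose c := z * \prod_(i < n | i != Ordinal kn) Ex P (fun x => phi i (X i x)).
have bW : bm W by apply: bmM => //; apply: bm_prod => i; exact: bc.
have := @Ex_transfer _ _ _ P _ _ P _ _ (X k) (X k) W (fun=> c) (mX k) (mX k) bW
  (bm_cst c) _ (phi k) (bphi k).
rewrite ExZ; last exact: bc.
have split_prod (psi : R -> R) x : Z x * \prod_(i < n) (if i == k :> nat then psi else phi i) (X i x)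
   = W x * psi (X k x).
  rewrite (bigD1 (Ordinal kn))//= eqxx /W -!mulrA; congr (_ * _); rewrite mulrC.
  by congr (_ * _); apply: eq_bigr => i; rewrite -val_eqE /= => /negbTE ->.
have split_E (psi : R -> R) : z * \prod_(i < n) Ex P (fun x => (if i == k :> nat then psi else phi i) (X i x))
   = c * Ex P (fun x => psi (X k x)).
  rewrite (bigD1 (Ordinal kn))//= eqxx /c -!mulrA; congr (_ * _); rewrite mulrC.
  by congr (_ * _); apply: eq_bigr => i; rewrite -val_eqE /= => /negbTE ->.
have selfE i : (if i == k then phi k else phi i) = phi i by case: eqP => [->|].
move=> E; transitivity (c * Ex P (fun x => phi k (X k x))); last first.
  by rewrite -split_E; congr (_ * _); apply: eq_bigr => i _; rewrite selfE.
rewrite -E.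
  congr Ex; apply/funext => x; rewrite -split_prod; congr (_ * _).
  by apply: eq_bigr => i _; rewrite selfE.
move=> B mB; rewrite ExZ; last by apply: bc; exact: bm_indic.
rewrite -split_E -(IH (fun i => if i == k then \1_B else phi i)).
- by congr Ex; apply/funext => x; rewrite -split_prod.
- by move=> i; case: eqP => // _; exact: bm_indic.
- move=> i /andP[ki ni]; case: eqP => [_|/eqP ik]; first by exists B.
  by apply: Hphi; rewrite ni andbT ltn_neqAle eq_sym ik.
Qed.

(** The characteristic function of a sum, kept real: the sine transforms vanish, and writing a sine
    as a cosine of shifted phase lets the induction, over a free phase, involve cosines only. *)
Lemma Ex_cos_sum X (Z : T -> R) (z : R) n (c a : nat -> R) :
  (forall i, measurable_fun setT (X i)) -> bm Z ->
  (forall phi : nat -> R -> R, (forall i, bm (phi i)) ->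
    Ex P (fun x => Z x * \prod_(i < n) phi i (X i x)) =
    z * \prod_(i < n) Ex P (fun x => phi i (X i x))) ->
  (forall i, (i < n)%N -> Ex P (fun x => cos (c i * X i x)) = a i /\
     Ex P (fun x => sin (c i * X i x)) = 0) ->
  forall t, Ex P (fun x => Z x * cos (t + \sum_(i < n) c i * X i x)) =
    z * (cos t * \prod_(i < n) a i).
Proof.
move=> mX bZ H Ha t.
have bc (phi : R -> R) i : bm phi -> bm (fun x => phi (X i x)) by move=> b; exact: (bm_comp b).
have bS k s : bm (fun x => cos (s + \sum_(i < k) c i * X i x)).
  split; last by exists 1 => x; rewrite ler_norml cos_geN1 cos_le1.
  apply: (measurableT_comp (f := @cos R)).
    by apply: continuous_measurable_fun; exact: continuous_cos.
  apply: measurable_funD => //; apply: measurable_sum => i.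
  by apply: measurable_funM.
(* The first [k] variables sit inside the cosine and the others are arbitrary factors, which receive
   what the addition formula splits off. *)
suff key k : (k <= n)%N -> forall s (phi : nat -> R -> R), (forall i, bm (phi i)) ->
    Ex P (fun x => Z x * (cos (s + \sum_(i < k) c i * X i x) *
      \prod_(k <= i < n) phi i (X i x))) =
    z * (cos s * \prod_(i < k) a i * \prod_(k <= i < n) Ex P (fun x => phi i (X i x))).
  have := key n (leqnn n) t (fun _ _ => 1) (fun=> bm_cst 1).
  rewrite [X in _ = z * (_ * X)]big_geq// mulr1 => <-; congr Ex; apply/funext => x.
  by rewrite big_geq// mulr1.
elim: k => [|k IH] kn s phi bphi.
  rewrite big_ord0 mulr1 !big_mkord.
  have -> : (fun x => Z x * (cos (s + \sum_(i < 0) c i * X i x) *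
       \prod_(0 <= i < n) phi i (X i x))) =
     (fun x => cos s * (Z x * \prod_(i < n) phi i (X i x))).
    by apply/funext => x; rewrite big_ord0 addr0 big_mkord mulrCA.
  rewrite ExZ; last by apply: bmM => //; apply: bm_prod => i; exact: bc.
  by rewrite H// mulrCA.
pose phi1 (f : R -> R) i := if i == k then f else phi i.
have bphi1 f i : bm f -> bm (phi1 f i) by rewrite /phi1; case: eqP.
have [b1 b2] := (bm_cosM (c k), bm_sinM (c k)).
have bG f s' : bm f -> bm (fun x => Z x * (cos (s' + \sum_(i < k) c i * X i x) *
      \prod_(k <= i < n) phi1 f i (X i x))).
  move=> bf; apply: bmM => //; apply: bmM => //; apply: bm_prod => i.
  by apply: bc; exact: bphi1.
have big1E f x : \prod_(k <= i < n) phi1 f i (X i x) =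
    f (X k x) * \prod_(k.+1 <= i < n) phi i (X i x).
  rewrite big_ltn// /phi1 eqxx; congr (_ * _).
  by apply: eq_big_nat => i /andP[ki _]; rewrite gtn_eqF.
have bigEE f : \prod_(k <= i < n) Ex P (fun x => phi1 f i (X i x)) =
    Ex P (fun x => f (X k x)) * \prod_(k.+1 <= i < n) Ex P (fun x => phi i (X i x)).
  rewrite big_ltn// /phi1 eqxx; congr (_ * _).
  by apply: eq_big_nat => i /andP[ki _]; rewrite gtn_eqF.
have [Ec Es] := Ha k kn.
transitivity (Ex P (fun x =>
   Z x * (cos (s + \sum_(i < k) c i * X i x) *
     \prod_(k <= i < n) phi1 (fun y => cos (c k * y)) i (X i x)) -
   Z x * (cos (s - pi / 2 + \sum_(i < k) c i * X i x) *
     \prod_(k <= i < n) phi1 (fun y => sin (c k * y)) i (X i x)))).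
  congr Ex; apply/funext => x; rewrite !big1E big_ord_recr/= addrA cosD.
  by rewrite -(cosBpihalf (s + _)) [s + _ - _]addrAC; ring.
rewrite (ExB P (bG _ _ b1) (bG _ _ b2)).
rewrite (IH (ltnW kn) s _ (fun i => bphi1 _ i b1)).
rewrite (IH (ltnW kn) (s - pi / 2) _ (fun i => bphi1 _ i b2)).
by rewrite !bigEE Ec Es big_ord_recr/=; ring.
Qed.

Lemma Ex_preimage (X : T -> R) (A : set R) : measurable_fun setT X ->
  measurable A -> Ex P (fun x => \1_A (X x)) = fine (P (X @^-1` A)).
Proof.
move=> mX mA; rewrite -Ex_indic; last by rewrite -[X in measurable X]setTI; exact: mX.
by congr Ex; apply/funext => x; rewrite !indicE; congr (_ _)%:R; apply/idP/idP => /set_mem h;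
  apply/mem_set.
Qed.

Lemma indep_indic X (B : set T) n A :
  measurable B -> (forall i, measurable_fun setT (X i)) ->
  (forall i, measurable (A i)) ->
  P (B `&` \bigcap_(i in [set` iota 0 n]) X i @^-1` A i) =
    (P B * \prod_(i <- iota 0 n) P (X i @^-1` A i))%E ->
  Ex P (fun x => \1_B x * \prod_(i < n) \1_(A i) (X i x)) =
    fine (P B) * \prod_(i < n) Ex P (fun x => \1_(A i) (X i x)).
Proof.
move=> mB mX mA H.
have mXA i : measurable (X i @^-1` A i).
  by rewrite -[X in measurable X]setTI; exact: mX.
have -> : (fun x => \1_B x * \prod_(i < n) \1_(A i) (X i x)) =
   \1_(B `&` \bigcap_(i in [set` iota 0 n]) X i @^-1` A i) :> (T -> R).
  apply/funext => x; rewrite indicI; congr (_ * _).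
  have [h|h] := pselect (forall i, (i < n)%N -> A i (X i x)).
    rewrite big1 => [|i _]; last by rewrite indicE mem_set//; exact: h.
    rewrite indicE mem_set// => i /=.
    by rewrite mem_iota add0n => /h.
  have [i [ni nA]] : exists i, (i < n)%N /\ ~ A i (X i x).
    apply: contrapT => h'; apply: h => i ni; apply: contrapT => nA; apply: h'.
    by exists i.
  rewrite (bigD1 (Ordinal ni))//= indicE memNset// mul0r.
  rewrite indicE memNset// => /(_ i) /=; rewrite mem_iota add0n => /(_ ni).
  exact: nA.
rewrite Ex_indic; last first.
  apply: measurableI => //; apply: bigcap_measurableType => //.
have finP C : measurable C -> P C \is a fin_num.
  by move=> mC; exact: fin_num_measure.
rewrite H -(fineK (finP _ mB)).
have -> : (\prod_(i <- iota 0 n) P (X i @^-1` A i))%E =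
   (\prod_(i <- iota 0 n) Ex P (fun x => \1_(A i) (X i x)))%:E.
  elim: (iota 0 n) => [|i s IH]; first by rewrite !big_nil.
  by rewrite !big_cons IH EFinM Ex_preimage// fineK// finP.
rewrite -EFinM /= (_ : iota 0 n = index_iota 0 n); last by rewrite /index_iota subn0.
by rewrite big_mkord.
Qed.

End independence.

(** * Fourier coefficients of the Poisson kernel *)

Section density.
Context {R : realType} {d : measure_display} {T : measurableType d}.
Variable P : probability T R.
Local Notation mu := (@lebesgue_measure R).
Local Notation GR := (measurableTypeR R).

Lemma density_integrable (D : set R) (p : R -> R) (X : T -> R) :
  measurable (D : set GR) -> has_density P D p X ->
  measurable_fun (D : set GR) (p : GR -> R) ->
  (forall x, D x -> 0 <= p x) -> mu.-integrable D (EFin \o p).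
Proof.
move=> mD [mX pX] mp p0; apply/integrableP; split; first exact/measurable_EFinP.
have := pX setT measurableT; rewrite setTI preimage_setT => E.
have -> : (\int[mu]_(x in D) `|(EFin \o p) x| = \int[mu]_(x in D) (p x)%:E)%E.
  by apply: eq_integral => x /set_mem Dx /=; rewrite ger0_norm// p0.
by rewrite -E; apply: le_lt_trans (probability_le1 P measurableT) (ltry 1).
Qed.

Lemma density_integrableM (D : set R) (p : R -> R) (X : T -> R) (f : R -> R) :
  measurable (D : set GR) -> has_density P D p X ->
  measurable_fun (D : set GR) (p : GR -> R) ->
  (forall x, D x -> 0 <= p x) -> bm f ->
  mu.-integrable D (EFin \o (fun x => f x * p x)).
Proof.
move=> mD pX mp p0 bf; have ip := density_integrable mD pX mp p0.
have [M M0 HM] := bm_bound bf.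
have mf : measurable_fun (setT : set GR) (f : GR -> R) := bf.1.
apply: (@le_integrable _ _ _ mu D mD _ _ _ _ (integrableZl mD M ip)).
  apply/measurable_EFinP; apply: measurable_funM => //.
  exact: measurable_funTS.
move=> x Dx /=; rewrite lee_fin !normrM [`|M|]ger0_norm ?(ltW M0)//.
by rewrite ler_wpM2r.
Qed.

Lemma Ex_density (D : set R) (p : R -> R) (X : T -> R) (phi : R -> R) :
  measurable (D : set GR) -> has_density P D p X ->
  measurable_fun (D : set GR) (p : GR -> R) ->
  (forall x, D x -> 0 <= p x) -> bm phi ->
  Ex P (fun x => phi (X x)) = \int[mu]_(x in D) (phi x * p x).
Proof.
move=> mD pX mp p0 bphi; have ip := density_integrable mD pX mp p0.
have [mX EX] := pX.
have iphi (f : R -> R) : bm f -> mu.-integrable D (EFin \o (fun x => f x * p x)).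
  exact: density_integrableM pX mp p0.
apply/eqP; rewrite -subr_eq0; apply/eqP.
pose L (f : R -> R) := Ex P (fun x => f (X x)) - \int[mu]_(x in D) (f x * p x).
pose I := \int[mu]_(x in D) p x.
have b (f : R -> R) : bm f -> bm (fun x => f (X x)) by move=> bf; exact: (bm_comp bf).
apply: (@bm_functional0 _ _ _ L (1 + I)) => //.
- move=> f g bf bg; rewrite /L (ExD P (b _ bf) (b _ bg)).
  rewrite (_ : \int[mu]_(x in D) ((f x + g x) * p x) =
    \int[mu]_(x in D) (f x * p x) + \int[mu]_(x in D) (g x * p x)); first ring.
  rewrite -RintegralD//; [|exact: iphi|exact: iphi].
  by apply: eq_Rintegral => x _; rewrite mulrDl.
- move=> c f bf; rewrite /L (ExZ P _ (b _ bf)) mulrBr; congr (_ - _).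
  rewrite -RintegralZl//; last exact: iphi.
  by apply: eq_Rintegral => x _; rewrite mulrA.
- move=> f M bf fM; rewrite /L; apply: le_trans (ler_normB _ _) _.
  rewrite mulrDl mul1r; apply: lerD; first by apply: Ex_norm_le; [exact: b|].
  apply: le_trans (le_normr_Rintegral _ (iphi _ bf)) _ => //.
  rewrite mulrC -RintegralZl//; apply: le_Rintegral => //.
  + by apply: (integrable_norm (iphi _ bf)).
  + exact: (integrableZl mD M ip).
  + by move=> x Dx; rewrite normrM [`|p x|]ger0_norm ?p0// ler_wpM2r ?p0.
- move=> A mA; rewrite /L Ex_preimage// EX//.
  rewrite (_ : \int[mu]_(x in D) (\1_A x * p x) = \int[mu]_(x in A `&` D) p x).
    by rewrite subrr.
  rewrite Rintegral_mkcondl; apply: eq_Rintegral => x _.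
  by rewrite patchE indicE; case: ifPn => _; rewrite ?mul1r ?mul0r.
Qed.

End density.

Section trigonometric_integrals.
Context {R : realType}.
Local Notation mu := (@lebesgue_measure R).

Lemma continuous_cosM (c : R) : continuous (fun x : R => cos (c * x)).
Proof.
move=> x; apply: (continuous_comp (f := fun x => c * x) (g := @cos R)).
  by apply: cvgM; [exact: cvg_cst|exact: cvg_id].
exact: continuous_cos.
Qed.

Lemma continuous_sinM (c : R) : continuous (fun x : R => sin (c * x)).
Proof.
move=> x; apply: (continuous_comp (f := fun x => c * x) (g := @sin R)).
  by apply: cvgM; [exact: cvg_cst|exact: cvg_id].
exact: continuous_sin.
Qed.

Lemma Rintegral_odd (g : R -> R) (a : R) : 0 <= a -> continuous g ->
  (forall x, g (- x) = - g x) -> \int[mu]_(x in `[- a, a]) g x = 0.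
Proof.
move=> a0 cg og.
have ig : mu.-integrable `[- a, a] (EFin \o g).
  apply: continuous_compact_integrable; first exact: segment_compact.
  exact: continuous_subspaceT.
have h : - a <= a by lra.
have := @integration_by_substitution_oppr R g (- a) a h.
rewrite opprK => /(_ (continuous_subspaceT cg)) E.
have : \int[mu]_(x in `[- a, a]) g x = -1 * \int[mu]_(x in `[- a, a]) g x.
  have H : \int[mu]_(x in `[- a, a]) (-1 * g x) =
      -1 * \int[mu]_(x in `[- a, a]) g x.
    by apply: RintegralZl => //; exact: measurable_itv.
  rewrite -H /Rintegral E; congr fine.
  by apply: eq_integral => x _ /=; rewrite og mulN1r.
by lra.
Qed.

Lemma Rintegral_cos (n : nat) : (0 < n)%N ->
  \int[mu]_(x in `[- pi, pi]) cos (n%:R * x) = 0.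
Proof.
move=> n0; have n0' : n%:R != 0 :> R by rewrite pnatr_eq0 -lt0n.
pose F x : R := n%:R^-1 * sin (n%:R * x).
have dF (x : R) : is_derive x (1 : R) F (cos (n%:R * x)).
  have H1 : is_derive x 1 (fun y : R => n%:R * y) n%:R.
    have := @is_deriveZ R R R id n%:R x 1 1 _.
    by rewrite /GRing.scale /= mulr1; exact.
  have := @is_deriveZ R R R (@sin R \o (fun y => n%:R * y)) n%:R^-1 x 1 _
    (@is_derive1_comp R (@sin R) (fun y => n%:R * y) x _ _ (is_derive_sin _) H1).
  by rewrite /GRing.scale /= mulrCA mulVf// mulr1; exact.
have cF : continuous F.
  by move=> x; apply: cvgM; [exact: cvg_cst|exact: continuous_sinM].
have sinn m : sin (m%:R * pi) = 0 :> R.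
  elim: m => [|m IH]; first by rewrite mul0r sin0.
  by rewrite -natr1 mulrDl mul1r sinDpi IH oppr0.
rewrite /Rintegral (@continuous_FTC2 _ _ F)//.
- by rewrite /F mulrN sinN sinn oppr0 !mulr0 subee.
- by have := pi_gt0 R; lra.
- by apply: continuous_subspaceT; exact: continuous_cosM.
- split.
  + by move=> x _; exact: ex_derive.
  + by apply: cvg_at_right_filter; exact: cF.
  + by apply: cvg_at_left_filter; exact: cF.
- by move=> x _; rewrite derive1E derive_val.
Qed.

End trigonometric_integrals.

Section poisson_kernel.
Context {R : realType}.
Local Notation mu := (@lebesgue_measure R).
Local Notation GR := (measurableTypeR R).
Variable r : R.
Hypothesis r01 : 0 < r < 1.

Lemma poisson_denom_gt0 (x : R) : 0 < 1 - 2 * r * cos x + r ^+ 2.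
Proof.
have /andP[r0 r1] := r01; have := cos_le1 x.
have : 0 < (1 - r) ^+ 2 by rewrite exprn_gt0// subr_gt0.
move=> h1; rewrite -subr_ge0 => h2; have := mulr_ge0 (ltW r0) h2.
by rewrite sqrrB in h1; lra.
Qed.

Lemma poisson_kernelE (x : R) :
  (1 - 2 * r * cos x + r ^+ 2) * poisson_kernel r x = (2 * pi)^-1 * (1 - r ^+ 2).
Proof.
rewrite /poisson_kernel mulrCA; congr (_ * _).
by rewrite mulrC divfK// lt0r_neq0// poisson_denom_gt0.
Qed.

Lemma poisson_kernel_ge0 (x : R) : 0 <= poisson_kernel r x.
Proof.
have /andP[r0 r1] := r01; have := pi_gt0 R => p0.
apply: mulr_ge0; first by rewrite invr_ge0 mulr_ge0 ?(ltW p0).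
apply: divr_ge0.
  by rewrite subr_ge0 exprn_ile1// ltW.
by rewrite ltW// poisson_denom_gt0.
Qed.

Lemma continuous_poisson_kernel : continuous (poisson_kernel r).
Proof.
move=> x; apply: cvgM; first exact: cvg_cst.
apply: cvgM; first exact: cvg_cst.
apply: cvgV; first by rewrite lt0r_neq0// poisson_denom_gt0.
apply: cvgD; last exact: cvg_cst.
apply: cvgB; first exact: cvg_cst.
by apply: cvgM; [exact: cvg_cst|exact: continuous_cos].
Qed.

Context {d : measure_display} {T : measurableType d}.
Variables (P : probability T R) (X : T -> R).
Hypothesis pX : has_density P `[- pi, pi] (poisson_kernel r) X.

Let Ed (phi : R -> R) : bm phi ->
  Ex P (fun x => phi (X x)) = \int[mu]_(x in `[- pi, pi]) (phi x * poisson_kernel r x).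
Proof.
move=> bphi; apply: (Ex_density (measurable_itv _) pX) => //.
  by apply: measurable_funTS; apply: continuous_measurable_fun;
    exact: continuous_poisson_kernel.
by move=> x _; exact: poisson_kernel_ge0.
Qed.

Let bcos (n : nat) := bm_cosM (n%:R : R).
Let bsin (n : nat) := bm_sinM (n%:R : R).

Let bc (phi : R -> R) : bm phi -> bm (fun x => phi (X x)).
Proof. by move=> b; apply: (bm_comp b); exact: pX.1. Qed.

Let e n := Ex P (fun x => cos (n%:R * X x)).

(* From [(1 - 2 r cos t + r^2) * poisson_kernel r t] being constant. *)
Let erec n : (1 + r ^+ 2) * e n.+1 = r * (e n.+2 + e n).
Proof.
pose psi (x : R) := (1 + r ^+ 2) * cos (n.+1%:R * x) -
  r * (cos (n.+2%:R * x) + cos (n%:R * x)).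
have bpsi : bm psi.
  by apply: bmB; apply: bmZ => //; exact: bmD.
have := Ed bpsi.
rewrite (_ : Ex P _ = (1 + r ^+ 2) * e n.+1 - r * (e n.+2 + e n)); last first.
  rewrite /psi (ExB P (bmZ _ (bc (bcos n.+1))) (bmZ _ (bmD (bc (bcos n.+2)) (bc (bcos n))))).
  by rewrite (ExZ P _ (bc (bcos n.+1))) (ExZ P _ (bmD (bc (bcos n.+2)) (bc (bcos n)))) (ExD P (bc (bcos n.+2)) (bc (bcos n))).
rewrite (_ : Rintegral _ _ _ = 0); first by move/eqP; rewrite subr_eq0 => /eqP.
rewrite -(mulr0 ((2 * pi)^-1 * (1 - r ^+ 2))) -(@Rintegral_cos R n.+1)//.
rewrite -RintegralZl//; last first.
  apply: continuous_compact_integrable; first exact: segment_compact.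
  by apply: continuous_subspaceT; exact: continuous_cosM.
apply: eq_Rintegral => x _.
have -> : psi x = (1 - 2 * r * cos x + r ^+ 2) * cos (n.+1%:R * x).
  rewrite /psi (_ : n.+2%:R * x = n.+1%:R * x + x); last by rewrite -[n.+2%:R]natr1; ring.
  rewrite (_ : n%:R * x = n.+1%:R * x - x); last by rewrite -[n.+1%:R]natr1; ring.
  by rewrite cosD cosB; ring.
by rewrite mulrAC poisson_kernelE.
Qed.

Let e0 : e 0%N = 1.
Proof. by rewrite /e -[RHS](Ex_cst P); congr Ex; apply/funext => x; rewrite mul0r cos0. Qed.

(** The frequency-0 case of the recurrence: the constant integrates to [1 - r^2], so
    [1 + r^2 - 2 r (e 1) = 1 - r^2], and [r] is nonzero. *)
Let e1 : e 1%N = r.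
Proof.
have /andP[r0 r1] := r01; have pi0 := pi_gt0 R.
pose psi (x : R) := (1 + r ^+ 2) * 1 - 2 * r * cos (1%:R * x).
have bpsi : bm psi by apply: bmB; apply: bmZ => //; exact: bm_cst.
have := Ed bpsi.
rewrite (_ : Ex P _ = (1 + r ^+ 2) - 2 * r * e 1%N); last first.
  rewrite /psi (ExB P (bmZ _ (bm_cst 1)) (bmZ _ (bc (bcos 1)))).
  by rewrite (ExZ P _ (bm_cst 1)) (ExZ P _ (bc (bcos 1))) Ex_cst mulr1.
rewrite (_ : Rintegral _ _ _ = 1 - r ^+ 2).
  move=> h; have : r * (e 1%N - r) = 0 by rewrite mulrBr -expr2; lra.
  by move/eqP; rewrite mulf_eq0 (gt_eqF r0)/= subr_eq0 => /eqP.
transitivity (\int[mu]_(x in `[- pi, pi]) ((2 * pi)^-1 * (1 - r ^+ 2))).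
  apply: eq_Rintegral => x _; rewrite -(poisson_kernelE x) /psi; congr (_ * _).
  by rewrite mul1r mulr1; ring.
rewrite Rintegral_cst//.
have -> : fine (mu `[- pi, pi]) = pi + pi.
  have H := lebesgue_measure_itv `[- pi, pi : R].
  rewrite (congr1 fine H) /= lte_fin ifT; last by lra.
  by rewrite /= opprK.
suff H (a b : R) : 0 < a -> (2 * a)^-1 * b * (a + a) = b by exact: H.
by move=> a0; field; rewrite lt0r_neq0.
Qed.

Lemma poisson_kernel_cos n : Ex P (fun x => cos (n%:R * X x)) = r ^+ n.
Proof.
have /andP[r0 r1] := r01.
suff : e n = r ^+ n /\ e n.+1 = r ^+ n.+1 by case.
elim: n => [|n [IH1 IH2]]; first by rewrite e0 e1.
split=> //; apply: (mulfI (lt0r_neq0 r0)).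
have := erec n; rewrite IH1 IH2 mulrDr => h.
apply: (addIr (r * r ^+ n)); rewrite -h.
by rewrite -[n.+2]addn2 -[n.+1]addn1 !exprD; ring.
Qed.

Lemma poisson_kernel_sin n : Ex P (fun x => sin (n%:R * X x)) = 0.
Proof.
rewrite (Ed (bsin n)); apply: Rintegral_odd; first exact: pi_ge0.
  move=> x; apply: cvgM; [exact: continuous_sinM|exact: continuous_poisson_kernel].
by move=> x; rewrite mulrN sinN /poisson_kernel cosN mulNr.
Qed.

End poisson_kernel.

(** * Characteristic function of the Cauchy process *)

Section derivation_rules.
Context {R : realType}.
Implicit Types (f g : R -> R) (x : R).

Lemma der_mul f g x df dg : is_derive x 1 f df -> is_derive x 1 g dg ->
  is_derive x (1 : R) (fun y => f y * g y) (f x * dg + g x * df).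
Proof. by move=> hf hg; exact: (@is_deriveM R R f g x 1 df dg hf hg). Qed.

Lemma der_add f g x df dg : is_derive x 1 f df -> is_derive x 1 g dg ->
  is_derive x (1 : R) (fun y => f y + g y) (df + dg).
Proof. by move=> hf hg; exact: (@is_deriveD R R R f g x 1 df dg hf hg). Qed.

Lemma der_scale (c : R) f x df : is_derive x 1 f df ->
  is_derive x (1 : R) (fun y => c * f y) (c * df).
Proof. by move=> hf; exact: (@is_deriveZ R R R f c x 1 df hf). Qed.

Lemma der_comp f g x df dg : is_derive (g x) 1 f df -> is_derive x 1 g dg ->
  is_derive x (1 : R) (fun y => f (g y)) (df * dg).
Proof. by move=> hf hg; exact: (@is_derive1_comp R f g x df dg hf hg). Qed.

Lemma der_lin (c : R) x : is_derive x (1 : R) (fun y => c * y) c.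
Proof. by have := der_scale c (is_derive_id x (1 : R)); rewrite mulr1; exact. Qed.

Lemma der_cst (c : R) x : is_derive x (1 : R) (fun=> c) 0.
Proof. exact: is_derive_cst. Qed.

Lemma der_eq f x df df' : is_derive x (1 : R) f df -> df = df' ->
  is_derive x (1 : R) f df'.
Proof. by move=> h <-. Qed.

Lemma der_ext f g x df : f =1 g -> is_derive x (1 : R) f df ->
  is_derive x (1 : R) g df.
Proof. by move=> /funext ->. Qed.

Lemma der_expN (c : R) x :
  is_derive x (1 : R) (fun y => expR (- (c * y))) (- c * expR (- (c * x))).
Proof.
rewrite mulrC; apply: (der_ext (f := fun y => expR (- c * y))).
  by move=> y; rewrite mulNr.
by rewrite -mulNr; apply: der_comp (is_derive_expR _) (der_lin _ _).
Qed.

Lemma der_cosM (c : R) x :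
  is_derive x (1 : R) (fun y => cos (c * y)) (- sin (c * x) * c).
Proof. exact: der_comp (is_derive_cos _) (der_lin _ _). Qed.

Lemma der_sinM (c : R) x :
  is_derive x (1 : R) (fun y => sin (c * y)) (cos (c * x) * c).
Proof. exact: der_comp (is_derive_sin _) (der_lin _ _). Qed.

Lemma der_continuous f (df : R -> R) : (forall x, is_derive x (1 : R) f (df x)) ->
  continuous f.
Proof. by move=> h x; apply: differentiable_continuous; apply/derivable1_diffP; exact: ex_derive. Qed.

Lemma cvgy0 f (C : R) : (forall x, 0 < x -> `|f x| <= C / x) ->
  f x @[x --> +oo] --> 0.
Proof.
move=> H; apply/cvgrPdist_le => e e0; near=> x.
have x0 : 0 < x by near: x; exact: nbhs_pinfty_gt.
rewrite sub0r normrN; apply: le_trans (H x x0) _.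
by rewrite ler_pdivrMr// mulrC -ler_pdivrMr//.
Unshelve. all: by end_near. Qed.

Lemma integral0y_FTC (f F : R -> R) (l : R) :
  (forall x, 0 <= x -> 0 <= f x) -> continuous f ->
  (forall x, is_derive x (1 : R) F (f x)) -> F x @[x --> +oo] --> l ->
  (\int[@lebesgue_measure R]_(x in `[0%R, +oo[) (f x)%:E = (l - F 0)%:E)%E.
Proof.
move=> f0 cf dF Fl; rewrite (@ge0_continuous_FTC2y _ f F 0 l)//.
- exact: continuous_subspaceT.
- by apply: cvg_at_right_filter; exact: (der_continuous dF).
- by move=> x _; rewrite derive1E; exact: derive_val.
Qed.

End derivation_rules.

(** * Explicit integrals on the half line *)

Section laplace.
Context {R : realType}.
Local Notation mu := (@lebesgue_measure R).
Local Notation GR := (measurableTypeR R).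

Lemma expRN_le (y : R) : 0 < y -> expR (- y) <= y^-1.
Proof.
move=> y0; rewrite expRN lef_pV2 ?posrE ?expR_gt0//.
by apply: le_trans (expR_ge1Dx y); rewrite lerDr.
Qed.

Lemma mul_expRN_le (y : R) : 0 < y -> y * expR (- y) <= 2 / y.
Proof.
move=> y0; have := @expR_ge1Dxn R y 1 (ltW y0); rewrite (_ : 2`! = 2%N)// => h.
rewrite expRN ler_pdivrMr ?expR_gt0// mulrAC ler_pdivlMr// -expr2.
have : y ^+ 2 / 2 <= expR y by apply: le_trans h; rewrite lerDr.
by rewrite ler_pdivrMr// mulrC.
Qed.

Lemma laplace_id (x : R) : 0 < x ->
  (\int[mu]_(s in `[0%R, +oo[) (s * expR (- (x * s)))%:E = (x ^- 2)%:E)%E.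
Proof.
move=> x0; have xn0 := lt0r_neq0 x0.
pose F s := (- x^-1 * s - x ^- 2) * expR (- (x * s)).
have dF s : is_derive s (1 : R) F (s * expR (- (x * s))).
  apply: der_eq (der_mul (der_add (der_lin _ _) (der_cst _ _)) (der_expN _ _)) _.
  by field.
have Fy : F s @[s --> +oo] --> 0.
  apply: (@cvgy0 _ _ (3 * x ^- 3)) => s s0.
  have xs0 : 0 < x * s by rewrite mulr_gt0.
  have -> : F s = - (x ^- 2 * (x * s * expR (- (x * s)) + expR (- (x * s)))).
    by rewrite /F; field.
  have x2 : 0 <= x ^- 2 by rewrite invr_ge0 exprn_ge0// ltW.
  rewrite normrN ger0_norm; last first.
    by rewrite mulr_ge0// addr_ge0// ?mulr_ge0 ?expR_ge0// ltW.
  rewrite (_ : 3 * _ / _ = x ^- 2 * (2 / (x * s) + (x * s)^-1)); last first.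
    by field; rewrite xn0 lt0r_neq0.
  rewrite ler_wpM2l//; apply: lerD; first exact: mul_expRN_le.
  exact: expRN_le.
rewrite (@integral0y_FTC _ (fun s => s * expR (- (x * s))) F 0)//.
- by rewrite /F !mulr0 oppr0 expR0 mulr1 !sub0r opprK.
- by move=> s s0; rewrite mulr_ge0// expR_ge0.
- by apply: der_continuous => s; exact: der_mul (is_derive_id _ _) (der_expN _ _).
Qed.

(** The factor [1 - cos] in place of [cos] keeps the integrand nonnegative, as both [integral0y_FTC]
    and the later use of Tonelli require. *)
Lemma laplace_cos (m s : R) : 0 < s ->
  (\int[mu]_(x in `[0%R, +oo[) ((1 - cos (m * x)) * (s * expR (- (s * x))))%:E
    = (m ^+ 2 / (s ^+ 2 + m ^+ 2))%:E)%E.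
Proof.
move=> s0; have sm0 : 0 < s ^+ 2 + m ^+ 2.
  by rewrite ltr_pwDl ?exprn_gt0// sqr_ge0.
have smn0 := lt0r_neq0 sm0.
pose c := (s ^+ 2 + m ^+ 2)^-1.
have c0 : 0 < c by rewrite invr_gt0.
pose F x := expR (- (s * x)) *
  (c * (s ^+ 2 * cos (m * x) + - (s * m) * sin (m * x)) - 1).
have dF x : is_derive x (1 : R) F ((1 - cos (m * x)) * (s * expR (- (s * x)))).
  apply: der_eq (der_mul (der_expN _ _) (der_add (der_scale _ (der_add
    (der_scale _ (der_cosM _ _)) (der_scale _ (der_sinM _ _)))) (der_cst _ _))) _.
  by rewrite /c; field.
have Fy : F x @[x --> +oo] --> 0.
  apply: (@cvgy0 _ _ ((c * (s ^+ 2 + `|s * m|) + 1) / s)) => x x0.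
  have sx0 : 0 < s * x by rewrite mulr_gt0.
  rewrite /F normrM ger0_norm ?expR_ge0// -[leRHS]mulrA -invfM [leLHS]mulrC.
  apply: ler_pM; rewrite ?expR_ge0//; last exact: expRN_le.
  apply: le_trans (ler_normB _ _) _; rewrite normr1 lerD2r normrM.
  rewrite [`|c|]ger0_norm ?(ltW c0)// ler_wpM2l ?(ltW c0)//.
  apply: le_trans (ler_normD _ _) _; apply: lerD; rewrite normrM.
    rewrite [`|s ^+ 2|]ger0_norm ?sqr_ge0// ler_piMr ?sqr_ge0//.
    by rewrite ler_norml cos_geN1 cos_le1.
  by rewrite normrN ler_piMr// ler_norml sin_geN1 sin_le1.
rewrite (@integral0y_FTC _ (fun x => (1 - cos (m * x)) * (s * expR (- (s * x)))) F 0)//.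
- rewrite /F !mulr0 oppr0 expR0 cos0 sin0 mulr0 mulr1 addr0 mul1r sub0r opprB.
  by congr EFin; rewrite /c; field.
- move=> x _; rewrite mulr_ge0 ?subr_ge0 ?cos_le1// mulr_ge0 ?expR_ge0//; exact: ltW.
- by apply: der_continuous => x.
Qed.

Lemma integral_lorentz (m : R) : 0 < m ->
  (\int[mu]_(s in `[0%R, +oo[) (m ^+ 2 / (s ^+ 2 + m ^+ 2))%:E = (m * (pi / 2))%:E)%E.
Proof.
move=> m0; have mn0 := lt0r_neq0 m0.
pose F s := m * atan (m^-1 * s).
have dF s : is_derive s (1 : R) F (m ^+ 2 / (s ^+ 2 + m ^+ 2)).
  apply: der_eq (der_scale _ (der_comp (is_derive1_atan _) (der_lin _ _))) _.
  have h : 0 < s ^+ 2 + m ^+ 2 by rewrite ltr_wpDl ?exprn_gt0// sqr_ge0.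
  by field; rewrite mn0 lt0r_neq0//= addrC lt0r_neq0.
have Fy : F s @[s --> +oo] --> m * (pi / 2).
  have H : m^-1 * x @[x --> +oo] --> +oo.
    apply/cvgryPge => A; near=> x.
    rewrite mulrC ler_pdivlMr//.
  have H2 := cvg_comp (fun x => m^-1 * x) (@atan R) H (@cvgy_atan R).
  exact: (cvgM (cvg_cst m) H2).
rewrite (@integral0y_FTC _ (fun s => m ^+ 2 / (s ^+ 2 + m ^+ 2)) F _ _ _ _ Fy)//.
- by rewrite /F mulr0 atan0 mulr0 subr0.
- by move=> s _; rewrite divr_ge0 ?addr_ge0 ?sqr_ge0.
- move=> s; apply: cvgM; first exact: cvg_cst.
  have h : 0 < s ^+ 2 + m ^+ 2 by rewrite ltr_wpDl ?exprn_gt0// sqr_ge0.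
  apply: cvgV; first by rewrite lt0r_neq0.
  by apply: cvgD; [exact: exprn_continuous|exact: cvg_cst].
Unshelve. all: by end_near. Qed.

End laplace.

Section sine_integral.
Context {R : realType}.
Local Notation mu := (@lebesgue_measure R).
Local Notation GR := (measurableTypeR R).

Lemma integral_indic_mul (D : set GR) (g : R -> R) :
  (\int[mu]_s (\1_D s * g s)%:E = \int[mu]_(s in D) (g s)%:E)%E.
Proof.
rewrite [RHS]integral_mkcond; apply: eq_integral => s _; rewrite patchE indicE.
by case: ifPn => _; rewrite ?mul1r ?mul0r.
Qed.

Lemma integral_oy_cy (g : R -> R) : continuous g ->
  (\int[mu]_(s in `]0%R, +oo[) (g s)%:E = \int[mu]_(s in `[0%R, +oo[) (g s)%:E)%E.
Proof.
move=> cg; apply: integral_itv_obnd_cbnd; apply/measurable_EFinP.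
by apply: measurable_funTS; exact: continuous_measurable_fun.
Qed.

(* Tonelli, from [1 / x ^ 2 = \int_0^oo s * exp (- x s) ds]. *)
Lemma integral_one_sub_cos (m : R) : 0 < m ->
  (\int[mu]_(x in `[0%R, +oo[) ((1 - cos (m * x)) / x ^+ 2)%:E = (m * (pi / 2))%:E)%E.
Proof.
move=> m0.
(* The value [s = 0] is excluded since [laplace_cos] needs [s > 0]; at [x = 0] both sides vanish
   because the quotient there is 0 by convention. *)
pose D1 : set GR := [set` `[0 : R, +oo[]; pose D2 : set GR := [set` `]0 : R, +oo[].
pose k (x s : R) := (1 - cos (m * x)) * (s * expR (- (x * s))).
pose K (p : GR * GR) := (\1_D1 p.1 * (\1_D2 p.2 * k p.1 p.2))%:E.
have mD1 : measurable D1 by exact: measurable_itv.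
have mD2 : measurable D2 by exact: measurable_itv.
have mK : measurable_fun setT K.
  apply/measurable_EFinP; apply: measurable_funM.
    by apply: measurableT_comp; [exact: measurable_indic|exact: measurable_fst].
  apply: measurable_funM.
    by apply: measurableT_comp; [exact: measurable_indic|exact: measurable_snd].
  have mcos : measurable_fun setT (fun x : GR => 1 - cos (m * x)).
    apply: continuous_measurable_fun => x; apply: cvgB; first exact: cvg_cst.
    exact: continuous_cosM.
  apply: measurable_funM.
    by apply: (measurableT_comp mcos); exact: measurable_fst.
  apply: measurable_funM; first exact: measurable_snd.
  apply: measurableT_comp; first exact: measurable_expR.
  by apply: measurableT_comp => //; apply: measurable_funM; [exact: measurable_fst|exact: measurable_snd].
have K0 p : (0 <= K p)%E.
  rewrite lee_fin /K; rewrite !indicE; case: (boolP (p.1 \in D1)) => [/set_mem|_]; last by rewrite mul0r.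
  case: (boolP (p.2 \in D2)) => [/set_mem|_ _]; last by rewrite mul0r mulr0.
  rewrite /D1 /D2 /= !in_itv/= !andbT => p2 p1.
  rewrite !mul1r mulr_ge0 ?subr_ge0 ?cos_le1// mulr_ge0 ?expR_ge0//; exact: ltW.
have ck1 (x : R) : continuous (fun s : R => s * expR (- (x * s))).
  by apply: der_continuous => s; exact: der_mul (is_derive_id _ _) (der_expN _ _).
have : (\int[mu]_x \int[mu]_s K (x, s) = \int[mu]_s \int[mu]_x K (x, s))%E.
  exact: (fubini_tonelli K mK K0).
have -> : (\int[mu]_x \int[mu]_s K (x, s) =
    \int[mu]_(x in `[0%R, +oo[) ((1 - cos (m * x)) / x ^+ 2)%:E)%E.
  rewrite -[RHS]integral_indic_mul; apply: eq_integral => x _; rewrite /K /=.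
  rewrite indicE; case: (boolP (x \in D1)) => [/set_mem|_]; last first.
    under eq_integral do rewrite mul0r.
    by rewrite integral0 mul0r.
  rewrite /D1 /= in_itv/= andbT => x0.
  under eq_integral do rewrite mul1r.
  rewrite integral_indic_mul /k mul1r.
  have [->|xn0] := eqVneq x 0.
    rewrite mulr0 cos0 subrr mul0r.
    by under eq_integral do rewrite mul0r; rewrite integral0.
  have {}x0 : 0 < x by rewrite lt_neqAle eq_sym xn0.
  under eq_integral do rewrite EFinM.
  rewrite ge0_integralZl_EFin//.
  - by rewrite integral_oy_cy// laplace_id.
  - by move=> s; rewrite /D2 /= in_itv/= andbT => s0; rewrite lee_fin mulr_ge0 ?expR_ge0// ltW.
  - by apply/measurable_EFinP; apply: measurable_funTS; exact: continuous_measurable_fun.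
move=> ->.
transitivity (\int[mu]_(s in `]0%R, +oo[) (m ^+ 2 / (s ^+ 2 + m ^+ 2))%:E)%E.
  rewrite -[RHS]integral_indic_mul; apply: eq_integral => s _; rewrite /K /=.
  rewrite [in RHS]indicE; case: (boolP (s \in D2)) => [sD|sD]; last first.
    rewrite mul0r indicE (negbTE sD).
    under eq_integral do rewrite mul0r mulr0.
    by rewrite integral0.
  rewrite indicE sD mul1r; move/set_mem : sD; rewrite /D2 /= in_itv/= andbT => s0.
  under eq_integral do rewrite mul1r.
  rewrite integral_indic_mul -(laplace_cos m s0).
  by apply: eq_integral => x _; rewrite /k mulrC [x * s]mulrC [in RHS]mulrC.
rewrite integral_oy_cy ?integral_lorentz//.
move=> s; apply: cvgM; first exact: cvg_cst.
have h : 0 < s ^+ 2 + m ^+ 2 by rewrite ltr_wpDl ?exprn_gt0// sqr_ge0.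
apply: cvgV; first by rewrite lt0r_neq0.
by apply: cvgD; [exact: exprn_continuous|exact: cvg_cst].
Qed.

End sine_integral.

Lemma cvg_eq (I : Type) (F : set_system I) (U : topologicalType) (f g : I -> U) (l m : U) :
  f @ F --> l -> f =1 g -> l = m -> g @ F --> m.
Proof. by move=> fl /funext <- <-. Qed.

(** * Increments of Levy processes *)

Section levy.
Context {R : realType} {d : measure_display} {T : measurableType d}.
Variables (P : probability T R) (X : R -> T -> R).
Hypothesis LX : levy_process P X.

Lemma levy_measurable_increment s t : 0 <= s -> 0 <= t ->
  measurable_fun setT (fun w => X t w - X s w).
Proof. by move=> s0 t0; apply: measurable_funB; exact: (levy_measurable LX). Qed.

Lemma levy_Ex_increment s t (phi : R -> R) : 0 <= s -> s <= t -> bm phi ->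
  Ex P (fun w => phi (X t w - X s w)) = Ex P (fun w => phi (X (t - s) w)).
Proof.
move=> s0 st bphi; have t0 := le_trans s0 st.
have ts0 : 0 <= t - s by rewrite subr_ge0.
have mD := levy_measurable_increment s0 t0.
have mX := levy_measurable LX ts0.
have E1 (Y : T -> R) psi : (fun x => 1 * psi (Y x)) = (fun x => psi (Y x)) :> (T -> R).
  by apply/funext => x; rewrite mul1r.
rewrite -(E1 (fun w => X t w - X s w) phi) -(E1 (X (t - s)) phi).
refine (@Ex_transfer R _ T P _ T P _ R (fun w => X t w - X s w) (X (t - s))
  (fun=> 1) (fun=> 1) mD mX (bm_cst 1) (bm_cst 1) _ phi bphi) => A mA.
rewrite !(E1 _ (\1_A : R -> R)) !Ex_preimage//.
have := levy_stationary LX s0 ts0 mA; rewrite subrKC.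
by move=> h; congr fine; exact: h.
Qed.

Lemma levy_Ex_prod n (t : nat -> R) : 0 <= t 0%N -> nondecreasing_seq t ->
  forall phi : nat -> R -> R, (forall i, bm (phi i)) ->
  Ex P (fun w => \prod_(i < n) phi i (X (t i.+1) w - X (t i) w)) =
  \prod_(i < n) Ex P (fun w => phi i (X (t i.+1 - t i) w)).
Proof.
move=> t0 tn phi bphi.
have ti i : 0 <= t i by apply: le_trans t0 (tn _ _ (leq0n i)).
pose D i w := X (t i.+1) w - X (t i) w.
have mD i : measurable_fun setT (D i) by exact: levy_measurable_increment.
have := @Ex_prod _ _ _ P D (fun=> 1) 1 n mD (bm_cst 1) _ phi bphi.
under eq_fun do rewrite mul1r; rewrite mul1r => ->.
  by apply: eq_bigr => i _; rewrite levy_Ex_increment// tn.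
move=> A mA; have := @indep_indic _ _ _ P D setT n A measurableT mD mA.
rewrite (congr1 fine (probability_setT P)) setTI => <-.
  by congr Ex; apply/funext => w; rewrite indicE in_setT.
rewrite (levy_indep_increments LX t0 tn (iota_uniq 0 n) mA).
by rewrite (probability_setT P) mul1e.
Qed.

Lemma levy_Ex_cos n (t : nat -> R) (c : nat -> R) th :
  0 <= t 0%N -> nondecreasing_seq t ->
  (forall i, (i < n)%N -> Ex P (fun w => sin (c i * X (t i.+1 - t i) w)) = 0) ->
  Ex P (fun w => cos (th + \sum_(i < n) c i * (X (t i.+1) w - X (t i) w))) =
  cos th * \prod_(i < n) Ex P (fun w => cos (c i * X (t i.+1 - t i) w)).
Proof.
move=> t0 tn Hs.
have ti i : 0 <= t i by apply: le_trans t0 (tn _ _ (leq0n i)).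
pose D i w := X (t i.+1) w - X (t i) w.
have mD i : measurable_fun setT (D i) by exact: levy_measurable_increment.
have := @Ex_cos_sum _ _ _ P D (fun=> 1) 1 n c
  (fun i => Ex P (fun w => cos (c i * X (t i.+1 - t i) w))) mD (bm_cst 1) _ _ th.
under eq_fun do rewrite mul1r; rewrite mul1r => -> //.
  move=> phi bphi; under eq_fun do rewrite mul1r; rewrite mul1r.
  rewrite [LHS](levy_Ex_prod n t0 tn bphi).
  by apply: eq_bigr => i _; rewrite levy_Ex_increment// tn.
move=> i ni; rewrite (levy_Ex_increment (ti i) (tn _ _ (leqnSn i)) (bm_cosM (c i))).
by rewrite (levy_Ex_increment (ti i) (tn _ _ (leqnSn i)) (bm_sinM (c i))) Hs.
Qed.

End levy.

Section exponential_limit.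
Context {R : realType}.

(* By [1 - y <= exp (- y) <= 1 / (1 + y)] with [y = 1 - x n.+1]. *)
Lemma power_limit (phi c : R) (x : nat -> R) :
  (forall n, 0 <= x n.+1) -> (forall n, phi = x n.+1 ^+ n.+1) ->
  n.+1%:R * (1 - x n.+1) @[n --> \oo] --> c -> phi = expR (- c).
Proof.
move=> x0 xphi xc; pose u n := 1 - x n.+1.
have uE n : u n = (n.+1%:R * u n) * n.+1%:R^-1 by rewrite mulrAC divff ?mul1r// pnatr_eq0.
have u0 : u n @[n --> \oo] --> (0 : R).
  by apply: (cvg_eq (cvgM xc (@cvg_harmonic R))); [move=> n; rewrite [RHS]uE|rewrite mulr0].
have cE (y : nat -> R) : y n @[n --> \oo] --> c -> expR (- y n) @[n --> \oo] --> expR (- c).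
  by move=> yc; apply: (cvg_comp _ _ (cvgN yc)); exact: continuous_expR.
have powE n (y : R) : expR (- (n.+1%:R * y)) = expR (- y) ^+ n.+1.
  by rewrite -mulrN expRM_natl.
apply/eqP; rewrite eq_le; apply/andP; split.
  apply: (cvgr_to_ge (cE _ xc)); near=> n.
  rewrite (xphi n) powE lerXn2r ?nnegrE ?expR_ge0//.
  by have := expR_ge1Dx (- u n); rewrite /u opprB addrCA subrr addr0.
have xc' : n.+1%:R * (u n / (1 - u n)) @[n --> \oo] --> c.
  have v0 : (1 - u n)^-1 @[n --> \oo] --> (1 - 0 : R)^-1.
    apply: cvgV; first by rewrite subr0 oner_neq0.
    by apply: cvgB => //; exact: cvg_cst.
  apply: (cvg_eq (cvgM xc v0)); last by rewrite subr0 invr1 mulr1.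
  by move=> n; rewrite /= mulrA.
apply: (cvgr_to_le (cE _ xc')); near=> n.
have un : u n < 1 by near: n; apply: cvgr_lt u0 _ _; exact: ltr01.
have x1 : 0 < x n.+1 by move: un; rewrite /u ltrBlDr ltrDl.
rewrite (xphi n) powE lerXn2r ?nnegrE ?expR_ge0// expRN /u opprB addrCA subrr addr0.
rewrite invf_ple ?posrE ?expR_gt0//.
apply: le_trans (expR_ge1Dx _); rewrite -[X in X + _](divff (lt0r_neq0 x1)) -mulrDl.
by rewrite addrCA subrr addr0 mul1r.
Unshelve. all: by end_near. Qed.

End exponential_limit.

Section cauchy.
Context {R : realType} {d : measure_display} {T : measurableType d}.
Variables (P : probability T R) (C : R -> T -> R).
Hypothesis HC : cauchy_process P C.
Local Notation mu := (@lebesgue_measure R).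
Local Notation GR := (measurableTypeR R).

Let q (s x : R) := s / (pi * (s ^+ 2 + x ^+ 2)).

Let den_gt0 (s x : R) : 0 < s -> 0 < pi * (s ^+ 2 + x ^+ 2).
Proof. by move=> s0; rewrite mulr_gt0 ?pi_gt0// ltr_wpDr ?sqr_ge0// exprn_gt0. Qed.

Let q_ge0 (s x : R) : 0 < s -> 0 <= q s x.
Proof. by move=> s0; rewrite divr_ge0 ?(ltW s0)// ltW// den_gt0. Qed.

Let continuous_q s : 0 < s -> continuous (q s).
Proof.
move=> s0 x; apply: cvgM; first exact: cvg_cst.
apply: cvgV; first by rewrite lt0r_neq0// den_gt0.
apply: cvgM; first exact: cvg_cst.
apply: cvgD; first exact: cvg_cst.
exact: exprn_continuous.
Qed.

Let measurable_q s : 0 < s -> measurable_fun (setT : set GR) (q s : GR -> R).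
Proof. by move=> s0; apply: continuous_measurable_fun; exact: continuous_q. Qed.

(** Oddness is applied on the truncations to [[- n, n]], and dominated convergence removes the
    truncation. *)
Lemma cauchy_Ex_sin c s : 0 < s -> Ex P (fun w => sin (c * C s w)) = 0.
Proof.
move=> s0; have mC : measurable_fun setT (C s) by exact: (levy_measurable HC.1 (ltW s0)).
have mI n : measurable (`[- n%:R, n%:R]%classic : set R) by exact: measurable_itv.
pose phi (n : nat) (x : R) : R := \1_(`[- n%:R, n%:R] : set R) x * sin (c * x).
have bphi n : bm (phi n) by apply: bmM; [exact: bm_indic|exact: bm_sinM].
have E0 n : Ex P (fun w => phi n (C s w)) = 0.
  rewrite (Ex_density measurableT (HC.2 _ s0) (measurable_q s0)) => //; last first.
    by move=> x _; exact: q_ge0.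
  rewrite (_ : \int[mu]_(x in setT) _ = \int[mu]_(x in `[- n%:R, n%:R]) (sin (c * x) * q s x)).
    apply: Rintegral_odd => //.
      by move=> x; apply: cvgM; [exact: continuous_sinM|exact: continuous_q].
    by move=> x; rewrite mulrN sinN mulNr /q sqrrN.
  rewrite /Rintegral -(integral_indic_mul (`[- n%:R, n%:R]%classic : set GR)); congr fine; apply: eq_integral => x _.
  by congr EFin; rewrite /phi /= -mulrA.
have bS : bm (fun w => sin (c * C s w)) by exact: (bm_comp (bm_sinM c) mC).
have h1 n x : `|phi n (C s x)| <= 1.
  rewrite /phi indicE; case: (_ \in _); rewrite ?mul0r ?normr0// mul1r.
  by rewrite ler_norml sin_geN1 sin_le1.
have h2 : Ex P (fun w => phi n (C s w)) @[n --> \oo] --> Ex P (fun w => sin (c * C s w)).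
  apply: (@Ex_cvg _ _ _ P (fun n w => phi n (C s w)) _ 1 (fun n => bm_comp (bphi n) mC) bS h1).
  apply/aeW => w; apply: cvg_near_cst; near=> n.
  rewrite /phi indicE mem_set ?mul1r//= in_itv/= -ler_norml.
  by near: n; exact: nbhs_infty_ger.
rewrite -(cvg_lim _ h2)//; apply/cvg_lim => //.
by apply: (cvg_eq (@cvg_cst _ (0 : R) _ \oo _)) => // n; rewrite E0.
Unshelve. all: by end_near. Qed.

Let cauchy_one_sub_cos m s : 0 < s ->
  ((1 - Ex P (fun w => cos (m * C s w)))%:E =
   2%:E * \int[mu]_(x in `[0%R, +oo[) ((1 - cos (m * x)) * q s x)%:E)%E.
Proof.
move=> s0; have mC : measurable_fun setT (C s) by exact: (levy_measurable HC.1 (ltW s0)).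
have b1 : bm (fun x : R => 1 - cos (m * x)) by apply: bmB; [exact: bm_cst|exact: bm_cosM].
have q0 x : setT x -> 0 <= q s x by move=> _; exact: q_ge0.
have -> : 1 - Ex P (fun w => cos (m * C s w)) = Ex P (fun w => 1 - cos (m * C s w)).
  by rewrite ExB ?Ex_cst//; [exact: bm_cst|exact: (bm_comp (bm_cosM m) mC)].
rewrite (Ex_density measurableT (HC.2 _ s0) (measurable_q s0) q0 b1).
rewrite /Rintegral fineK; last first.
  apply: integrable_fin_num => //.
  exact: (density_integrableM measurableT (HC.2 _ s0) (measurable_q s0) q0 b1).
rewrite ge0_symfun_integralT.
- by rewrite set_itvcy.
- by move=> x; rewrite mulr_ge0 ?q_ge0// subr_ge0 cos_le1.
- move=> x; apply: cvgM; last exact: continuous_q.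
  by apply: cvgB; [exact: cvg_cst|exact: continuous_cosM].
- by move=> x /=; rewrite mulrN cosN /q sqrrN.
Qed.

(** The rescaled densities increase to the Levy density [t / (pi x^2)], so monotone convergence
    reduces the limit to [integral_one_sub_cos]. *)
Let cauchy_cos_limit m t : 0 < m -> 0 < t ->
  n.+1%:R * (1 - Ex P (fun w => cos (m * C (t / n.+1%:R) w))) @[n --> \oo] --> m * t.
Proof.
move=> m0 t0; pose g (n : nat) (x : R) := n.+1%:R * ((1 - cos (m * x)) * q (t / n.+1%:R) x).
have tn (n : nat) : 0 < t / n.+1%:R by rewrite divr_gt0.
have gE n x : g n x = (1 - cos (m * x)) * (t / (pi * ((t / n.+1%:R) ^+ 2 + x ^+ 2))).
  rewrite /g /q mulrCA; congr (_ * _); rewrite !mulrA; congr (_ / _).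
  by rewrite mulrAC divff ?mul1r// pnatr_eq0.
have cg n : continuous (g n).
  move=> x; apply: cvgM; first exact: cvg_cst.
  apply: cvgM; last exact: continuous_q.
  by apply: cvgB; [exact: cvg_cst|exact: continuous_cosM].
have g0 n x : 0 <= g n x.
  by rewrite mulr_ge0// mulr_ge0 ?q_ge0// subr_ge0 cos_le1.
have E n : (n.+1%:R * (1 - Ex P (fun w => cos (m * C (t / n.+1%:R) w))))%:E =
    (2%:E * \int[mu]_(x in `[0%R, +oo[) (g n x)%:E)%E.
  rewrite EFinM (cauchy_one_sub_cos m (tn n)) muleCA; congr (_ * _)%E.
  rewrite -ge0_integralZl_EFin//.
  - by move=> x _; rewrite lee_fin mulr_ge0 ?q_ge0// subr_ge0 cos_le1.
  - apply/measurable_EFinP; apply: measurable_funTS; apply: continuous_measurable_fun.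
    move=> x; apply: cvgM; last exact: continuous_q.
    by apply: cvgB; [exact: cvg_cst|exact: continuous_cosM].
pose D : set GR := [set` `[0 : R, +oo[].
pose gy (x : R) := t / pi * ((1 - cos (m * x)) / x ^+ 2).
have sg n k x : (n <= k)%N -> g n x <= g k x.
  move=> nk; rewrite !gE ler_wpM2l ?subr_ge0 ?cos_le1// ler_wpM2l ?(ltW t0)//.
  have dn j : 0 < pi * ((t / j.+1%:R) ^+ 2 + x ^+ 2) by exact: den_gt0 (tn j).
  rewrite lef_pV2 ?posrE// ler_pM2l ?pi_gt0// lerD2r.
  rewrite lerXn2r ?nnegrE ?(ltW (tn _))// ler_pM2l// lef_pV2 ?posrE//.
  by rewrite ler_nat.
have cgy x : g n x @[n --> \oo] --> gy x.
  have [->|x0] := eqVneq x 0.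
    apply: (cvg_eq (@cvg_cst _ (0 : R) _ \oo _)) => [n|]; rewrite ?gE /gy;
      by rewrite mulr0 cos0 subrr !(mul0r, mulr0).
  have h1 : t / n.+1%:R @[n --> \oo] --> (0 : R).
    by apply: (cvg_eq (cvgM (@cvg_cst _ t _ \oo _) (@cvg_harmonic R))); rewrite ?mulr0.
  have h2 : (pi * ((t / n.+1%:R) * (t / n.+1%:R) + x ^+ 2))^-1 @[n --> \oo] -->
      (pi * (0 * 0 + x ^+ 2))^-1.
    apply: cvgV; first by rewrite mulr0 add0r mulf_neq0 ?sqrf_eq0// lt0r_neq0 ?pi_gt0.
    apply: cvgM; first exact: cvg_cst.
    by apply: cvgD; [exact: cvgM|exact: cvg_cst].
  apply: (cvg_eq (cvgM (@cvg_cst _ ((1 - cos (m * x)) * t) _ \oo _) h2)) => [n|].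
    by rewrite gE mulrA.
  by rewrite /gy mulr0 add0r invfM; ring.
have mg n : measurable_fun D (EFin \o g n : GR -> \bar R).
  apply/measurable_EFinP; apply: measurable_funTS.
  by apply: continuous_measurable_fun; exact: cg.
have mD : measurable D by exact: measurable_itv.
have h3 : (\int[mu]_(x in D) (g n x)%:E @[n --> \oo] --> (m * t / 2)%:E)%E.
  have := @cvg_monotone_convergence _ _ _ mu D mD (fun n => EFin \o g n) mg _ _.
  have g0' n x : D x -> (0 <= (g n x)%:E)%E by move=> _; rewrite lee_fin.
  have sg' x : D x -> {homo (fun n => (g n x)%:E) : n k / (n <= k)%N >-> (n <= k)%E}.
    by move=> _ n k nk; rewrite lee_fin; exact: sg.
  move=> /(_ g0' sg') h; apply: (cvg_eq h) => //.
  transitivity (\int[mu]_(x in D) (gy x)%:E)%E.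
    apply: eq_integral => x _; apply/cvg_lim => //.
    by apply: cvg_EFin; [near=> n|exact: cgy].
  under eq_integral do rewrite EFinM.
  rewrite ge0_integralZl_EFin//.
  - rewrite integral_one_sub_cos// -EFinM; congr EFin.
    have p0 : (pi : R) != 0 by rewrite lt0r_neq0// pi_gt0.
    by rewrite !mulrA [t / pi * m]mulrAC divfK// [t * m]mulrC.
  - by move=> x _; rewrite lee_fin divr_ge0 ?sqr_ge0// subr_ge0 cos_le1.
  - apply/measurable_EFinP.
    (* With its value 0 at the origin the limit is discontinuous there, so its measurability is
       taken from the continuous approximations. *)
    apply: (measurable_fun_cvg (h := fun n (x : GR) => pi / t * g n x)) => [n|x _].
      apply: measurable_funM => //; apply: measurable_funTS.
      by apply: continuous_measurable_fun; exact: cg.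
    apply: (cvg_eq (cvgM (@cvg_cst _ (pi / t) _ \oo _) (cgy x))) => //.
    have p0 : (pi : R) != 0 by rewrite lt0r_neq0// pi_gt0.
    by rewrite /gy !mulrA divfK ?(lt0r_neq0 t0)// divff// mul1r.
  - by rewrite divr_ge0 ?(ltW t0) ?pi_ge0.
have h4 : fine (2%:E * \int[mu]_(x in D) (g n x)%:E)%E @[n --> \oo] --> 2 * (m * t / 2).
  exact: (fine_cvg (cvgeZl (isT : (2%:E : \bar R) \is a fin_num) h3)).
by apply: (cvg_eq h4) => [n|]; [rewrite /= -E|rewrite mulrC divfK].
Unshelve. all: by end_near. Qed.

Let cauchy_cos_pow m t n : 0 < t -> (0 < n)%N ->
  Ex P (fun w => cos (m * C t w)) = Ex P (fun w => cos (m * C (t / n%:R) w)) ^+ n.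
Proof.
move=> t0 n0; pose s i : R := i%:R * (t / n%:R).
have tn0 : 0 < t / n%:R by rewrite divr_gt0// ltr0n.
have s0 : 0 <= s 0%N by rewrite /s mul0r.
have sn : nondecreasing_seq s.
  by move=> i j ij; rewrite /s ler_wpM2r ?(ltW tn0)// ler_nat.
have sS i : s i.+1 - s i = t / n%:R by rewrite /s -mulrBl -natrB// subSnn mul1r.
have mC u : 0 <= u -> measurable_fun setT (C u) by exact: (levy_measurable HC.1).
have E := @levy_Ex_cos _ _ _ P C HC.1 n s (fun=> m) 0 s0 sn
  (fun i _ => etrans (congr1 (fun u => Ex P (fun w => sin (m * C u w))) (sS i))
     (cauchy_Ex_sin m tn0)).
rewrite cos0 mul1r in E.
rewrite (eq_bigr (fun=> Ex P (fun w => cos (m * C (t / n%:R) w)))) in E;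
  last by move=> i _; rewrite sS.
rewrite prodr_const card_ord in E; rewrite -E.
have si i : 0 <= s i by rewrite (le_trans s0)// sn.
apply: Ex_ae.
- exact: (bm_comp (bm_cosM m) (mC _ (ltW t0))).
- apply: (bm_comp (f := cos) (X := fun w => 0 + \sum_(i < n) m * (C (s i.+1) w - C (s i) w))).
    exact: bm_cosine.
  apply: measurable_funD => //; apply: measurable_sum => i; apply: measurable_funM => //.
  by apply: measurable_funB; exact: mC.
- apply: ae_imp (levy_start HC.1) => w C0.
  rewrite add0r -mulr_sumr; congr (cos (m * _)).
  rewrite -(big_mkord xpredT (fun i => C (s i.+1) w - C (s i) w)) telescope_sumr//.
  by rewrite /s mul0r C0 subr0 mulrC divfK// pnatr_eq0 -lt0n.
Qed.

(** Infinite divisibility in place of a contour integral: the value at [t] is the [n]-th power of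
    the value at [t / n], whose distance to 1 is asymptotic to [|c| t / n]. *)
Lemma cauchy_Ex_cos c t : 0 < t -> Ex P (fun w => cos (c * C t w)) = expR (- (`|c| * t)).
Proof.
move=> t0; have [->|c0] := eqVneq c 0.
  rewrite normr0 mul0r oppr0 expR0 -[RHS](Ex_cst P); congr Ex.
  by apply/funext => w; rewrite mul0r cos0.
have -> : (fun w => cos (c * C t w)) = (fun w => cos (`|c| * C t w)).
  by apply/funext => w; have [h|h] := leP 0 c;
    rewrite ?(ger0_norm h) ?(ltr0_norm h) ?mulNr ?cosN.
apply: (power_limit (x := fun n => Ex P (fun w => cos (`|c| * C (t / n%:R) w)))).
(* Nonnegative as the square of the value at half the time. *)
- move=> n; rewrite (cauchy_cos_pow `|c| (n := 2))//; first exact: sqr_ge0.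
  by rewrite divr_gt0.
- by move=> n; exact: cauchy_cos_pow.
- by apply: cauchy_cos_limit; rewrite ?normr_gt0.
Qed.

End cauchy.

(** * Increments of the compound Poisson process *)

Lemma sigma_algebra_bigcap_seq (U : Type) (G : set (set U)) (I : eqType) (s : seq I)
    (A : I -> set U) : sigma_algebra setT G ->
  (forall i, G (A i)) -> G (\bigcap_(i in [set` s]) A i).
Proof.
move=> /sigma_algebraP[//|GT _ _ GI] GA; elim: s => [|i s IH].
  by rewrite set_nil bigcap_set0.
rewrite (_ : [set` i :: s] = i |` [set` s]) ?bigcap_setU1; first exact: GI.
by apply/seteqP; split => j /=; rewrite inE => /predU1P.
Qed.

(** * Conditioning on an integer-valued variable *)

Section freezing.
Context {R : realType} {d : measure_display} {T : measurableType d}.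
Variables (P : probability T R) (W : T -> nat) (G : nat -> T -> R) (e : nat -> R) (M : R).
Hypotheses (mW : forall k, measurable (W @^-1` [set k]))
  (bG : forall k, bm (G k)) (GM : forall k x, `|G k x| <= M) (eM : forall k, `|e k| <= M).

Let approx (H : nat -> T -> R) K x := \sum_(k < K) \1_(W @^-1` [set (k : nat)]) x * H k x.

Let approxE H K x : approx H K x = if (W x < K)%N then H (W x) x else 0.
Proof.
rewrite /approx; case: ifPn => [WK|]; last first.
  rewrite -leqNgt => KW; rewrite big1// => k _; rewrite indicE memNset ?mul0r//= => Wk.
  by move: KW; rewrite Wk leqNgt ltn_ord.
rewrite (bigD1 (Ordinal WK))//= indicE mem_set// mul1r big1 ?addr0// => k kW.
rewrite indicE memNset ?mul0r//= => Wk.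
by move: kW; rewrite -val_eqE/= Wk eqxx.
Qed.

Let bm_approx H K : (forall k, bm (H k)) -> bm (approx H K).
Proof. by move=> bH; apply: bm_sum => k; apply: bmM => //; exact: bm_indic. Qed.

Let approx_cvg H x : approx H ^~ x @ \oo --> H (W x) x.
Proof.
apply: cvg_near_cst; near=> K; rewrite approxE ifT//.
by near: K; exists (W x).+1.
Unshelve. all: by end_near. Qed.

Lemma measurable_freeze (H : nat -> T -> R) : (forall k, measurable_fun setT (H k)) ->
  measurable_fun setT (fun x => H (W x) x).
Proof.
move=> mH; apply: (measurable_fun_cvg (h := approx H)) => [K|x _].
  apply: measurable_sum => k; apply: measurable_funM => //; exact: (bm_indic (mW k)).1.
exact: approx_cvg.
Qed.

Lemma bm_freeze (H : nat -> T -> R) : (forall k, bm (H k)) -> (forall k x, `|H k x| <= M) ->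
  bm (fun x => H (W x) x).
Proof.
by move=> bH HM; split; [apply: measurable_freeze => k; exact: (bH k).1|exists M].
Qed.

Let Ex_approx_cvg (H : nat -> T -> R) : (forall k, bm (H k)) -> (forall k x, `|H k x| <= M) ->
  Ex P (approx H K) @[K --> \oo] --> Ex P (fun x => H (W x) x).
Proof.
move=> bH HM; apply: (@Ex_cvg _ _ _ P _ _ M).
- by move=> K; exact: bm_approx.
- exact: bm_freeze.
- move=> K x; rewrite approxE; case: ifP => // _; rewrite normr0.
  exact: le_trans (normr_ge0 _) (HM 0%N x).
- by apply/aeW => x; exact: approx_cvg.
Qed.

Let Ex_indicM k :
  Ex P (fun x => \1_(W @^-1` [set k]) x * e k) = fine (P (W @^-1` [set k])) * e k.
Proof.
rewrite -(Ex_indic P (mW k)) mulrC -ExZ; last exact: bm_indic.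
by congr Ex; apply/funext => x; rewrite mulrC.
Qed.

(** Both sides are summed over the values of [W]; dominated convergence disposes of the tail, and
    the hypothesis plays the role of a conditional expectation given [W = k]. *)
Lemma Ex_freeze :
  (forall k, Ex P (fun x => \1_(W @^-1` [set k]) x * G k x) =
    fine (P (W @^-1` [set k])) * e k) ->
  Ex P (fun x => G (W x) x) = Ex P (fun x => e (W x)).
Proof.
move=> Ge; have be k : bm (fun _ : T => e k) by exact: bm_cst.
have eM' k (x : T) : `|e k| <= M by exact: eM.
rewrite -(cvg_lim _ (Ex_approx_cvg bG GM))// -(cvg_lim _ (Ex_approx_cvg be eM'))//.
congr (lim (_ @ \oo)); apply/funext => K; rewrite !Ex_sum.
- by apply: eq_bigr => k _; rewrite Ge Ex_indicM.
- by move=> k; apply: bmM => //; exact: bm_indic.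
- by move=> k; apply: bmM => //; exact: bm_indic.
Qed.

Lemma Ex_discrete_cvg :
  \sum_(k < K) fine (P (W @^-1` [set (k : nat)])) * e k @[K --> \oo] -->
  Ex P (fun x => e (W x)).
Proof.
have be k : bm (fun _ : T => e k) by exact: bm_cst.
have eM' k (x : T) : `|e k| <= M by exact: eM.
apply: (cvg_eq (Ex_approx_cvg be eM')) => // K; rewrite Ex_sum.
- by apply: eq_bigr => k _; rewrite Ex_indicM.
- by move=> k; apply: bmM => //; exact: bm_indic.
Qed.

End freezing.

(** * Poisson counts *)

Section poisson.
Context {R : realType} {d : measure_display} {T : measurableType d}.
Variables (P : probability T R) (lambda : R) (N : R -> T -> nat).
Hypotheses (lambda_gt0 : 0 < lambda) (PN : poisson_process P lambda N).

Let LN : levy_process P (fun t w => (N t w)%:R) := PN.1.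

Lemma poisson_measurable t k : 0 <= t -> measurable (N t @^-1` [set k]).
Proof.
move=> t0; have := levy_measurable LN t0 measurableT (measurable_set1 (k%:R : R)).
rewrite setTI; congr measurable; apply/seteqP; split => w /=.
  by move/eqP; rewrite eqr_nat => /eqP.
by move=> ->.
Qed.

(** By stationarity [N t - N s] has the law of [N (t - s)], which is never negative. The null set
    depends on [s] and [t], so only countably many pairs can be treated at once. *)
Lemma poisson_mono s t : 0 <= s -> s <= t -> {ae P, forall w, (N s w <= N t w)%N}.
Proof.
move=> s0 st; have ts0 : 0 <= t - s by rewrite subr_ge0.
have mA : measurable [set x : R | x < 0] by rewrite -set_itvNyo; exact: measurable_itv.
have := levy_stationary LN s0 ts0 mA; rewrite subrKC.
have -> : [set w | [set x : R | x < 0] (N (t - s) w)%:R] = set0.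
  by apply/seteqP; split => w //=; rewrite ltNge ler0n.
rewrite measure0 => H.
exists [set w | [set x : R | x < 0] ((N t w)%:R - (N s w)%:R)]; split => //.
  have := levy_measurable_increment LN s0 (le_trans s0 st) measurableT mA.
  by rewrite setTI.
by move=> w /= /negP; rewrite -ltnNge subr_lt0 ltr_nat.
Qed.

Lemma poisson_generating (q s : R) : 0 <= q <= 1 -> 0 < s ->
  Ex P (fun w => q ^+ N s w) = expR (- (lambda * s * (1 - q))).
Proof.
move=> /andP[q0 q1] s0.
have ls0 : 0 < lambda * s by rewrite mulr_gt0.
have mN k : measurable (N s @^-1` [set k]) by exact: poisson_measurable (ltW s0).
have bq k : `|q ^+ k| <= 1 by rewrite ger0_norm ?exprn_ge0// exprn_ile1.
have h1 := Ex_discrete_cvg (P := P) mN bq.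
have h2 : series (exp_coeff (q * (lambda * s))) K @[K --> \oo] --> expR (q * (lambda * s)).
  exact: is_cvg_series_exp_coeff.
rewrite -(cvg_lim _ h1)//; apply/cvg_lim => //.
apply: (cvg_eq (cvgM (@cvg_cst _ (expR (- (lambda * s))) _ \oo _) h2)) => [K|]; last first.
  by rewrite -expRD; congr expR; ring.
rewrite /= /series/= big_mkord mulr_sumr; apply: eq_bigr => k _.
have -> : fine (P (N s @^-1` [set (k : nat)])) = poisson_pmf (lambda * s) k.
  by have := PN.2 s k s0 => /(congr1 fine).
rewrite /poisson_pmf ls0 /exp_coeff/= exprMn; ring.
Qed.

End poisson.

Section compound.
Context {R : realType} {d : measure_display} {T : measurableType d}.
Variables (P : probability T R) (r lambda : R) (N : R -> T -> nat) (X : nat -> T -> R).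
Hypotheses (r01 : 0 < r < 1) (lambda_gt0 : 0 < lambda) (PN : poisson_process P lambda N)
  (dX : forall j, has_density P `[- pi, pi] (poisson_kernel r) (X j))
  (iX : mutually_independent P X)
  (NX : independent_sigma_algebras P (generated_sigma_algebra [set t | 0 <= t] N)
          (generated_sigma_algebra setT X)).

Let S k w : R := \sum_(j < k) X j w.

Let measurable_X j : measurable_fun setT (X j) := (dX j).1.

Let measurable_S k : measurable_fun setT (S k).
Proof. by apply: measurable_sum. Qed.

Lemma compound_measurable t : 0 <= t -> measurable_fun setT (fun w => \sum_(j < N t w) X j w).
Proof.
move=> t0; apply: (measurable_freeze (W := N t) _ (H := S)) => k.
  exact: (poisson_measurable PN).
exact: measurable_S.
Qed.

Let event_N t k : 0 <= t ->
  generated_sigma_algebra [set t | 0 <= t] N (N t @^-1` [set k]).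
Proof.
move=> t0; apply: sub_sigma_algebra; exists t => //.
by exists [set k]; rewrite ?setTI.
Qed.

Let event_X n (A : nat -> set R) : (forall i, measurable (A i)) ->
  generated_sigma_algebra setT X (\bigcap_(i in [set` iota 0 n]) X i @^-1` A i).
Proof.
move=> mA; apply: (@sigma_algebra_bigcap_seq _ (generated_sigma_algebra setT X) _ (iota 0 n)
  (fun i => X i @^-1` A i)); first exact: smallest_sigma_algebra.
by move=> i; apply: sub_sigma_algebra; exists i => //; exists (A i); rewrite ?setTI.
Qed.

Let cos_X (c : int) j : Ex P (fun w => cos (c%:~R * X j w)) = r ^+ `|c|%N /\
  Ex P (fun w => sin (c%:~R * X j w)) = 0.
Proof.
have [hc hs] := (poisson_kernel_cos r01 (dX j) `|c|%N, poisson_kernel_sin r01 (dX j) `|c|%N).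
have [c0|c0] := leP 0 c.
  by rewrite -hc -hs; split; congr Ex; apply/funext => w; rewrite -{1}(gez0_abs c0).
have cE : c%:~R = - (`|c|%N%:R) :> R by rewrite -[c in LHS]opprK -(ltz0_abs c0) rmorphN.
split; first by rewrite -hc; congr Ex; apply/funext => w; rewrite cE mulNr cosN.
rewrite (_ : (fun w => _) = (fun w => -1 * sin (`|c|%N%:R * X j w))).
  have bX : bm (fun w => sin (`|c|%N%:R * X j w)).
    exact: (bm_comp (bm_sinM _) (measurable_X j)).
  by rewrite ExZ// hs mulr0.
by apply/funext => w; rewrite cE mulN1r mulNr sinN.
Qed.

Let cos_sum (B : set T) (c : nat -> int) n th : measurable B ->
  generated_sigma_algebra [set t | 0 <= t] N B ->
  Ex P (fun w => \1_B w * cos (th + \sum_(j < n) (c j)%:~R * X j w)) =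
  fine (P B) * (cos th * \prod_(j < n) r ^+ `|c j|%N).
Proof.
move=> mB GB; apply: (@Ex_cos_sum _ _ _ P X (\1_B) (fine (P B)) n (fun j => (c j)%:~R)
  (fun j => r ^+ `|c j|%N)) => //; first exact: bm_indic.
move=> phi bphi; apply: (@Ex_prod _ _ _ P X (\1_B) (fine (P B)) n) => //;
  first exact: bm_indic.
move=> A mA; apply: indep_indic => //.
rewrite (NX GB (event_X n mA)); congr (_ * _)%E.
by apply: iX => //; exact: iota_uniq.
Qed.

Let sum_lt K m : (m <= K)%N -> (\sum_(j < K) (j < m) = m)%N.
Proof.
move=> mK; rewrite -[RHS]card_ord -sum1_card (big_ord_widen K (fun=> 1%N) mK).
by rewrite [RHS]big_mkcond/=; apply: eq_bigr => j _; case: (j < m)%N.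
Qed.

Let S_widen K m w : (m <= K)%N -> S m w = \sum_(j < K) X j w *+ (j < m).
Proof.
move=> mK; rewrite /S (big_ord_widen K (fun j => X j w) mK) big_mkcond/=.
by apply: eq_bigr => j _; case: (j < m)%N.
Qed.

(** With the counts frozen at [k i], each increment is a sum over a block of jumps, and the blocks
    are disjoint. Regrouping by jumps gives the [j]-th one the single coefficient [c' j]. *)
Let cos_blocks (B : set T) (c : nat -> int) (k : nat -> nat) n th : measurable B ->
  generated_sigma_algebra [set t | 0 <= t] N B -> {homo k : i j / (i <= j)%N} ->
  Ex P (fun w => \1_B w * cos (th + \sum_(i < n) (c i)%:~R * (S (k i.+1) w - S (k i) w))) =
  fine (P B) * (cos th * \prod_(i < n) r ^+ (`|c i|%N * (k i.+1 - k i))).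
Proof.
move=> mB GB kn; pose b i j : bool := (k i <= j < k i.+1)%N.
have bE i j : ((j < k i) + b i j = (j < k i.+1))%N.
  have := kn _ _ (leqnSn i); rewrite /b; case: (ltnP j (k i)) => [h1 h2|//].
  by rewrite (leq_trans h1 h2).
pose c' j : int := \sum_(i < n) c i *+ b i j.
have Ec w : \sum_(i < n) (c i)%:~R * (S (k i.+1) w - S (k i) w) =
    \sum_(j < k n) (c' j)%:~R * X j w.
  transitivity (\sum_(i < n) \sum_(j < k n) (c i *+ b i j)%:~R * X j w).
    apply: eq_bigr => i _.
    rewrite (S_widen w (kn _ _ (ltn_ord i))) (S_widen w (kn _ _ (ltnW (ltn_ord i)))).
    rewrite -sumrB mulr_sumr; apply: eq_bigr => j _.
    rewrite -bE mulrnDr addrAC subrr add0r rmorphMn/= mulrnAr mulrnAl.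
    by [].
  rewrite exchange_big/=; apply: eq_bigr => j _.
  by rewrite -mulr_suml /c' rmorph_sum.
(* At most one block contains [j], so the absolute value passes through the sum. *)
have Hc' j : `|c' j|%N = (\sum_(i < n) `|c i|%N * b i j)%N.
  have [[i0 bi0]|nb] := pselect (exists i : 'I_n, b i j).
    have b0 (i : 'I_n) : i != i0 -> b i j = false.
      move=> ii0; apply/negP => bi; move: bi bi0; rewrite /b => /andP[h1 h2] /andP[h3 h4].
      have [ij|ij] := ltnP i i0.
        by have := leq_trans h2 (leq_trans (kn _ _ ij) h3); rewrite ltnn.
      have {ij} : (i0 < i)%N by rewrite ltn_neqAle ij andbT eq_sym.
      move=> ij.
      by have := leq_trans h4 (leq_trans (kn _ _ ij) h1); rewrite ltnn.
    rewrite /c' (bigD1 i0)//= big1 => [|i /b0 ->]; last by rewrite mulr0n.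
    rewrite (bigD1 i0)//= big1 => [|i /b0 ->]; last by rewrite muln0.
    by rewrite bi0 mulr1n addr0 muln1 addn0.
  have b0 (i : 'I_n) : b i j = false by apply/negP => bi; apply: nb; exists i.
  by rewrite /c' !big1// => i _; rewrite b0 ?mulr0n ?muln0.
under eq_fun do rewrite Ec; rewrite cos_sum//; congr (_ * (_ * _)).
rewrite !prodrXr; congr (r ^+ _).
under eq_bigr do rewrite Hc'; rewrite exchange_big/=; apply: eq_bigr => i _.
rewrite -big_distrr/=; congr (_ * _)%N.
apply/eqP; rewrite -(eqn_add2l (k i)) subnKC ?kn//.
rewrite -{1}(sum_lt (kn _ _ (ltnW (ltn_ord i)))) -big_split/=.
by under eq_bigr do rewrite bE; rewrite sum_lt// kn.
Qed.

(* Replacing the values of [N] by their running maximum makes every tuple of values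
   monotone; it changes nothing almost surely. *)
Let runmax (s : seq nat) i : nat := \max_(l < i.+1) nth 0%N s l.

Let runmax_homo s : {homo runmax s : i j / (i <= j)%N}.
Proof.
move=> i j ij; apply/bigmax_leqP => l _.
have lj : (l < j.+1)%N by apply: leq_trans (ltn_ord l) _.
exact: (leq_bigmax (Ordinal lj)).
Qed.

Let runmaxE s i : (forall l, (l < i)%N -> nth 0%N s l <= nth 0%N s l.+1)%N ->
  runmax s i = nth 0%N s i.
Proof.
move=> si; apply/eqP; rewrite eqn_leq; apply/andP; split; last first.
  exact: (leq_bigmax (Ordinal (ltnSn i))).
apply/bigmax_leqP => l _; have : (l <= i)%N by rewrite -ltnS.
move: (nat_of_ord l) => {}l.
elim: i si => [|i IH] si; first by rewrite leqn0 => /eqP ->.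
rewrite leq_eqVlt => /predU1P[-> //|li].
by apply: leq_trans (si i _) => //; apply: IH => // m mi; apply: si; rewrite ltnW.
Qed.

(** Given all counts, the jumps contribute [r] to the power of the weighted number of jumps; the
    remaining mean over the counts factors by independent increments, and each factor is a value of
    the Poisson generating function. *)
Lemma compound_Ex_cos n (t : nat -> R) (c : nat -> int) th :
  0 <= t 0%N -> (forall i, t i < t i.+1) ->
  Ex P (fun w => cos (th + \sum_(i < n) (c i)%:~R *
    ((\sum_(j < N (t i.+1) w) X j w) - (\sum_(j < N (t i) w) X j w)))) =
  cos th * \prod_(i < n) expR (- (lambda * (t i.+1 - t i) * (1 - r ^+ `|c i|%N))).
Proof.
move=> t0 tS; have /andP[r0 r1] := r01.
have tn : nondecreasing_seq t by apply/nondecreasing_seqP => i; exact: ltW.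
have ti i : 0 <= t i by apply: le_trans t0 (tn _ _ (leq0n i)).
pose V w := [seq N (t i) w | i <- iota 0 n.+1].
(* The tuple of counts is coded by one integer, so that [Ex_freeze] conditions on all of them at
   once. *)
pose W w := pickle (V w).
pose dec k : seq nat := odflt [::] (unpickle k).
have decW w : dec (W w) = V w by rewrite /dec /W pickleK.
have nthV w i : (i <= n)%N -> nth 0%N (V w) i = N (t i) w.
  by move=> i_n; rewrite (nth_map 0%N) ?size_iota// nth_iota.
(* A level set of [W] is empty or a finite intersection of level sets of the counts. [H] is left
   free since both measurability and membership in the sigma-algebra of [N] are wanted. *)
have event (H : set (set T)) : sigma_algebra setT H ->
    (forall i k, H (N (t i) @^-1` [set k])) -> forall k, H (W @^-1` [set k]).
  move=> sH HN k; have [[w0 Ww0]|nW] := pselect (exists w, W w = k); last first.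
    rewrite (_ : _ @^-1` _ = set0); first by case: sH.
    by apply/seteqP; split => w //= Ww; apply: nW; exists w.
  have -> : W @^-1` [set k] =
      \bigcap_(i in [set` iota 0 n.+1]) N (t i) @^-1` [set N (t i) w0].
    apply/seteqP; split => w; [move=> Ww i iV|move=> Hw].
      have i_n : (i <= n)%N.
        by have : i \in iota 0 n.+1 := iV; rewrite mem_iota add0n ltnS => /andP[].
      have := congr1 (fun k => nth 0%N (dec k) i) (etrans Ww (esym Ww0)).
      by rewrite /= !decW !nthV.
    have VE : V w = V w0 by apply/eq_in_map => i iV; exact: Hw.
    by rewrite /preimage/= /W VE.
  exact: sigma_algebra_bigcap_seq.
have mW k : measurable (W @^-1` [set k]).
  apply: (event _ (sigma_algebra_measurable T)) => i j; exact: (poisson_measurable PN).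
have gW k : generated_sigma_algebra [set t | 0 <= t] N (W @^-1` [set k]).
  by apply: (event _ (smallest_sigma_algebra _ _)) => i j; exact: event_N.
pose K k i := runmax (dec k) i.
pose G k w := cos (th + \sum_(i < n) (c i)%:~R * (S (K k i.+1) w - S (K k i) w)).
pose e k := cos th * \prod_(i < n) r ^+ (`|c i|%N * (K k i.+1 - K k i)).
have cos1 x : `|cos x| <= 1 :> R by rewrite ler_norml cos_geN1 cos_le1.
have bG k : bm (G k).
  apply: (bm_comp (@bm_cosine R)); apply: measurable_funD => //; apply: measurable_sum => i.
  by apply: measurable_funM => //; apply: measurable_funB; exact: measurable_S.
have rle1 m : r ^+ m <= 1 by rewrite exprn_ile1// ltW.
have e1 k : `|e k| <= 1.
  rewrite /e normrM -[leRHS]mulr1 ler_pM// ger0_norm.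
    by apply: prodr_ile1 => i _; rewrite exprn_ge0 ?(ltW r0)//=.
  by apply: prodr_ge0 => i _; rewrite exprn_ge0 ?(ltW r0).
have mono : {ae P, forall w i, (N (t i) w <= N (t i.+1) w)%N}.
  by apply: ae_foralln => i; apply: (poisson_mono PN) => //; exact: ltW.
have KE w : (forall i, (N (t i) w <= N (t i.+1) w)%N) ->
    forall i, (i <= n)%N -> K (W w) i = N (t i) w.
  move=> Hw i i_n; rewrite /K decW runmaxE ?nthV// => l li.
  by rewrite !nthV// ?(ltnW (leq_trans li i_n))// (leq_trans li).
have bD i : measurable_fun setT (fun w => (\sum_(j < N (t i) w) X j w : R)).
  exact: compound_measurable.
transitivity (Ex P (fun w => G (W w) w)).
  apply: Ex_ae.
  - apply: (bm_comp (@bm_cosine R)); apply: measurable_funD => //; apply: measurable_sum => i.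
    by apply: measurable_funM => //; apply: measurable_funB.
  - by apply: (bm_freeze mW (M := 1)) => // k x; exact: cos1.
  - apply: ae_imp mono => w /KE KEw; rewrite /G; congr cos; congr (_ + _).
    by apply: eq_bigr => i _; rewrite /S !KEw// ltnW.
rewrite (Ex_freeze mW bG (M := 1) (e := e)) //; last first.
- by move=> k; exact: (cos_blocks c n th (mW k) (gW k) (@runmax_homo (dec k))).
- by move=> k x; exact: cos1.
(* An extension of [k |-> r ^ (|c i| k)] to real arguments, as [levy_Ex_prod] takes bounded
   functions of real increments; the absolute value of [x] keeps it at most 1. *)
pose phi i (x : R) := expR (ln r * (`|c i|%N%:R * `|x|)).
have bphi i : bm (phi i).
  split.
    apply: measurableT_comp => //; apply: measurable_funM => //.
    by apply: measurable_funM => //; exact: measurableT_comp.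
  exists 1 => x; rewrite ger0_norm ?expR_ge0// -[leRHS]expR0 ler_expR.
  by rewrite nmulr_rle0 ?mulr_ge0// ln_lt0 ?r0.
have phiE i (k : nat) : phi i k%:R = (r ^+ `|c i|%N) ^+ k.
  rewrite /phi ger0_norm// -natrM mulrC expRM_natl lnK ?posrE// exprM.
  by [].
have mNt i : measurable_fun setT (fun w => (N (t i) w)%:R : R) by exact: (levy_measurable PN.1).
transitivity (cos th * Ex P (fun w => \prod_(i < n) phi i ((N (t i.+1) w)%:R - (N (t i) w)%:R))).
  rewrite -ExZ; last first.
    apply: bm_prod => i.
    apply: (bm_comp (bphi i) (X := fun w => (N (t i.+1) w)%:R - (N (t i) w)%:R : R)).
    exact: measurable_funB.
  apply: Ex_ae.
  - by apply: (bm_freeze mW (M := 1) (H := fun k _ => e k)) => // k; exact: bm_cst.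
  - apply: bmZ; apply: bm_prod => i.
    apply: (bm_comp (bphi i) (X := fun w => (N (t i.+1) w)%:R - (N (t i) w)%:R : R)).
    exact: measurable_funB.
  - apply: ae_imp mono => w Hw; congr (_ * _); apply: eq_bigr => i _.
    by rewrite !(KE _ Hw)// ?(ltnW (ltn_ord i))// -natrB// phiE exprM.
rewrite (levy_Ex_prod PN.1 n t0 tn bphi); congr (_ * _); apply: eq_bigr => i _.
have dt : 0 < t i.+1 - t i by rewrite subr_gt0.
under eq_fun do rewrite phiE.
by rewrite (poisson_generating lambda_gt0 PN)// exprn_ge0 ?(ltW r0)/=.
Qed.

End compound.

(** * Approximation by trigonometric polynomials *)

Section fejer.
Context {R : realType}.
Implicit Types (x y : R) (N : nat).

Definition chord x y : R := cabs (unit_exp x - unit_exp y).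

Lemma chord_ge0 x y : 0 <= chord x y.
Proof. exact: cabs_ge0. Qed.

Lemma chord_sqr x y : chord x y ^+ 2 = 2 - 2 * cos (x - y).
Proof.
rewrite /chord cabsX2/= cosB.
have := cos2Dsin2 x; have := cos2Dsin2 y; move: (cos x) (cos y) (sin x) (sin y) => a b c e h1 h2.
have -> : (a - b) ^+ 2 + (c - e) ^+ 2 = (a ^+ 2 + c ^+ 2) + (b ^+ 2 + e ^+ 2) - 2 * (a * b + c * e).
  by ring.
by rewrite h1 h2; congr (_ - _); lra.
Qed.

(** From [(2 eta - a)^2 >= 0], that is [a <= eta + a^2 / (4 eta)]: the chord is traded for its
    square, which is affine in a cosine and so accessible both to the Fejer kernel and to
    expectations. *)
Lemma chord_le (eta : R) x y : 0 < eta -> chord x y <= eta + (2 - 2 * cos (x - y)) / (4 * eta).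
Proof.
move=> e0; rewrite -chord_sqr; move: (chord x y) => a.
rewrite -subr_ge0 (_ : _ - a = (2 * eta - a) ^+ 2 / (4 * eta)).
  by rewrite divr_ge0 ?sqr_ge0// mulr_ge0// ltW.
by field; rewrite lt0r_neq0.
Qed.

Let csum N x := \sum_(k < N) cos (k%:R * x).
Let ssum N x := \sum_(k < N) sin (k%:R * x).

(** The real and imaginary parts of the geometric sum identity
    [(q - 1) (1 + ... + q^(N-1)) = q^N - 1] with [q = exp (i x)]. *)
Let geometric N x :
  csum N x * cos x - ssum N x * sin x - csum N x = cos (N%:R * x) - 1 /\
  csum N x * sin x + ssum N x * cos x - ssum N x = sin (N%:R * x).
Proof.
elim: N => [|N [IH1 IH2]].
  by rewrite /csum /ssum !big_ord0 !mul0r cos0 sin0 !subr0 subrr addr0.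
rewrite /csum /ssum !big_ord_recr/= -/(csum N x) -/(ssum N x) -[N.+1%:R]natr1.
rewrite [(N%:R + 1) * x]mulrDl mul1r cosD sinD -IH2 -[cos (N%:R * x)](subrK 1) -IH1.
have := cos2Dsin2 x; move: (csum N x) (ssum N x) (cos x) (sin x) => C S a b h.
by split; nra.
Qed.

Let dirichlet_sqr N x :
  (csum N x ^+ 2 + ssum N x ^+ 2) * (2 - 2 * cos x) = 2 - 2 * cos (N%:R * x).
Proof.
have [h1 h2] := geometric N x.
have := cos2Dsin2 (N%:R * x); have := cos2Dsin2 x.
have -> : cos (N%:R * x) = csum N x * cos x - ssum N x * sin x - csum N x + 1.
  by rewrite h1 subrK.
rewrite -h2; move: (csum N x) (ssum N x) (cos x) (sin x) => C S a b h3 h4.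
by nra.
Qed.

(** The Fejer kernel, the squared modulus of the sum of the [exp (i k x)] over [k < N] divided by
    [N]; the double sum displays it as a trigonometric polynomial of degree less than [N]. *)
Definition fejer N x : R := N%:R^-1 * \sum_(k < N) \sum_(l < N) cos ((k%:Z - l%:Z)%:~R * x).

Let fejerE N x : fejer N x = N%:R^-1 * (csum N x ^+ 2 + ssum N x ^+ 2).
Proof.
congr (_ * _); rewrite !expr2 !mulr_suml -big_split/=; apply: eq_bigr => k _.
rewrite !mulr_sumr -big_split/=; apply: eq_bigr => l _.
by rewrite rmorphB/= mulrBl cosB.
Qed.

Lemma fejer_ge0 N x : 0 <= fejer N x.
Proof. by rewrite fejerE mulr_ge0// addr_ge0 ?sqr_ge0. Qed.

Lemma fejer_concentrated N x : (2 - 2 * cos x) * fejer N x <= 4 / N%:R.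
Proof.
rewrite fejerE mulrCA [_ * (_ + _)]mulrC dirichlet_sqr mulrC ler_wpM2r//.
by have := cos_geN1 (N%:R * x); lra.
Qed.

Definition node N (j : nat) : R := j%:R * (2 * pi / N%:R).

(** At the angle [th = 2 pi |m| / N] one has [cos (N th) = 1], so [dirichlet_sqr] forces both
    exponential sums to vanish as soon as [cos th < 1], which holds because [th / 2] lies strictly
    between 0 and [pi]. *)
Let node_sum N (m : int) x : (0 < N)%N -> (0 < `|m| < N)%N ->
  \sum_(j < N) cos (m%:~R * (x - node N j)) = 0.
Proof.
move=> N0 /andP[m0 mN]; pose th : R := `|m|%N%:R * (2 * pi / N%:R).
have N0' : N%:R != 0 :> R by rewrite pnatr_eq0 -lt0n.
have thN : N%:R * th = `|m|%N%:R * (2 * pi) by rewrite /th mulrCA [N%:R * _]mulrC divfK.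
have cN : cos (N%:R * th) = 1.
  rewrite thN; elim: {+}`|m|%N => [|k IH]; first by rewrite mul0r cos0.
  by rewrite -natr1 mulrDl mul1r {2}[2 * pi]mulr_natl cosD2pi.
have half : 0 < th / 2 < pi.
  have p0 := pi_gt0 R.
  have -> : th / 2 = (`|m|%N%:R / N%:R) * pi by rewrite /th; field.
  by rewrite mulr_gt0 ?divr_gt0 ?ltr0n//= gtr_pMl// ltr_pdivrMr ?ltr0n// mul1r ltr_nat.
have cth : cos th < 1.
  have -> : th = th / 2 + th / 2 by rewrite -splitr.
  rewrite cosD; have := cos2Dsin2 (th / 2); have := sin_gt0_pi half.
  by move: (sin _) (cos _) => s c s0; nra.
have := dirichlet_sqr N th; rewrite cN mulr1 subrr => /eqP; rewrite mulf_eq0 => /orP[]; last first.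
  by rewrite subr_eq0 => /eqP; lra.
rewrite paddr_eq0 ?sqr_ge0// !sqrf_eq0 => /andP[/eqP C0 /eqP S0].
have nodeE (j : nat) : `|m|%N%:R * node N j = j%:R * th by rewrite /node /th mulrCA.
have mE (y : R) : cos (m%:~R * y) = cos (`|m|%N%:R * y).
  have [h|h] := leP 0 m; first by rewrite -{1}(gez0_abs h).
  by rewrite -[m in LHS]opprK -(ltz0_abs h) rmorphN/= mulNr cosN.
under eq_bigr do rewrite mE mulrBr nodeE cosB.
by rewrite big_split/= -!mulr_sumr -/(csum N th) -/(ssum N th) C0 S0 !mulr0 addr0.
Qed.

Lemma fejer_average N x : (0 < N)%N -> N%:R^-1 * \sum_(j < N) fejer N (x - node N j) = 1.
Proof.
move=> N0; have N0' : N%:R != 0 :> R by rewrite pnatr_eq0 -lt0n.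
have diag (k l : 'I_N) : \sum_(j < N) cos ((k%:Z - l%:Z)%:~R * (x - node N j)) =
    if l == k then N%:R else 0.
  have [->|kl] := eqVneq l k.
    under eq_bigr do rewrite subrr mul0r cos0.
    by rewrite sumr_const card_ord.
  apply: node_sum => //; apply/andP; split.
    by rewrite absz_gt0 subr_eq0 eqz_nat eq_sym.
  have [h|h] := leqP l k.
    by rewrite distnEl// (leq_ltn_trans (leq_subr _ _)).
  by rewrite distnEr ?(ltnW h)// (leq_ltn_trans (leq_subr _ _)).
rewrite /fejer -mulr_sumr exchange_big/=.
under eq_bigr do rewrite exchange_big/=.
under eq_bigr do under eq_bigr do rewrite diag.
under eq_bigr do rewrite -big_mkcond/= big_pred1_eq.
by rewrite sumr_const card_ord -[X in _ * (_ * X)]mulr_natl; field.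
Qed.

End fejer.

(** * Trigonometric polynomials in several angles *)

Section trigonometric.
Context {R : realType}.

Inductive trig_poly (n : nat) : ((nat -> R) -> R) -> Prop :=
| trig_cos a th (c : nat -> int) :
    trig_poly n (fun x => a * cos (th + \sum_(i < n) (c i)%:~R * x i))
| trig_add p q : trig_poly n p -> trig_poly n q -> trig_poly n (fun x => p x + q x).

Lemma trig_eq n p q : trig_poly n p -> p =1 q -> trig_poly n q.
Proof. by move=> tp /funext <-. Qed.

Lemma trig_cst n a : trig_poly n (fun=> a).
Proof.
apply: trig_eq (trig_cos n a 0 (fun=> 0)) _ => x.
by rewrite big1 ?addr0 ?cos0 ?mulr1// => i _; rewrite mul0r.
Qed.

Lemma trig_sum n (I : Type) (s : seq I) (p : I -> (nat -> R) -> R) :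
  (forall i, trig_poly n (p i)) -> trig_poly n (fun x => \sum_(i <- s) p i x).
Proof.
move=> tp; elim: s => [|i s IH].
  by apply: trig_eq (trig_cst n 0) _ => x; rewrite big_nil.
by apply: trig_eq (trig_add (tp i) IH) _ => x; rewrite big_cons.
Qed.

Lemma trig_scale n b p : trig_poly n p -> trig_poly n (fun x => b * p x).
Proof.
elim=> [a th c|p1 p2 _ h1 _ h2].
  by apply: trig_eq (trig_cos n (b * a) th c) _ => x; rewrite mulrA.
by apply: trig_eq (trig_add h1 h2) _ => x; rewrite /= -mulrDr.
Qed.

Lemma trig_mul_cos n (m : int) (y : R) p : trig_poly n p ->
  trig_poly n.+1 (fun x => cos (m%:~R * (x n - y)) * p x).
Proof.
elim=> [a th c|p1 p2 _ h1 _ h2]; last first.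
  by apply: trig_eq (trig_add h1 h2) _ => x; rewrite /= -mulrDr.
pose c' (s : int) i := if i == n then s else c i.
have E s (x : nat -> R) : \sum_(i < n.+1) (c' s i)%:~R * x i = \sum_(i < n) (c i)%:~R * x i + s%:~R * x n.
  rewrite big_ord_recr/= /c' eqxx; congr (_ + _); apply: eq_bigr => i _.
  by rewrite ltn_eqF.
apply: trig_eq (trig_add (trig_cos n.+1 (a / 2) (th - m%:~R * y) (c' m))
  (trig_cos n.+1 (a / 2) (th + m%:~R * y) (c' (- m)))) _ => x.
rewrite !E rmorphN/= mulNr; set A := \sum_(i < n) _; set B := m%:~R * x n.
have -> : th - m%:~R * y + (A + B) = (th + A) + m%:~R * (x n - y) by rewrite /B; ring.
have -> : th + m%:~R * y + (A - B) = (th + A) - m%:~R * (x n - y) by rewrite /B; ring.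
by rewrite cosB cosD; field.
Qed.

Lemma trig_mul_fejer n N y p : trig_poly n p ->
  trig_poly n.+1 (fun x => fejer N (x n - y) * p x).
Proof.
move=> tp; pose q k x := \sum_(l < N) cos ((k%:Z - l%:Z)%:~R * (x n - y)) * p x.
have tq k : trig_poly n.+1 (q k) by apply: trig_sum => l; exact: trig_mul_cos.
have := trig_scale N%:R^-1 (trig_sum (index_enum 'I_N) tq).
move=> /trig_eq; apply => x; rewrite /fejer -mulrA; congr (_ * _).
rewrite mulr_suml; apply: eq_bigr => k _.
by rewrite mulr_suml.
Qed.

(* Fejer's operator in the last variable, discretized at [N] equidistant nodes: the
   average over the nodes is exact since the kernel has degree less than [N]. *)
Lemma trig_approx n (Phi : (nat -> R) -> R) L :
  (forall x y, `|Phi x - Phi y| <= L * \sum_(i < n) chord (x i) (y i)) ->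
  forall e, 0 < e -> exists2 p, trig_poly n p & forall x, `|Phi x - p x| <= e.
Proof.
elim: n Phi => [|n IH] Phi lip e e0.
  exists (fun=> Phi (fun=> 0)); first exact: trig_cst.
  by move=> x; apply: le_trans (lip _ _) _; rewrite big_ord0 mulr0 ltW.
have [L0|L0] := leP L 0.
  exists (fun=> Phi (fun=> 0)); first exact: trig_cst.
  move=> x; apply: le_trans (lip _ _) _; apply: le_trans (ltW e0).
  by rewrite mulr_le0_ge0// sumr_ge0// => i _; exact: chord_ge0.
(* By [chord_le] and [fejer_concentrated], the last variable costs [L * (eta + 1 / (N eta))]. Here
   [L * eta = e / 4], and [N >= 1 / eta^2] makes the second term no larger; the induction hypothesis
   takes the remaining [e / 2]. *)
pose eta := e / (4 * L); have eta0 : 0 < eta by rewrite divr_gt0// mulr_gt0.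
pose N := (Num.truncn (eta ^- 2)).+1.
have N0 : 0 < N%:R :> R by rewrite ltr0n.
have Neta : N%:R^-1 / eta <= eta.
  have ee : 0 < eta * eta by exact: mulr_gt0.
  rewrite ler_pdivrMr// -[leRHS]invrK lef_pV2 ?posrE ?invr_gt0//.
  by rewrite ltW// /N expr2 truncnS_gt.
pose upd (x : nat -> R) y i := if i == n then y else x i.
have updE x y i : (i < n)%N -> upd x y i = x i by move=> i_n; rewrite /upd ltn_eqF.
have lipj y : forall x x', `|Phi (upd x y) - Phi (upd x' y)| <= L * \sum_(i < n) chord (x i) (x' i).
  move=> x x'; apply: le_trans (lip _ _) _; rewrite big_ord_recr/= ler_wpM2l ?(ltW L0)//.
  rewrite (_ : chord (upd x y n) _ = 0) ?addr0; last by rewrite /upd eqxx /chord subrr Normc.normc0.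
  by apply: eq_ler; apply/eq_bigr => i _; rewrite !updE.
have e2 : 0 < e / 2 by rewrite divr_gt0.
have /choice[p Hp] : forall j : nat, exists p, trig_poly n p /\
    forall x, `|Phi (upd x (node N j)) - p x| <= e / 2.
  by move=> j; have [p] := IH _ (lipj (node N j)) _ e2; exists p.
exists (fun x => N%:R^-1 * \sum_(j < N) fejer N (x n - node N j) * p j x).
  by apply: trig_scale; apply: trig_sum => j; apply: trig_mul_fejer; exact: (Hp j).1.
move=> x.
have -> : Phi x = N%:R^-1 * \sum_(j < N) fejer N (x n - node N j) * Phi x.
  by rewrite -mulr_suml mulrA fejer_average ?mul1r// -(ltr0n R).
rewrite -mulrBr -sumrB normrM gtr0_norm ?invr_gt0//.
have Hj j : `|fejer N (x n - node N j) * Phi x - fejer N (x n - node N j) * p j x| <=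
    fejer N (x n - node N j) * (L * eta + e / 2) + L * (N%:R^-1 / eta).
  rewrite -mulrBr normrM ger0_norm ?fejer_ge0//.
  have h1 : `|Phi x - p j x| <= L * chord (x n) (node N j) + e / 2.
    rewrite -(subrKA (Phi (upd x (node N j)))); apply: le_trans (ler_normD _ _) _.
    apply: lerD; last exact: (Hp j).2.
    apply: le_trans (lip _ _) _; rewrite ler_wpM2l ?(ltW L0)// big_ord_recr/= big1.
      by rewrite add0r /upd eqxx.
    by move=> i _; rewrite updE// /chord subrr Normc.normc0.
  have h2 := chord_le (x n) (node N j) eta0.
  have h3 := fejer_concentrated N (x n - node N j).
  have h4 := fejer_ge0 N (x n - node N j).
  apply: le_trans (ler_wpM2l h4 h1) _; rewrite !mulrDr addrAC lerD2r.
  rewrite mulrCA -[X in _ <= X + _]mulrCA -mulrDr ler_wpM2l ?(ltW L0)//.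
  apply: le_trans (ler_wpM2l h4 h2) _; rewrite mulrDr lerD2l mulrA ler_pdivrMr ?(mulr_gt0 _ eta0)//.
  rewrite mulrC; apply: le_trans h3 _.
  by apply: eq_ler; field; rewrite !lt0r_neq0.
have iN : 0 <= N%:R^-1 :> R by rewrite invr_ge0 ltW.
apply: (le_trans (ler_wpM2l iN (ler_norm_sum _ _ _))).
apply: (le_trans (ler_wpM2l iN (ler_sum _ (fun (j : 'I_N) _ => Hj j)))).
rewrite big_split/= mulrDr -mulr_suml mulrA fejer_average ?mul1r; last by rewrite -(ltr0n R).
rewrite sumr_const card_ord -[X in _ + _ * X]mulr_natl mulKf ?lt0r_neq0//.
have : L * eta = e / 4 by rewrite /eta; field; rewrite lt0r_neq0.
have := ler_wpM2l (ltW L0) Neta; lra.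
Qed.

Lemma trig_bm d (T : measurableType d) n (D : nat -> T -> R) p : trig_poly n p ->
  (forall i, measurable_fun setT (D i)) -> bm (fun w => p (fun i => D i w)).
Proof.
move=> + mD; elim=> [a th c|p1 p2 _ h1 _ h2]; last exact: bmD.
apply: bmZ; apply: (bm_comp (f := cos) (X := fun w => th + \sum_(i < n) (c i)%:~R * D i w)).
  exact: bm_cosine.
by apply: measurable_funD => //; apply: measurable_sum => i; exact: measurable_funM.
Qed.

End trigonometric.

(** * Driving processes *)

Section paths.
Context {R : realType}.
Implicit Types (y : R -> R) (xi : R -> R[i]).

(** [y] is any cadlag process that controls [xi]: the angle in the Cauchy case, the number of jumps
    in the compound Poisson case. *)
Lemma small_osc_cadlag (T : R) xi y : 0 <= T -> cadlag y ->
  (forall e : R, 0 < e -> exists2 d : R, 0 < d &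
    forall u v, 0 <= u -> 0 <= v -> `|y u - y v| < d -> cabs (xi u - xi v) <= e) ->
  small_osc T xi.
Proof.
move=> T0 [yr yl] yxi; apply: small_oscP => // s /andP[s0 sT] e e0.
have [d d0 Hd] := yxi e e0.
have [d1 d10 Hd1] : exists2 d1, 0 < d1 & forall u, s <= u -> u < s + d1 -> `|y s - y u| < d.
  have /cvgrPdist_lt/(_ _ d0) := yr s s0; rewrite near_withinE => -[d1 /= d10 H].
  exists d1 => // u su us; have [->|su'] := eqVneq u s; first by rewrite subrr normr0.
  apply: H; last by rewrite lt_neqAle eq_sym su' su.
  by rewrite /ball_/= distrC ger0_norm ?subr_ge0// ltrBlDl.
have [d2 d20 Hd2] : exists2 d2, 0 < d2 &
    forall u v, 0 <= u -> s - d2 < u -> u <= v -> v < s -> `|y u - y v| < d.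
  move: s0; rewrite le_eqVlt => /predU1P[s0|s0].
    exists 1 => // u v u0 _ uv; rewrite -s0 => v0.
    by have := le_lt_trans (le_trans u0 uv) v0; rewrite ltxx.
  have d2 : 0 < d / 2 by rewrite divr_gt0.
  have /cvg_ex[l] := yl s s0.
  move=> /cvgrPdist_lt/(_ _ d2); rewrite near_withinE => -[d1' /= d10' H].
  exists d1' => // u v _ su uv vs.
  have Hu w : s - d1' < w -> w < s -> `|l - y w| < d / 2.
    move=> h1 h2; apply: H => //; rewrite /ball_/= ger0_norm ?subr_ge0 ?ltW//.
    by rewrite ltrBlDl -ltrBlDr.
  rewrite -(subrKA l) (le_lt_trans (ler_normD _ _))// [d]splitr ltrD//.
    by rewrite distrC Hu// (le_lt_trans uv).
  by rewrite Hu// (lt_le_trans su).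
exists (Num.min d1 d2); first by rewrite lt_min d10.
split=> [u su|u v u0]; rewrite ?lt_min.
  rewrite -ltrBlDl lt_min => /andP[h1 _]; apply: Hd => //; first exact: le_trans su.
  by apply: Hd1 => //; rewrite -ltrBlDl.
rewrite ltrBlDr -ltrBlDl lt_min => /andP[_ h1] uv vs.
apply: Hd => //; first exact: le_trans uv.
by apply: Hd2 => //; rewrite ltrBlDr -ltrBlDl.
Qed.

Lemma chord_small (e : R) : 0 < e ->
  exists2 d : R, 0 < d & forall x z, `|x - z| < d -> chord x z <= e.
Proof.
move=> e0; have e2 : 0 < e ^+ 2 / 2 by rewrite divr_gt0// exprn_gt0.
have /cvgrPdist_lt/(_ _ e2)[d /= d0 H] := @continuous_cos R 0.
exists d => // x z xz.
rewrite -ler_sqr ?nnegrE ?chord_ge0 ?(ltW e0)// chord_sqr.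
have := H (x - z); rewrite /ball_/= sub0r normrN => /(_ xz); rewrite cos0.
move=> /(le_lt_trans (ler_norm _)); lra.
Qed.

End paths.

(* What the proof uses of a driving process [exp (i Y)]: the increments of [Y] are
   independent and symmetric, and [a m s] is the characteristic function of an
   increment over a time [s] at the frequency [m]. *)
Record driving {R : realType} {d : measure_display} {T : measurableType d}
    (P : probability T R) (xi : R -> T -> R[i]) (Y : R -> T -> R) (a : nat -> R -> R) : Prop := {
  driving_exp : forall t w, 0 <= t -> xi t w = unit_exp (Y t w) ;
  driving_measurable : forall t, 0 <= t -> measurable_fun setT (Y t) ;
  driving_start : {ae P, forall w, Y 0 w = 0} ;
  driving_osc : forall t, 0 <= t -> {ae P, forall w, small_osc t (xi ^~ w)} ;
  driving_trig : forall n (t : nat -> R) (c : nat -> int) th,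
    0 <= t 0%N -> (forall i, t i < t i.+1) ->
    Ex P (fun w => cos (th + \sum_(i < n) (c i)%:~R * (Y (t i.+1) w - Y (t i) w))) =
    cos th * \prod_(i < n) a `|c i|%N (t i.+1 - t i) }.

Lemma compound_driving {R : realType} {d : measure_display} {T : measurableType d}
    (P : probability T R) (r lambda : R) xi : 0 < r < 1 -> 0 < lambda ->
  compound_poisson_driving P r lambda xi ->
  exists Y, driving P xi Y (fun m s => expR (- (lambda * s * (1 - r ^+ m)))).
Proof.
move=> r01 l0 [N [X [[PN dX iX NX] xiE]]].
exists (fun t w => \sum_(j < N t w) X j w); split => //.
- exact: (compound_measurable PN dX).
- apply: ae_imp (levy_start PN.1) => w /eqP; rewrite pnatr_eq0 => /eqP ->.
  by rewrite big_ord0.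
- move=> t t0; apply: ae_imp (levy_cadlag PN.1) => w cN.
  (* Counts at distance less than 1 are equal, so [xi] takes the same value at both times whatever
     [e] is. *)
  apply: (small_osc_cadlag t0 cN) => e e0; exists 1 => // u v u0 v0.
  rewrite !xiE// => uv; have -> : N u w = N v w.
    have far k l : (k < l)%N -> `|k%:R - l%:R| < 1 :> R = false.
      move=> kl; rewrite distrC ger0_norm ?subr_ge0 ?ler_nat ?(ltnW kl)//.
      by rewrite -natrB ?(ltnW kl)// (ltr_nat R _ 1) ltnS leqn0 subn_eq0 leqNgt kl.
    by case: (ltngtP (N u w) (N v w)) uv => // h; rewrite ?(far _ _ h)// distrC far.
  by rewrite subrr Normc.normc0 ltW.
- by move=> n t c th t0 tS; rewrite (compound_Ex_cos r01 l0 PN dX iX NX).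
Qed.

Lemma cauchy_driving {R : realType} {d : measure_display} {T : measurableType d}
    (P : probability T R) xi : unimodular_cauchy_driving P xi ->
  exists Y, driving P xi Y (fun m s => expR (- (m%:R * s))).
Proof.
move=> [C HC xiE]; exists C; split => //.
- exact: (levy_measurable HC.1).
- exact: (levy_start HC.1).
- move=> t t0; apply: ae_imp (levy_cadlag HC.1) => w cC.
  apply: (small_osc_cadlag t0 cC) => e e0; have [dd d0 H] := chord_small e0.
  by exists dd => // u v u0 v0 uv; rewrite !xiE//; exact: H.
- move=> n t c th t0 tS.
  have tn : nondecreasing_seq t by apply/nondecreasing_seqP => i; exact: ltW.
  have dt i : 0 < t i.+1 - t i by rewrite subr_gt0.
  have := @levy_Ex_cos _ _ _ P C HC.1 n t (fun i => (c i)%:~R) th t0 tn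
    (fun i _ => cauchy_Ex_sin HC _ (dt i)).
  move=> ->; congr (_ * _); apply: eq_bigr => i _; rewrite (cauchy_Ex_cos HC)//.
  by rewrite -intr_norm -abszE.
Qed.

Section cvg_big.
Context {R : realType} {U : Type} {F : set_system U} {FF : Filter F}.
Variables (f : nat -> U -> R) (l : nat -> R).
Hypothesis fl : forall i, f i x @[x --> F] --> l i.

Lemma cvg_sum_ord n : \sum_(i < n) f i x @[x --> F] --> \sum_(i < n) l i.
Proof.
elim: n => [|n IH].
  by apply: (cvg_eq (@cvg_cst _ (0 : R) _ F _)) => [x|]; rewrite big_ord0.
have h : (fun x => \sum_(i < n) f i x + f n x) @ F --> \sum_(i < n) l i + l n by exact: cvgD.
by apply: (cvg_eq h) => [x|]; rewrite big_ord_recr.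
Qed.

Lemma cvg_prod_ord n : \prod_(i < n) f i x @[x --> F] --> \prod_(i < n) l i.
Proof.
elim: n => [|n IH].
  by apply: (cvg_eq (@cvg_cst _ (1 : R) _ F _)) => [x|]; rewrite big_ord0.
have h : (fun x => (\prod_(i < n) f i x) * f n x) @ F --> (\prod_(i < n) l i) * l n by exact: cvgM.
by apply: (cvg_eq h) => [x|]; rewrite big_ord_recr.
Qed.

End cvg_big.

Lemma poisson_cauchy_limit {R : realType} (m : nat) (s : R) :
  expR (- ((1 - r)^-1 * s * (1 - r ^+ m))) @[r --> (1 : R)^'-] --> expR (- (m%:R * s)).
Proof.
have h : - (s * \sum_(i < m) r ^+ i) @[r --> (1 : R)^'-] --> - (m%:R * s).
  apply: cvgN; rewrite mulrC; apply: cvgM; first exact: cvg_cst.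
  apply: cvg_at_left_filter.
  have : (fun r : R => \sum_(i < m) r ^+ i) r @[r --> (1 : R)] --> \sum_(i < m) (1 : R) ^+ i.
    by apply: (cvg_sum_ord (f := fun i r => r ^+ i)) => i; exact: exprn_continuous.
  move=> /cvg_eq; apply => //.
  by under eq_bigr do rewrite expr1n; rewrite sumr_const card_ord.
have h2 := cvg_comp _ _ h (@continuous_expR R (- (m%:R * s))).
apply: cvg_trans h2; apply: near_eq_cvg; near=> r => /=.
have r1 : 1 - r != 0 by rewrite subr_eq0 eq_sym lt_eqF//; near: r; exact: nbhs_left_lt.
congr (expR (- _)); rewrite -[1 - r ^+ m]opprB subrX1 -mulNr opprB.
by field.
Unshelve. all: by end_near. Qed.

Lemma driving_trig_poly {R : realType} {d : measure_display} {T : measurableType d}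
    (P : probability T R) (xi : R -> T -> R[i]) (Y : R -> T -> R) (a : nat -> R -> R)
    n (t : nat -> R) (p : (nat -> R) -> R) :
  driving P xi Y a -> 0 <= t 0%N -> (forall i, t i < t i.+1) -> trig_poly n p ->
  bm (fun w => p (fun i => Y (t i.+1) w - Y (t i) w)).
Proof.
move=> D t0 tS tp; apply: (trig_bm (D := fun i w => Y (t i.+1) w - Y (t i) w) tp) => i.
have ti j : 0 <= t j.
  by elim: j => // j IH; rewrite (le_trans IH)// ltW.
by apply: measurable_funB; exact: (driving_measurable D).
Qed.

(** * Convergence of trigonometric expectations *)

Section convergence.
Context {R : realType}.
Context {d : R -> measure_display} {T : forall r, measurableType (d r)}.
Variables (P : forall r, probability (T r) R) (xi : forall r, R -> T r -> R[i])
  (Y : forall r, R -> T r -> R) (a : R -> nat -> R -> R).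
Context {d' : measure_display} {T' : measurableType d'}.
Variables (P' : probability T' R) (xi' : R -> T' -> R[i]) (Y' : R -> T' -> R) (a' : nat -> R -> R).
Hypotheses (D : forall r, 0 < r < 1 -> driving (P r) (@xi r) (@Y r) (a r))
  (D' : driving P' xi' Y' a')
  (aa' : forall m s, a r m s @[r --> (1 : R)^'-] --> a' m s).

Lemma trig_poly_cvg n (t : nat -> R) p : 0 <= t 0%N -> (forall i, t i < t i.+1) ->
  trig_poly n p ->
  Ex (P r) (fun w => p (fun i => @Y r (t i.+1) w - @Y r (t i) w)) @[r --> (1 : R)^'-] -->
  Ex P' (fun w => p (fun i => Y' (t i.+1) w - Y' (t i) w)).
Proof.
move=> t0 tS.
have near01 : \forall r \near (1 : R)^'-, 0 < r < 1.
  near=> r; apply/andP; split; first by near: r; exact: nbhs_left_gt.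
  by near: r; exact: nbhs_left_lt.
elim=> [b th c|p1 p2 t1 h1 t2 h2].
  have bc d1 (T1 : measurableType d1) (P1 : probability T1 R) x1 Y1 a1 :
      driving P1 x1 Y1 a1 ->
      Ex P1 (fun w => b * cos (th + \sum_(i < n) (c i)%:~R * (Y1 (t i.+1) w - Y1 (t i) w))) =
      b * (cos th * \prod_(i < n) a1 `|c i|%N (t i.+1 - t i)).
    move=> D1; rewrite ExZ; first by rewrite (driving_trig D1).
    have := driving_trig_poly D1 t0 tS (trig_cos n 1 th c).
    by under eq_fun do rewrite mul1r.
  rewrite (bc _ _ _ _ _ _ D').
  have h : b * (cos th * \prod_(i < n) a r `|c i|%N (t i.+1 - t i)) @[r --> (1 : R)^'-] -->
      b * (cos th * \prod_(i < n) a' `|c i|%N (t i.+1 - t i)).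
    apply: cvgM; first exact: cvg_cst.
    apply: cvgM; first exact: cvg_cst.
    by apply: (cvg_prod_ord (f := fun i r => a r `|c i|%N (t i.+1 - t i))
      (l := fun i => a' `|c i|%N (t i.+1 - t i))) => i; exact: aa'.
  apply: cvg_trans h; apply: near_eq_cvg; apply: filterS near01 => r r01.
  by rewrite /= (bc _ _ _ _ _ _ (D r01)).
rewrite (ExD P' (driving_trig_poly D' t0 tS t1) (driving_trig_poly D' t0 tS t2)).
apply: cvg_trans (cvgD h1 h2); apply: near_eq_cvg; apply: filterS near01 => r r01.
by rewrite /= (ExD (P r) (driving_trig_poly (D r01) t0 tS t1) (driving_trig_poly (D r01) t0 tS t2)).
Unshelve. all: by end_near. Qed.

End convergence.

Lemma bm_sum_ord {R : realType} {d : measure_display} {S : measurableType d}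
    (F : nat -> S -> R) n :
  (forall i, (i < n)%N -> bm (F i)) -> bm (fun w => \sum_(i < n) F i w).
Proof.
elim: n => [|n IH] bF.
  by under eq_fun do rewrite big_ord0; exact: bm_cst.
under eq_fun do rewrite big_ord_recr/=; apply: bmD; last exact: bF.
by apply: IH => i i_n; apply: bF; exact: ltnW.
Qed.

Lemma Ex_sum_ord_le {R : realType} {d : measure_display} {S : measurableType d}
    (P : probability S R) (F : nat -> S -> R) n b :
  (forall i, (i < n)%N -> bm (F i) /\ Ex P (F i) <= b) ->
  Ex P (fun w => \sum_(i < n) F i w) <= n%:R * b.
Proof.
elim: n => [|n IH] bF.
  by under eq_fun do rewrite big_ord0; rewrite Ex_cst mul0r.
have bF' i : (i < n)%N -> bm (F i) /\ Ex P (F i) <= b by move=> i_n; apply: bF; exact: ltnW.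
under eq_fun do rewrite big_ord_recr/=; rewrite ExD.
- by rewrite -natr1 mulrDl mul1r lerD ?IH//; exact: (bF n (ltnSn n)).2.
- by apply: bm_sum_ord => i /bF'[].
- exact: (bF n (ltnSn n)).1.
Qed.

(** * Error bounds along one path *)

Section scheme.
Context {R : realType}.
Implicit Types (x y : nat -> R[i]) (p : R -> R[i]) (rho : R).

Lemma euler_lip_driving (h : R) x y rho z n : 0 <= h ->
  (forall k, (k < n)%N -> cabs (x k) = 1) -> (forall k, (k < n)%N -> cabs (y k) = 1) ->
  1 < rho -> rho <= cabs z ->
  cabs (euler h x z n - euler h y z n) <=
  expR (h * lipz rho *+ n) * (h * lipx rho * \sum_(k < n) cabs (x k - y k)).
Proof.
move=> h0 x1 y1 r1 rz.
have L0 := lipz_ge0 rho; have K0 := lipx_ge0 r1.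
have hL0 : 0 <= h * lipz rho by rewrite mulr_ge0.
have b0 k : 0 <= h * lipx rho * cabs (x k - y k) by rewrite !mulr_ge0 ?cabs_ge0.
have := @gronwall R (h * lipz rho) (fun k => cabs (euler h x z k - euler h y z k))
  (fun k => h * lipx rho * cabs (x k - y k)) n hL0 (fun k _ => b0 k).
rewrite /= subrr Normc.normc0 add0r -mulr_sumr => H; apply: le_trans (H _) _.
  move=> k kn.
  have -> : forall p q a b : R[i], p + h%:C * a - (q + h%:C * b) =
    (p - q) + h%:C * (a - b) by move=> *; ring.
  apply: le_trans (le_normcD _ _) _; rewrite mulrDl mul1r -addrA lerD2l.
  rewrite Normc.normcM cabs_real ger0_norm// -!mulrA -mulrDr ler_wpM2l//.
  have [xk yk] : (forall j, (j < k)%N -> cabs (x j) = 1) /\ (forall j, (j < k)%N -> cabs (y j) = 1).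
    by split=> j jk; rewrite ?x1 ?y1// (ltn_trans jk).
  apply: le_trans (cabs_tri _ (lfield (euler h y z k) (x k)) _) _; apply: lerD.
    by apply: lfield_lipz => //; [exact: x1|exact: euler_ge|exact: euler_ge].
  by apply: lfield_lipx => //; [exact: x1|exact: y1|exact: euler_ge].
by rewrite ler_wpM2r ?expDx_le// mulr_ge0 ?sumr_ge0// ?mulr_ge0// => i _; exact: cabs_ge0.
Qed.

(** A Riemann sum, with [m] points per step, for the time integral of the distance between [p] and
    its value at the later end of the current step of length [T / N]. *)
Definition osc_sum (T : R) N p m : R := T / (N * m)%:R * \sum_(k < N) \sum_(i < m)
  cabs (p (T - (k * m + i)%:R * (T / (N * m)%:R)) - p (T - (k * m)%:R * (T / (N * m)%:R))).

Variable T : R.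
Hypothesis T_gt0 : 0 < T.

Definition step_const rho z : R :=
  expR (T * lipz rho) * (T * lipz rho * (expo rho * (expR (T * expo rho) * cabs z))).

Definition osc_const rho : R := expR (T * lipz rho) * lipx rho.

Lemma step_const_ge0 rho z : 1 < rho -> 0 <= step_const rho z.
Proof.
move=> r1; have := expo_ge0 r1; have := lipz_ge0 rho => h1 h2.
by have T0 := ltW T_gt0; rewrite /step_const; nneg.
Qed.

Lemma osc_const_ge0 rho : 1 < rho -> 0 <= osc_const rho.
Proof. by move=> r1; rewrite mulr_ge0 ?expR_ge0// lipx_ge0. Qed.

Let grid (N k : nat) : (k <= N)%N -> (0 < N)%N -> 0 <= T - k%:R * (T / N%:R).
Proof.
move=> kN N0; rewrite subr_ge0 mulrCA ger_pMr// ler_pdivrMr ?ltr0n// mul1r.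
by rewrite ler_nat.
Qed.

(** The scheme with [N * m] steps is inserted between: its distance to the flow is the [e], valid
    from an index depending on the path, and its distance to the coarse scheme is given by
    [euler_refine]. *)
Lemma euler_close p w z rho N (e : R) : (forall s, 0 <= s -> cabs (p s) = 1) ->
  small_osc T p -> loewner_flow p T w z -> 1 < rho -> rho <= cabs z -> (0 < N)%N -> 0 < e ->
  exists m0 : nat, forall m, (m0 <= m)%N -> (0 < m)%N ->
    cabs (w - euler (T / N%:R) (fun k => p (T - k%:R * (T / N%:R))) z N) <=
    e + (step_const rho z * (T / N%:R) + osc_const rho * osc_sum T N p m).
Proof.
move=> p1 po pf r1 rz N0 e0.
have Dz : Delta z by apply/DeltaE; exact: lt_le_trans rz.
have [N1 H] := euler_cvg T_gt0 Dz p1 po pf e0.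
exists N1 => m Nm m0.
have Nm0 : (0 < N * m)%N by rewrite muln_gt0 N0.
have NmR : (N * m)%:R != 0 :> R by rewrite pnatr_eq0 -lt0n.
have mR : m%:R != 0 :> R by rewrite pnatr_eq0 -lt0n.
have NR : N%:R != 0 :> R by rewrite pnatr_eq0 -lt0n.
have hm : T / (N * m)%:R *+ m = T / N%:R.
  by rewrite -mulr_natr natrM; field; rewrite NR mR.
have h0 : 0 <= T / (N * m)%:R by rewrite divr_ge0 ?(ltW T_gt0).
have hT : T / (N * m)%:R *+ (N * m) = T by rewrite -mulr_natr divfK.
pose x k := p (T - k%:R * (T / (N * m)%:R)).
have x1 k : (k < N * m)%N -> cabs (x k) = 1.
  by move=> kn; apply: p1; apply: grid => //; exact: ltnW.
have := @euler_refine R (T / (N * m)%:R) x rho T z N m m0 h0 x1 r1 rz hT.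
rewrite hm.
have -> : (fun k => x (k * m)%N) = (fun k => p (T - k%:R * (T / N%:R))).
  by apply/funext => k; rewrite /x -hm mulrnAr !mulr_natl mulrnA.
move=> H2; apply: le_trans (cabs_tri _ (euler (T / (N * m)%:R) x z (N * m)) _) _.
apply: lerD.
  by apply: H => //; apply: leq_trans Nm _; exact: leq_pmull.
by apply: le_trans H2 _; rewrite mulrDr !mulrA.
Qed.

Definition scheme N x (i : nat) : R[i] := (expR (- T))%:C * euler (T / N%:R) x (zseq i) N.

Let expNT : `|expR (- T)| <= 1.
Proof. by rewrite ger0_norm ?expR_ge0// expR_le1 lerNl oppr0 ltW. Qed.

Let cabs_scale z : cabs ((expR (- T))%:C * z) <= cabs z.
Proof. by rewrite Normc.normcM cabs_real ler_piMl ?cabs_ge0. Qed.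

Lemma scheme_lip N K : exists2 L, 0 <= L & forall x y,
  (forall k, (k < N)%N -> cabs (x k) = 1) -> (forall k, (k < N)%N -> cabs (y k) = 1) ->
  l1dist K (scheme N x) (scheme N y) <= L * \sum_(k < N) cabs (x k - y k).
Proof.
pose L i := let rho := cabs (zseq i : R[i]) in
  expR (T / N%:R * lipz rho *+ N) * (T / N%:R * lipx rho).
have h0 : 0 <= T / N%:R by rewrite divr_ge0 ?(ltW T_gt0).
have L0 i : 0 <= L i.
  by rewrite mulr_ge0 ?expR_ge0// mulr_ge0// lipx_ge0// zseq_Delta.
exists (\sum_(i < K) L i); first by apply: sumr_ge0.
move=> x y x1 y1; rewrite mulr_suml; apply: ler_sum => i _.
rewrite /scheme -mulrBr; apply: le_trans (cabs_scale _) _.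
apply: (le_trans (euler_lip_driving h0 x1 y1 (zseq_Delta i) (lexx _))).
by rewrite /L !mulrA.
Qed.

Variables (p : R -> R[i]) (g : Sigma' R) (v : R[i] -> R[i]).
Hypotheses (p1 : forall s, 0 <= s -> cabs (p s) = 1) (po : small_osc T p)
  (pv : forall z, Delta z -> loewner_flow p T (v z) z)
  (gv : forall z, Delta z -> Sigma'_val g z = (expR (- T))%:C * v z).

Definition flow_lip rho : R := expR (T * lipz rho).

(** The Euler schemes satisfy this bound for every number of steps, so it survives in the limit; the
    scaling by [expR (- T) <= 1] preserves it. *)
Lemma flow_lip_class : lip_class flow_lip g.
Proof.
move=> rho r1 z w rz rw.
have [Dz Dw] : Delta z /\ Delta w by split; apply/DeltaE; exact: lt_le_trans r1 _.
rewrite !gv// -mulrBr; apply: le_trans (cabs_scale _) _.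
apply/ler_addgt0Pr => e e0; have e2 : 0 < e / 2 by rewrite divr_gt0.
have [N1 H1] := euler_cvg T_gt0 Dz p1 po (pv Dz) e2.
have [N2 H2] := euler_cvg T_gt0 Dw p1 po (pv Dw) e2.
pose N := (maxn N1 N2).+1.
have [NN1 NN2] : (N1 <= N)%N /\ (N2 <= N)%N.
  by split; apply: leqW; [exact: leq_maxl|exact: leq_maxr].
have := H1 N NN1 isT; have := H2 N NN2 isT.
set ew := euler _ _ w _; set ez := euler _ _ z _ => h2 h1.
have h3 : cabs (ez - ew) <= flow_lip rho * cabs (z - w).
  have -> : flow_lip rho = expR (T / N%:R * lipz rho *+ N).
    by rewrite /flow_lip -mulrnAl -[_ *+ N]mulr_natr divfK// pnatr_eq0.
  apply: euler_lip => //; first by rewrite divr_ge0 ?(ltW T_gt0).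
  by move=> k kN; apply: p1; apply: grid => //; exact: ltnW.
apply: le_trans (cabs_tri _ ez _) _; rewrite addrC.
apply: le_trans (lerD (cabs_tri _ ew _) h1) _.
rewrite -cabsB in h2; lra.
Qed.

Lemma scheme_close K N : (0 < N)%N ->
  forall e : R, 0 < e -> exists m0 : nat, forall m, (m0 <= m)%N -> (0 < m)%N ->
    l1dist K (evals g) (scheme N (fun k => p (T - k%:R * (T / N%:R)))) <=
    e + ((\sum_(i < K) step_const (cabs (zseq i)) (zseq i)) * (T / N%:R) +
         (\sum_(i < K) osc_const (cabs (zseq i))) * osc_sum T N p m).
Proof.
move=> N0 e e0; pose e' := e / K.+1%:R; have e'0 : 0 < e' by rewrite divr_gt0.
have /choice[m0 Hm0] : forall i : nat, exists m0 : nat, forall m, (m0 <= m)%N -> (0 < m)%N ->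
    cabs (v (zseq i) - euler (T / N%:R) (fun k => p (T - k%:R * (T / N%:R))) (zseq i) N) <=
    e' + (step_const (cabs (zseq i)) (zseq i) * (T / N%:R) +
      osc_const (cabs (zseq i)) * osc_sum T N p m).
  move=> i; have z1 := zseq_Delta (R := R) i.
  by apply: euler_close => //; apply: pv; exact/DeltaE.
exists (\max_(i < K) m0 i) => m mm m_gt0.
rewrite !mulr_suml -big_split/=.
apply: (@le_trans _ _ (\sum_(i < K) (e' + (step_const (cabs (zseq i)) (zseq i) * (T / N%:R) +
      osc_const (cabs (zseq i)) * osc_sum T N p m)))).
  apply: ler_sum => i _; rewrite /evals /scheme gv; last exact/DeltaE/zseq_Delta.
  rewrite -mulrBr; apply: le_trans (cabs_scale _) _; apply: Hm0 => //.
  by apply: leq_trans mm; exact: (leq_bigmax i).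
rewrite big_split/= lerD2r sumr_const card_ord -mulr_natr /e' mulrAC ler_pdivrMr//.
by rewrite ler_wpM2l ?(ltW e0)// ler_nat.
Qed.

End scheme.

Section lower_semicontinuity.
Context {R : realType} {d : measure_display} {S : measurableType d}.
Variable P : probability S R.

(** The remainders have controlled means but may fail to converge. The functions [min (u + rem m) 0]
    are uniformly bounded because [rem m >= 0], tend to 0 almost surely, and lie below
    [u + rem m]. *)
Lemma Ex_liminf (u : S -> R) (rem : nat -> S -> R) B : bm u -> (forall m, bm (rem m)) ->
  (forall m w, 0 <= rem m w) -> (forall m, Ex P (rem m) <= B) ->
  {ae P, forall w, forall e, 0 < e -> exists m0 : nat, forall m, (m0 <= m)%N ->
    - rem m w - e <= u w} ->
  - B <= Ex P u.
Proof.
move=> bu br r0 EB H; pose g m w := Num.min (u w + rem m w) 0.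
have bs m : bm (fun w => u w + rem m w) by exact: bmD.
have gM : exists2 M, 0 < M & forall m w, `|g m w| <= M.
  have [M M0 HM] := bm_bound bu; exists M => // m w; rewrite /g.
  have := HM w; rewrite ler_norml => /andP[h1 _].
  case: (leP (u w + rem m w) 0) => h; last by rewrite normr0 ltW.
  by rewrite ler0_norm// lerNl (le_trans h1)// lerDl.
have [M M0 HM] := gM.
have bg m : bm (g m).
  split; last by exists M.
  by apply: (measurable_minr (bs m).1); exact: measurable_cst.
have h0 : Ex P (g m) @[m --> \oo] --> (0 : R).
  rewrite -[X in _ --> X](Ex_cst P 0); apply: (Ex_cvg bg (bm_cst 0) HM).
  apply: ae_imp H => w Hw; apply/cvgrPdist_le => e e0.
  have [m0 Hm0] := Hw e e0; near=> m.
  have hm : - rem m w - e <= u w by apply: Hm0; near: m; exact: nbhs_infty_ge.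
  rewrite sub0r normrN /g; case: (leP (u w + rem m w) 0) => h; last by rewrite normr0 ltW.
  by rewrite ler0_norm// lerNl; lra.
have h1 : Ex P (g m) - B @[m --> \oo] --> 0 - B by apply: cvgB => //; exact: cvg_cst.
rewrite -sub0r; apply: (cvgr_to_le h1); near=> m.
rewrite /= lerBlDr; apply: le_trans (lerD (lexx _) (EB m)).
rewrite -ExD//; apply: Ex_le => // w.
by rewrite /g ge_min lexx.
Unshelve. all: by end_near. Qed.

End lower_semicontinuity.

(** * Mean oscillation of the driving process *)

Section driven_flow.
Context {R : realType} {d : measure_display} {S : measurableType d}.
Variables (P : probability S R) (xi : R -> S -> R[i]) (Y : R -> S -> R) (a : nat -> R -> R).
Hypotheses (D : driving P xi Y a) (a1 : forall s, 0 < s -> a 1%N s = expR (- s)).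

Lemma cabs_unit_exp_chord (x y : R) : cabs (unit_exp x - unit_exp y) = Num.sqrt (2 - 2 * cos (x - y)).
Proof. by rewrite -chord_sqr sqrtr_sqr ger0_norm// chord_ge0. Qed.

Lemma bm_oscillation s t : 0 <= s -> 0 <= t -> bm (fun w => cabs (xi t w - xi s w)).
Proof.
move=> s0 t0.
have mY : measurable_fun setT (fun w => Y t w - Y s w).
  by apply: measurable_funB; exact: (driving_measurable D).
have -> : (fun w => cabs (xi t w - xi s w)) =
    (fun w => Num.sqrt (2 - 2 * cos (Y t w - Y s w))).
  by apply/funext => w; rewrite !(driving_exp D)// cabs_unit_exp_chord.
apply: (bm_comp (f := fun x : R => Num.sqrt (2 - 2 * cos x)) _ mY); split.
  apply: continuous_measurable_fun => x; apply: continuous_comp; last exact: sqrt_continuous.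
  apply: cvgB; first exact: cvg_cst.
  by apply: cvgM; [exact: cvg_cst|exact: continuous_cos].
exists 2 => x; rewrite ger0_norm ?sqrtr_ge0// -ler_sqr ?nnegrE ?sqrtr_ge0//.
have := cos_le1 x; have := cos_geN1 x => h1 h2.
by rewrite sqr_sqrtr; lra.
Qed.

(** [chord_le] leaves only the mean cosine of the increment, which is [exp (- (t - s))] at frequency
    1. The bound thus depends on the law through [a1] only, and [eta] is kept free to be optimized
    against the mesh. *)
Lemma Ex_oscillation s t eta : 0 <= s -> s <= t -> 0 < eta ->
  Ex P (fun w => cabs (xi t w - xi s w)) <= eta + (t - s) / (2 * eta).
Proof.
move=> s0 st eta0; have t0 := le_trans s0 st.
have [->|nst] := eqVneq s t.
  rewrite subrr mul0r addr0 (_ : (fun _ => _) = fun=> 0) ?Ex_cst ?ltW//.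
  by apply/funext => w; rewrite subrr Normc.normc0.
have ts : 0 < t - s by rewrite subr_gt0 lt_neqAle nst.
(* [driving_trig] takes an infinite increasing sequence of times; only the first increment of this
   one is used. *)
pose tt i := s + i%:R * (t - s).
have tt0 : 0 <= tt 0%N by rewrite /tt mul0r addr0.
have ttS i : tt i < tt i.+1 by rewrite /tt ltrD2l ltr_pM2r// ltr_nat.
have E := driving_trig D 1 (fun=> 1) 0 tt0 ttS.
have [tt_0 tt_1] : tt 0%N = s /\ tt 1%N = t by rewrite /tt; split; ring.
rewrite !big_ord1 cos0 mul1r tt_0 tt_1 a1// in E.
have mY : measurable_fun setT (fun w => Y t w - Y s w).
  by apply: measurable_funB; exact: (driving_measurable D).
have bc : bm (fun w => cos (Y t w - Y s w)).
  apply: (bm_comp (f := cos) _ mY).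
  exact: bm_cosine.
have {}E : Ex P (fun w => cos (Y t w - Y s w)) = expR (- (t - s)).
  by rewrite -E; congr Ex; apply/funext => w; rewrite big_ord1 add0r mul1r tt_0 tt_1.
pose k := (4 * eta)^-1.
have bk : bm (fun w => (eta + 2 * k) - (2 * k) * cos (Y t w - Y s w)).
  by apply: bmB; [exact: bm_cst|exact: bmZ].
apply: (@le_trans _ _ (Ex P (fun w => (eta + 2 * k) - (2 * k) * cos (Y t w - Y s w)))).
  apply: Ex_le => //; first exact: bm_oscillation.
  move=> w; rewrite !(driving_exp D)//; apply: le_trans (chord_le _ _ eta0) _.
  by apply: eq_ler; rewrite /k; ring.
rewrite ExB ?Ex_cst ?ExZ//; [|exact: bm_cst|exact: bmZ].
rewrite E; have := expR_ge1Dx (- (t - s)).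
have -> : (t - s) / (2 * eta) = 2 * k * (t - s) by rewrite /k; field; rewrite lt0r_neq0.
have k0 : 0 < 2 * k by rewrite mulr_gt0// invr_gt0 mulr_gt0.
by move=> h; rewrite -addrA lerD2l; have := ler_wpM2l (ltW k0) h; lra.
Qed.

Variable T : R.
Hypothesis T_gt0 : 0 < T.

Let fine_grid N m k i : (0 < N)%N -> (0 < m)%N -> (k < N)%N -> (i < m)%N ->
  0 <= T - (k * m + i)%:R * (T / (N * m)%:R).
Proof.
move=> N0 m0 kN im; have Nm0 : (0 < N * m)%N by rewrite muln_gt0 N0.
rewrite subr_ge0 mulrCA ger_pMr// ler_pdivrMr ?ltr0n// mul1r ler_nat.
apply: (@leq_trans (k.+1 * m)); first by rewrite mulSn addnC leq_add2r ltnW.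
by rewrite leq_mul2r kN orbT.
Qed.

Let osc N m k i w : R :=
  cabs (xi (T - (k * m + i)%:R * (T / (N * m)%:R)) w - xi (T - (k * m)%:R * (T / (N * m)%:R)) w).

Let bm_osc N m k i : (0 < N)%N -> (0 < m)%N -> (k < N)%N -> (i < m)%N -> bm (osc N m k i).
Proof.
by move=> *; apply: bm_oscillation; [rewrite -[(k * m)%N]addn0|]; exact: fine_grid.
Qed.

Let bm_osc_row N m k : (0 < N)%N -> (0 < m)%N -> (k < N)%N ->
  bm (fun w => \sum_(i < m) osc N m k i w).
Proof. by move=> N0 m0 kN; apply: (bm_sum_ord (F := osc N m k)) => i im; exact: bm_osc. Qed.

Let bm_osc_double N m : (0 < N)%N -> (0 < m)%N ->
  bm (fun w => \sum_(k < N) \sum_(i < m) osc N m k i w).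
Proof.
move=> N0 m0; apply: (bm_sum_ord (F := fun k w => \sum_(i < m) osc N m k i w)) => k kN.
exact: bm_osc_row.
Qed.

Lemma bm_osc_sum N m : (0 < N)%N -> (0 < m)%N -> bm (fun w => osc_sum T N (xi ^~ w) m).
Proof. by move=> N0 m0; apply: bmZ; exact: bm_osc_double. Qed.

Lemma osc_sum_ge0 N m p : 0 <= osc_sum T N p m.
Proof.
rewrite mulr_ge0 ?divr_ge0 ?(ltW T_gt0)//.
by apply: sumr_ge0 => k _; apply: sumr_ge0 => i _; exact: cabs_ge0.
Qed.

Lemma Ex_osc_sum N m eta : (0 < N)%N -> (0 < m)%N -> 0 < eta ->
  Ex P (fun w => osc_sum T N (xi ^~ w) m) <= T * (eta + T / N%:R / (2 * eta)).
Proof.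
move=> N0 m0 eta0; pose b := eta + T / N%:R / (2 * eta).
have Nm0 : (0 < N * m)%N by rewrite muln_gt0 N0.
have h0 : 0 <= T / (N * m)%:R by rewrite divr_ge0 ?(ltW T_gt0).
have Eo k i : (k < N)%N -> (i < m)%N -> Ex P (osc N m k i) <= b.
  move=> kN im; rewrite /osc; under eq_fun do rewrite -cabsB.
  apply: (le_trans (@Ex_oscillation (T - (k * m + i)%:R * (T / (N * m)%:R))
    (T - (k * m)%:R * (T / (N * m)%:R)) eta _ _ eta0)).
  - exact: fine_grid.
  - by rewrite lerD2l lerN2 ler_wpM2r// ler_nat leq_addr.
  - rewrite lerD2l ler_wpM2r ?invr_ge0 ?mulr_ge0 ?(ltW eta0)//.
    rewrite opprD opprK addrACA subrr add0r addrC -mulrBl natrD addrAC subrr add0r.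
    have -> : i%:R * (T / (N * m)%:R) = T / N%:R * (i%:R / m%:R) by rewrite natrM invfM; ring.
    rewrite ler_piMr ?divr_ge0 ?(ltW T_gt0)//.
    by rewrite ler_pdivrMr ?ltr0n// mul1r ler_nat ltnW.
rewrite /osc_sum (ExZ P _ (bm_osc_double N0 m0)).
apply: (@le_trans _ _ (T / (N * m)%:R * (N%:R * (m%:R * b)))).
  rewrite ler_wpM2l//; apply: (Ex_sum_ord_le (F := fun k w => \sum_(i < m) osc N m k i w)).
  move=> k kN; split; first exact: bm_osc_row.
  apply: (Ex_sum_ord_le (F := osc N m k)) => i im; split; [exact: bm_osc|exact: Eo].
by rewrite [N%:R * _]mulrA -natrM mulrA divfK// pnatr_eq0 -lt0n.
Qed.

End driven_flow.

(** * Comparison of the flow with a finite-dimensional functional *)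

Lemma ae_and {R : realType} d (S : measurableType d) (mu : {measure set S -> \bar R})
    (A B : S -> Prop) :
  {ae mu, forall x, A x} -> {ae mu, forall x, B x} -> {ae mu, forall x, A x /\ B x}.
Proof. exact: (@filterI _ _ (ae_filter_ringOfSetsType mu)). Qed.

Section comparison.
Context {R : realType}.
Variable T : R.
Hypothesis T_gt0 : 0 < T.

Lemma euler_ext (h : R) x y (z : R[i]) n : (forall k, (k < n)%N -> x k = y k) ->
  euler h x z n = euler h y z n.
Proof.
elim: n => //= n IH xy; rewrite xy// IH// => k kn; exact: xy (leqW kn).
Qed.

(** It provides an element of the class, so that the infimum defining [lower_env] runs over a
    nonempty set. *)
Lemma idDelta_lip_class :
  lip_class (flow_lip T) (SigSub (mem_set (@idDelta_Sigma' R)) : Sigma' R).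
Proof.
move=> rho r1 z w rz rw.
have inD (u : R[i]) : rho <= cabs u -> idDelta u = u.
  by move=> ru; rewrite /idDelta ifT//; apply/DeltaE; exact: lt_le_trans r1 ru.
change (cabs (idDelta z - idDelta w) <= flow_lip T rho * cabs (z - w)).
rewrite !inD// ler_peMl ?cabs_ge0// -expR0 ler_expR mulr_ge0 ?(ltW T_gt0)//.
exact: lipz_ge0.
Qed.

Lemma chord_sum n (x y : nat -> R) :
  chord (\sum_(i < n) x i) (\sum_(i < n) y i) <= \sum_(i < n) chord (x i) (y i).
Proof.
elim: n => [|n IH]; first by rewrite !big_ord0 /chord subrr Normc.normc0.
rewrite !big_ord_recr/=; apply: le_trans (lerD IH (lexx _)).
have expD (a b : R) : unit_exp (a + b) = unit_exp a * unit_exp b.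
  by rewrite /unit_exp cosD sinD; apply/eqP; rewrite eq_complex/= eqxx addrC eqxx.
rewrite /chord !expD.
set A := unit_exp _; set B := unit_exp _; set A' := unit_exp _; set B' := unit_exp _.
apply: le_trans (cabs_tri _ (A' * B) _) _.
by rewrite -mulrBl -mulrBr !Normc.normcM !cabs_unit_exp mulr1 mul1r.
Qed.

Variables (h : Sigma' R -> R) (M : R).
Hypotheses (ch : continuous h) (hM : forall g, `|h g| <= M).

Let env := lower_env (flow_lip T) h.

(** The scheme runs backwards: its step [k] reads the driving process at time [T - k T / N], whose
    angle is the sum of the first [N - k] increments. *)
Definition grid_angles N (x : nat -> R) k : R[i] := unit_exp (\sum_(i < (N - k)%N) x i).

Definition discretized N k x := env k (scheme T N (grid_angles N x)).

Lemma discretized_lip N k : exists L, forall x y,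
  `|discretized N k x - discretized N k y| <= L * \sum_(i < N) chord (x i) (y i).
Proof.
(* The factor [k] is the slope of the envelope, and [N] appears because an increment enters at most
   [N] driving values. *)
have [L L0 HL] := scheme_lip T_gt0 N k; exists (k%:R * (L * N%:R)).
have half x y : discretized N k x - discretized N k y <=
    k%:R * (L * N%:R) * \sum_(i < N) chord (x i) (y i).
  apply: le_trans (lower_env_lip idDelta_lip_class hM _ _ _) _.
  rewrite -!mulrA ler_wpM2l//.
  apply: le_trans (HL _ _ _ _) _; try by move=> j _; exact: cabs_unit_exp.
  rewrite ler_wpM2l// -[X in X%:R * _]card_ord mulr_natl -sumr_const; apply: ler_sum => j _.
  apply: le_trans (chord_sum _ _ _) _.
  rewrite (big_ord_widen N (fun i => chord (x i) (y i)) (leq_subr j N)) big_mkcond/=.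
  by apply: ler_sum => i _; case: ifP => // _; exact: chord_ge0.
move=> x y; rewrite ler_norml half andbT lerNl opprB.
apply: le_trans (half y x) _.
by apply: eq_ler; congr (_ * _); apply: eq_bigr => i _;
  rewrite /chord cabsB.
Qed.

Section process.
Context {d : measure_display} {S : measurableType d}.
Variables (P : probability S R) (xi : R -> S -> R[i]) (Y : R -> S -> R) (a : nat -> R -> R)
  (f : S -> R -> R[i] -> R[i]) (F : {RV P >-> Borel (Sigma' R)}).
Hypotheses (D : driving P xi Y a) (a1 : forall s, 0 < s -> a 1%N s = expR (- s))
  (fP : {ae P, forall w, loewner_solution T (xi ^~ w) (f w)})
  (FP : {ae P, forall w, forall z, Delta z ->
     Sigma'_val (F w) z = (expR (- T))%:C * f w T z}).

Let measurable_F (k : Sigma' R -> R) : continuous k -> measurable_fun setT (fun w => k (F w)).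
Proof.
move=> ck; apply: (measurableT_comp (f := k : Borel (Sigma' R) -> R) (g := F)) => //.
exact: continuous_Borel.
Qed.

Lemma bm_observable : bm (fun w => h (F w)).
Proof. by split; [exact: measurable_F|exists M]. Qed.

(** The envelope is at most [M] on the Lipschitz class, to which [F w] belongs almost surely; the
    minimum makes this a bound for all [w]. *)
Let env_bound k w : `|Num.min M (env k (evals (F w)))| <= M.
Proof.
rewrite ler_norml le_min ge_min lexx/= andbT.
have M0 : 0 <= M by apply: le_trans (hM (F w)).
rewrite (lower_env_ge idDelta_lip_class hM) andbT.
by rewrite (le_trans _ M0)// oppr_le0.
Qed.

Lemma bm_env k : bm (fun w => Num.min M (env k (evals (F w)))).
Proof.
split; last by exists M.
apply: measurable_minr; first exact: measurable_cst.
apply: (measurable_F (k := fun g => env k (evals g))).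
exact: (continuous_lower_env idDelta_lip_class hM).
Qed.

Let flow : {ae P, forall w, [/\ Y 0 w = 0, small_osc T (xi ^~ w),
    forall z, Delta z -> loewner_flow (xi ^~ w) T (f w T z) z
  & forall z, Delta z -> Sigma'_val (F w) z = (expR (- T))%:C * f w T z]}.
Proof.
have H := ae_and (ae_and (driving_start D) (driving_osc D (ltW T_gt0))) (ae_and fP FP).
apply: ae_imp H => w [[h1 h2] [h3 h4]].
split=> // z Dz; apply/(loewner_inverse h3) => //.
by rewrite lexx ltW.
Qed.

Let xi1 w s : 0 <= s -> cabs (xi s w) = 1.
Proof. by move=> s0; rewrite (driving_exp D)// cabs_unit_exp. Qed.

Lemma flow_in_lip_class : {ae P, forall w, lip_class (flow_lip T) (F w)}.
Proof.
apply: ae_imp flow => w [_ osc fl Fv].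
exact: (flow_lip_class T_gt0 (@xi1 w) osc fl Fv).
Qed.

Lemma env_cvg : Ex P (fun w => Num.min M (env k (evals (F w)))) @[k --> \oo] -->
  Ex P (fun w => h (F w)).
Proof.
apply: (Ex_cvg bm_env bm_observable env_bound); apply: ae_imp flow_in_lip_class => w Fw.
apply/cvgrPdist_le => e e0.
have [k0 Hk0] := lower_env_cvg idDelta_lip_class hM ch Fw e0.
near=> k; have h1 : h (F w) - e <= env k (evals (F w)).
  by apply: Hk0; near: k; exact: nbhs_infty_ge.
have h2 := lower_env_evals idDelta_lip_class hM k Fw.
have h3 : env k (evals (F w)) <= M.
  by apply: le_trans h2 _; apply: le_trans (ler_norm _) (hM _).
by rewrite (min_idPr h3) ger0_norm ?subr_ge0// lerBlDr addrC -lerBlDr.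
Unshelve. all: by end_near. Qed.

Let time N (i : nat) : R := i%:R * (T / N%:R).

Definition mesh_error N k eta : R :=
  k%:R * ((\sum_(i < k) step_const T (cabs (zseq i)) (zseq i)) * (T / N%:R) +
          (\sum_(i < k) osc_const T (cabs (zseq i))) * (T * (eta + T / N%:R / (2 * eta)))).

(** The two halves serve different processes: the first bounds the mean of [h] from below for the
    processes indexed by [r], the second bounds the mean of the envelope from above for the Cauchy
    process. *)
Lemma Ex_discretized N k eta e p : (0 < N)%N -> 0 < eta -> trig_poly N p ->
  (forall x, `|discretized N k x - p x| <= e) ->
  Ex P (fun w => p (fun i => Y (i.+1%:R * (T / N%:R)) w - Y (i%:R * (T / N%:R)) w)) <=
    Ex P (fun w => h (F w)) + (e + mesh_error N k eta) /\
  Ex P (fun w => Num.min M (env k (evals (F w)))) <=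
    Ex P (fun w => p (fun i => Y (i.+1%:R * (T / N%:R)) w - Y (i%:R * (T / N%:R)) w)) +
    (e + mesh_error N k eta).
Proof.
move=> N0 eta0 tp pe.
have TN : 0 < T / N%:R by rewrite divr_gt0 ?ltr0n.
have t0 : 0 <= time N 0 by rewrite /time mul0r.
have tS i : time N i < time N i.+1 by rewrite /time ltr_pM2r// ltr_nat.
pose Q w := p (fun i => Y (time N i.+1) w - Y (time N i) w).
have bQ : bm Q by exact: (driving_trig_poly D t0 tS tp).
pose A : R := \sum_(i < k) step_const T (cabs (zseq i)) (zseq i).
pose B : R := \sum_(i < k) osc_const T (cabs (zseq i)).
have B0 : 0 <= B.
  by apply: sumr_ge0 => i _; rewrite osc_const_ge0// zseq_Delta.
have kB0 : 0 <= k%:R * B by rewrite mulr_ge0.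
pose rem m w := k%:R * B * osc_sum T N (xi ^~ w) m.+1.
have br m : bm (rem m) by apply: bmZ; exact: (bm_osc_sum D T_gt0).
have r0 m w : 0 <= rem m w by rewrite mulr_ge0// osc_sum_ge0.
have Er m : Ex P (rem m) <= k%:R * B * (T * (eta + T / N%:R / (2 * eta))).
  rewrite /rem ExZ; last exact: (bm_osc_sum D T_gt0).
  by rewrite ler_wpM2l//; exact: (Ex_osc_sum D a1 T_gt0).
(* The term [rem m w] need not be small along a path; only its mean, bounded independently of [m],
   enters through [Ex_liminf]. *)
have close : {ae P, forall w, lip_class (flow_lip T) (F w) /\
    forall e', 0 < e' -> exists m0 : nat, forall m, (m0 <= m)%N ->
      `|env k (evals (F w)) - Q w| <= e' + (e + k%:R * (A * (T / N%:R))) + rem m w}.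
  apply: ae_imp flow => w [Y0 osc fl Fv]; split.
    exact: (flow_lip_class T_gt0 (@xi1 w) osc fl Fv).
  move=> e' e'0; pose e1 := e' / k.+1%:R; have e10 : 0 < e1 by rewrite divr_gt0.
  have [m0 Hm0] := scheme_close T_gt0 (@xi1 w) osc fl Fv k N0 e10.
  exists m0 => m mm0; have := Hm0 m.+1 (leqW mm0) isT.
  set y := scheme _ _ _ => Hy.
  pose x i := Y (time N i.+1) w - Y (time N i) w.
  (* The increments telescope to the angle itself because [Y] starts at 0. *)
  have Ey : scheme T N (grid_angles N x) = y.
    apply/funext => i; congr (_ * _); apply: euler_ext => j jN.
    rewrite /grid_angles -(big_mkord xpredT x) telescope_sumr//.
    rewrite /time mul0r Y0 subr0 -(driving_exp D); last exact: mulr_ge0 (ler0n _ _) (ltW TN).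
    by rewrite natrB ?(ltnW jN)// mulrBl mulrCA divff ?mulr1// pnatr_eq0 -lt0n.
  have h1 : `|env k (evals (F w)) - discretized N k x| <= k%:R * l1dist k (evals (F w)) y.
    rewrite /discretized Ey ler_norml (lower_env_lip idDelta_lip_class hM) andbT.
    rewrite lerNl opprB; apply: le_trans (lower_env_lip idDelta_lip_class hM _ _ _) _.
    by rewrite ler_wpM2l//; apply: ler_sum => i _; rewrite cabsB.
  rewrite -(subrKA (discretized N k x)); apply: le_trans (ler_normD _ _) _.
  apply: le_trans (lerD h1 (pe x)) _.
  apply: le_trans (lerD (ler_wpM2l (ler0n _ k) Hy) (lexx _)) _.
  rewrite -/A -/B /rem !mulrDr.
  have : k%:R * e1 <= e'.
    rewrite /e1 mulrCA ger_pMr// ler_pdivrMr// mul1r ler_nat.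
    exact: leqnSn.
  by rewrite mulrA => h2; lra.
have hmesh : mesh_error N k eta = k%:R * (A * (T / N%:R)) +
    k%:R * B * (T * (eta + T / N%:R / (2 * eta))).
  by rewrite /mesh_error -/A -/B mulrDr [k%:R * (B * _)]mulrA.
pose c := e + k%:R * (A * (T / N%:R)).
have bc : bm (fun _ : S => c) by exact: bm_cst.
split.
  have bu : bm (fun w => h (F w) - Q w + c).
    by apply: bmD => //; apply: bmB => //; exact: bm_observable.
  have H : {ae P, forall w e', 0 < e' -> exists m0 : nat, forall m, (m0 <= m)%N ->
      - rem m w - e' <= h (F w) - Q w + c}.
    apply: ae_imp close => w [lw H] e' e'0; have [m0 Hm0] := H e' e'0.
    exists m0 => m mm0; have := lower_env_evals idDelta_lip_class hM k lw.
    have := Hm0 m mm0; rewrite ler_norml -/c -/env => /andP[h1 _]; lra.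
  have := Ex_liminf bu br r0 Er H.
  rewrite ExD ?ExB ?Ex_cst//; [|exact: bm_observable|apply: bmB => //; exact: bm_observable].
  rewrite -/(Ex P Q) hmesh /c; lra.
have bu : bm (fun w => Q w - Num.min M (env k (evals (F w))) + c).
  by apply: bmD => //; apply: bmB => //; exact: bm_env.
have H : {ae P, forall w e', 0 < e' -> exists m0 : nat, forall m, (m0 <= m)%N ->
    - rem m w - e' <= Q w - Num.min M (env k (evals (F w))) + c}.
  apply: ae_imp close => w [lw H] e' e'0; have [m0 Hm0] := H e' e'0.
  exists m0 => m mm0; have h2 : Num.min M (env k (evals (F w))) <= env k (evals (F w)).
    by rewrite ge_min lexx orbT.
  have := Hm0 m mm0; rewrite ler_norml -/c => /andP[_ h1]; lra.
have := Ex_liminf bu br r0 Er H.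
rewrite ExD ?ExB ?Ex_cst//; [|exact: bm_env|apply: bmB => //; exact: bm_env].
rewrite -/(Ex P Q) hmesh /c; lra.
Qed.

End process.

End comparison.

(** * Passage to the limit *)

Section convergence_in_law.
Context {R : realType}.
Variable T : R.
Hypothesis T_gt0 : 0 < T.

(** [eta] is fixed first, against the term free of [N]; [N] then absorbs the terms in [T / N], one
    of which carries [1 / eta]. *)
Lemma mesh_error_small k (e : R) : 0 < e ->
  exists N eta, [/\ (0 < N)%N, 0 < eta & mesh_error T N k eta <= e].
Proof.
move=> e0; rewrite /mesh_error.
set A := \sum_(i < k) _; set B := \sum_(i < k) _.
have A0 : 0 <= A by apply: sumr_ge0 => i _; rewrite step_const_ge0// zseq_Delta.
have B0 : 0 <= B by apply: sumr_ge0 => i _; rewrite osc_const_ge0// zseq_Delta.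
have T0 := ltW T_gt0.
have c0 : 0 <= k%:R * (B * T) by rewrite !mulr_ge0.
pose eta := e / (2 * (k%:R * (B * T) + 1)).
have c1 : 0 < k%:R * (B * T) + 1 by rewrite ltr_wpDl.
have eta0 : 0 < eta by rewrite divr_gt0// mulr_gt0.
pose C := k%:R * (A * T + B * (T * (T / (2 * eta)))).
have h1 : k%:R * (B * T) * eta <= e / 2.
  have -> : k%:R * (B * T) * eta = e / 2 * (k%:R * (B * T) / (k%:R * (B * T) + 1)).
    by rewrite /eta; field; rewrite lt0r_neq0.
  by rewrite ler_piMr ?divr_ge0 ?(ltW e0)// ler_pdivrMr// mul1r lerDl.
pose N := (Num.truncn (C / (e / 2))).+1.
have N0 : 0 < N%:R :> R by rewrite ltr0n.
have h2 : C / N%:R <= e / 2.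
  by rewrite ler_pdivrMr// mulrC -ler_pdivrMr ?divr_gt0// ltW// truncnS_gt.
exists N, eta; split => //.
have -> : k%:R * (A * (T / N%:R) + B * (T * (eta + T / N%:R / (2 * eta)))) =
    k%:R * (B * T) * eta + C / N%:R by rewrite /C; ring.
by rewrite [e]splitr; exact: lerD.
Qed.

Variables (d : R -> measure_display) (Omega : forall r, measurableType (d r))
  (P : forall r, probability (Omega r) R) (xi : forall r, R -> Omega r -> R[i])
  (Y : forall r, R -> Omega r -> R) (a : R -> nat -> R -> R)
  (f : forall r, Omega r -> R -> R[i] -> R[i])
  (F : forall r, {RV (P r) >-> Borel (Sigma' R)}).
Hypotheses (D : forall r, 0 < r < 1 -> driving (P r) (@xi r) (@Y r) (a r))
  (a1 : forall r s, 0 < r < 1 -> 0 < s -> a r 1%N s = expR (- s))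
  (fP : forall r, 0 < r < 1 -> {ae P r, forall w, loewner_solution T (@xi r ^~ w) (f w)})
  (FP : forall r, 0 < r < 1 -> {ae P r, forall w, forall z, Delta z ->
    Sigma'_val (F r w) z = (expR (- T))%:C * f w T z}).
Variables (d' : measure_display) (Omega' : measurableType d')
  (P' : probability Omega' R) (xi' : R -> Omega' -> R[i])
  (Y' : R -> Omega' -> R) (a' : nat -> R -> R)
  (f' : Omega' -> R -> R[i] -> R[i]) (F' : {RV P' >-> Borel (Sigma' R)}).
Hypotheses (D' : driving P' xi' Y' a') (a1' : forall s, 0 < s -> a' 1%N s = expR (- s))
  (f'P : {ae P', forall w, loewner_solution T (xi' ^~ w) (f' w)})
  (F'P : {ae P', forall w, forall z, Delta z ->
    Sigma'_val (F' w) z = (expR (- T))%:C * f' w T z}).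
Hypothesis aa' : forall m s, a r m s @[r --> (1 : R)^'-] --> a' m s.

Lemma lower_limit (h : Sigma' R -> R) M : continuous h -> (forall g, `|h g| <= M) ->
  forall e, 0 < e -> \forall r \near (1 : R)^'-,
    Ex P' (fun w => h (F' w)) - e <= Ex (P r) (fun w => h (F r w)).
Proof.
(* Six losses: the choice of [k], the trigonometric approximation and the mesh error once for each
   of the two processes, and the convergence of the trigonometric expectations. *)
move=> ch hM e e0; pose e6 := e / 6; have e60 : 0 < e6 by rewrite divr_gt0.
have [k Hk] : exists k, Ex P' (fun w => h (F' w)) - e6 <=
    Ex P' (fun w => Num.min M (lower_env (flow_lip T) h k (evals (F' w)))).
  have /cvgrPdist_le/(_ _ e60)[k0 _ Hk0] := env_cvg T_gt0 ch hM D' f'P F'P.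
  exists k0; have := Hk0 k0 (leqnn k0); rewrite ler_norml => /andP[_ h1]; lra.
have [N [eta [N0 eta0 small]]] := mesh_error_small k e60.
have [L HL] := discretized_lip T_gt0 hM N k.
have [p tp Hp] := trig_approx HL e60.
have TN : 0 < T / N%:R by rewrite divr_gt0 ?ltr0n.
have t0 : 0 <= 0%:R * (T / N%:R) by rewrite mul0r.
have tS i : i%:R * (T / N%:R) < i.+1%:R * (T / N%:R) by rewrite ltr_pM2r// ltr_nat.
have Q := trig_poly_cvg D D' aa' (t := fun i => i%:R * (T / N%:R)) t0 tS tp.
have [_ h1] := Ex_discretized T_gt0 ch hM D' a1' f'P F'P N0 eta0 tp Hp.
have /cvgrPdist_le/(_ _ e60) := Q; apply: filter_app.
have near01 : \forall r \near (1 : R)^'-, 0 < r < 1.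
  near=> r; apply/andP; split; first by near: r; exact: nbhs_left_gt.
  by near: r; exact: nbhs_left_lt.
apply: filterS near01 => r r01; rewrite ler_norml => /andP[_ h2].
have a1r s : 0 < s -> a r 1%N s = expR (- s) by exact: a1.
have [h3 _] := Ex_discretized T_gt0 ch hM (D r01) a1r (fP r01) (FP r01) N0 eta0 tp Hp.
have : e = 6 * e6 by rewrite /e6 mulrC divfK.
move: h1 h2 h3 Hk small; lra.
Unshelve. all: by end_near. Qed.

Lemma law_cvg : weakly_cvg 1^'- (fun r => distribution (P r) (F r)) (distribution P' F').
Proof.
move=> h ch bh; have [M _ hM] : exists2 M, 0 < M & forall g, `|h g| <= M.
  have /pinfty_ex_gt0[M M0 HM] := bh; exists M => // g; exact: HM.
have integralE d0 (S : measurableType d0) (P0 : probability S R)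
    (F0 : {RV P0 >-> Borel (Sigma' R)}) :
    (\int[distribution P0 F0]_x (h x)%:E = (Ex P0 (fun w => h (F0 w)))%:E)%E.
  have bF := bm_observable ch hM F0.
  rewrite integral_distribution.
  - by rewrite -EFin_Ex.
  - by apply/measurable_EFinP; exact: continuous_Borel.
  - exact: bm_integrable.
rewrite integralE; under eq_fun do rewrite integralE.
apply: cvg_EFin; first by near=> r.
apply/cvgrPdist_le => e e0.
have := lower_limit ch hM e0.
have chN : continuous (fun g => - h g) by move=> g; exact: (cvgN (ch g)).
have hMN g : `|- h g| <= M by rewrite normrN.
have := lower_limit chN hMN e0.
apply: filter_app2; near=> r => h1 h2.
have ExN d0 (S : measurableType d0) (P0 : probability S R)
    (F0 : {RV P0 >-> Borel (Sigma' R)}) :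
    Ex P0 (fun w => - h (F0 w)) = - Ex P0 (fun w => h (F0 w)).
  rewrite -mulN1r -ExZ; last exact: (bm_observable ch hM F0).
  by congr Ex; apply/funext => w; rewrite mulN1r.
by move: h1; rewrite !ExN /= ler_norml => h1; apply/andP; split; lra.
Unshelve. all: by end_near. Qed.

End convergence_in_law.

Theorem proposition4p3 (R : realType) (T : R) (T_gt0 : 0 < T)
  (* the driving processes xi_r, with solutions f_t^r and the Sigma'-valued
     random variables e^{-T} f_T^r *)
  (d : R -> measure_display) (Omega : forall r, measurableType (d r))
  (P : forall r, probability (Omega r) R)
  (xi : forall r, R -> Omega r -> R[i])
  (f : forall r, Omega r -> R -> R[i] -> R[i])
  (F : forall r, {RV (P r) >-> Borel (Sigma' R)})
  (xiP : forall r, 0 <= r < 1 ->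
    compound_poisson_driving (P r) r (1 - r)^-1 (xi r))
  (fP : forall r, 0 <= r < 1 ->
    {ae P r, forall w, loewner_solution T (xi r ^~ w) (f r w)})
  (FP : forall r, 0 <= r < 1 ->
    {ae P r, forall w, forall z, Delta z ->
      Sigma'_val (F r w) z = (expR (- T))%:C * f r w T z})
  (* the same for the unimodular Cauchy process *)
  (d' : measure_display) (Omega' : measurableType d')
  (P' : probability Omega' R)
  (xi' : R -> Omega' -> R[i])
  (f' : Omega' -> R -> R[i] -> R[i])
  (F' : {RV P' >-> Borel (Sigma' R)})
  (xi'P : unimodular_cauchy_driving P' xi')
  (f'P : {ae P', forall w, loewner_solution T (xi' ^~ w) (f' w)})
  (F'P : {ae P', forall w, forall z, Delta z ->
    Sigma'_val (F' w) z = (expR (- T))%:C * f' w T z}) :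
  weakly_cvg 1^'- (fun r => distribution (P r) (F r)) (distribution P' F').
Proof.
have lambda_gt0 (r : R) : 0 < r < 1 -> 0 < (1 - r)^-1 by case/andP=> _ r1; rewrite invr_gt0 subr_gt0.
pose a r (m : nat) (s : R) := expR (- ((1 - r)^-1 * s * (1 - r ^+ m))).
have r01W (r : R) : 0 < r < 1 -> 0 <= r < 1 by case/andP=> /ltW -> ->.
have exY (r : R) (r01 : 0 < r < 1) := compound_driving r01 (lambda_gt0 r r01) (xiP r (r01W r r01)).
(* An angle process is chosen for each [r] in []0, 1[]; elsewhere a dummy value is taken, which the
   filter [1^'-] does not see. *)
pose Y (r : R) : R -> Omega r -> R := if pselect (0 < r < 1) is left r01 then projT1 (cid (exY r r01))
  else fun _ _ => 0.
have D (r : R) : 0 < r < 1 -> driving (P r) (xi r) (@Y r) (a r).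
  by move=> r01; rewrite /Y; case: pselect => // r01'; case: cid.
have [Y' D'] := cauchy_driving xi'P.
apply: (@law_cvg R T T_gt0 d Omega P xi Y a f F D _ _ _ d' Omega' P' xi' Y' _ f' F' D') => //.
(* At frequency 1 the factor [1 - r] cancels the intensity, which is the source of all uniformity in
   [r]. *)
- move=> r s /andP[_ r1] s0; rewrite /a expr1 mulrAC mulVf ?mul1r//.
  by rewrite subr_eq0 eq_sym lt_eqF.
- by move=> r r01; exact: fP r (r01W r r01).
- by move=> r r01; exact: FP r (r01W r r01).
- by move=> s s0; rewrite mul1r.
- by move=> m s; exact: poisson_cauchy_limit.
Qed.
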